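(* Let $n,d\ge 1$ be integers. The Hilbert series of $R_{n,n+2,d}$ is given by the polynomial \[\sum_{i=0}^{D_{n,n+2,d}} a_i t^i,\] where \[a_i=\sum_{r=0}^{\lfloor (n-1)/2\rfloor}\ \sum_{k=0}^{n-1-2r}(-1)^k\binom{n+2}{k}\binom{-nrd+nr+2ir-2rd-kd+n+i-1}{n-1},\] and where \[D_{n,n+2,d}=\begin{cases}(n+1)(d-1)/2 & \text{if } n \text{ is odd},\\[2pt] \left\lfloor \dfrac{n(n+2)(d-1)}{2(n+1)}\right\rfloor & \text{if } n\text{ is even}.\end{cases}\]
   Context: Let $\Bbbk$ be a field of characteristic zero and $S=\Bbbk[x_1,\ldots,x_n]$ with the standard grading. For positive integers $n,m,d$, $R_{n,m,d}=S/(\ell_1^d,\ldots,\ell_m^d)$, where $\ell_1,\ldots,\ell_m$ are general linear forms, i.e. statements hold for all $(\ell_1,\dots,\ell_m)$ in some nonempty Zariski open subset of $(S_1)^m$. The Hilbert series of a standard graded algebra $A$ is $\sum_i \dim_\Bbbk(A_i)t^i$. $D_{n,m,d}$ denotes the degree of the Hilbert series (a polynomial) of $R_{n,m,d}$. Binomial coefficients: $\binom{a}{b}=0$ whenever $b<0$, or $a<0$ and $b>0$ (and, as usual, when $0\le a<b$). *)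

(* Defs.v *)
From HB Require Import structures.
From mathcomp Require Import all_boot all_order all_algebra.
From mathcomp Require Import mpoly.

Set Implicit Arguments.
Unset Strict Implicit.
Unset Printing Implicit Defensive.

Import Order.TTheory GRing.Theory Num.Theory.
Local Open Scope ring_scope.

(* A point of (S_1)^m is encoded by its coefficient matrix A : 'M_(m, n), whose
   j-th row lists the coefficients of the j-th linear form. *)
Definition linform (K : fieldType) (m n : nat) (A : 'M[K]_(m, n)) (j : 'I_m) :
    {mpoly K[n]} :=
  \sum_(i < n) A j i *: 'X_i.

(* The complement of the common zero locus of a set F of polynomials in the
   m * n coefficients. *)
Definition zariski_open (K : fieldType) (m n : nat)
    (U : 'M[K]_(m, n) -> Prop) : Prop :=
  exists F : {mpoly K[(m * n)%N]} -> Prop,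
    forall A, U A <-> exists2 f, F f & f.@[fun k => mxvec A 0 k] != 0.

Definition for_general (K : fieldType) (m n : nat)
    (P : 'M[K]_(m, n) -> Prop) : Prop :=
  exists U : 'M[K]_(m, n) -> Prop,
    [/\ zariski_open U, exists A, U A & forall A, U A -> P A].

Definition ideal_gen (K : fieldType) (m n : nat) (g : 'I_m -> {mpoly K[n]})
    (p : {mpoly K[n]}) : Prop :=
  exists q : 'I_m -> {mpoly K[n]}, p = \sum_(j < m) q j * g j.

(* The ideal (l_1^d, ..., l_m^d). *)
Definition power_ideal (K : fieldType) (m n : nat) (A : 'M[K]_(m, n))
    (d : nat) : {mpoly K[n]} -> Prop :=
  ideal_gen (fun j => linform A j ^+ d).

(* dim_K (S/I)_i = h, for I a homogeneous ideal: some h forms of degree i have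
   classes modulo I that are a basis of (S/I)_i = S_i / (I \cap S_i). *)
Definition has_graded_dim (K : fieldType) (n : nat) (I : {mpoly K[n]} -> Prop)
    (i h : nat) : Prop :=
  exists b : 'I_h -> {mpoly K[n]},
    (forall j, b j \is i.-homog) /\
    (forall p : {mpoly K[n]}, p \is i.-homog ->
       exists! c : 'rV[K]_h, I (p - \sum_(j < h) c 0 j *: b j)).

(* The Hilbert series of S/I is the polynomial H. *)
Definition has_hilbert_series (K : fieldType) (n : nat)
    (I : {mpoly K[n]} -> Prop) (H : {poly int}) : Prop :=
  forall i : nat, exists2 h : nat, has_graded_dim I i h & H`_i = h%:Z.

(* For a < 0 this is 0 unless b = 0, and not the usual polynomial extension
   (-1)^b * 'C(b - a - 1, b). *)
Definition binz (a : int) (b : nat) : int :=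
  match a with
  | Posz a' => 'C(a', b)%:Z
  | Negz _ => (b == 0%N)%:Z
  end.

Definition hcoef (n d i : nat) : int :=
  \sum_(0 <= r < (n.-1 %/ 2).+1%N) \sum_(0 <= k < (n.-1 - 2 * r).+1%N)
    (-1) ^+ k * 'C((n + 2)%N, k)%:Z *
    binz (- (n%:Z * r%:Z * d%:Z) + n%:Z * r%:Z + 2 * i%:Z * r%:Z
          - 2 * r%:Z * d%:Z - k%:Z * d%:Z + n%:Z + i%:Z - 1) n.-1.

Definition hdeg (n d : nat) : nat :=
  if odd n then ((n + 1) * (d - 1) %/ 2)%N
  else (n * (n + 2) * (d - 1) %/ (2 * (n + 1)))%N.

(* Main.v *)
Require Import Defs.
From Stdlib Require Classical_Prop.
From mathcomp Require Import all_boot all_order all_algebra.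
From mathcomp Require Import mpoly.
From mathcomp Require Import ssrcomplements.
From mathcomp Require Import zify ring.

(** Put e = d - 1.  After a linear change of variables the first n forms are
    X_1, ..., X_n, and only two general forms P = \sum_k P_k X_k and
    Q = \sum_k Q_k X_k remain.  The proof exhibits a monomial basis of the
    quotient.  A monomial m is valid when, from the left,
    m_i <= e and m_i <= mu_i, where mu_i = i e - 2 \sum_(p < i) m_p, and
    when the same holds with the variables read from right to left.  In other
    words, mu is a walk made of Clebsch-Gordan steps for sl2, the irreducible
    representation of highest weight e being tensored at each step.  The claim
    is that the valid monomials of degree i give the dimension in degree i.

    The upper and the lower bound come from one degeneration.  Let P_k and Q_k
    be polynomials in a parameter tau whose degrees are M^(n-k+1) and M^k,
    for a large M.  An element of K[tau][X_1, ..., X_n] is dominant at m when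
    the coefficient of m has the largest degree in tau, strictly.

    Spanning: if m is not valid, then the ideal has an element dominant at m
    ([invalid_dominant]).  The degrees in tau are lexicographic weights, so this
    says that m is a leading monomial of the ideal of the X_k^d and P^d, or of
    the X_k^d and Q^d in the reversed order ([left_lead]); the variables are
    crossed one at a time, each crossing being a statement about complete
    intersections in two variables ([two_variables]).  Hence invalid monomials
    reduce to valid ones for one choice of forms, and so for general forms
    ([span_open]).

    Independence: a form g killed by the d-th powers of the derivations along
    P, Q and the variables is orthogonal to the ideal for the apolarity pairing.
    For each valid m there is such a form dominant at m ([valid_dominant]).
    Leibniz' rule makes exponents add up under products of such forms, and the
    walk of m is a sum of walks in {0, 1}; for these the form is a determinant
    of Vandermonde type.  The functionals so obtained bound the rank of the
    ideal for generic tau, therefore also at tau = 0, where the two forms are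
    arbitrary ([indep_normal]).  Both halves give [generic_graded_dim].

    Counting: for monomials of degree i the conditions from the right confine
    the walk to [0, l], where l = (n + 2) e - 2 i, and the reflection principle
    counts such walks: their number is the sum of the coefficients of
    (1 + X + ... + X^e)^(n+2) over one residue class modulo l + 2, minus the sum
    over the preceding class.  By symmetry of the coefficients this is
    \sum_(r >= 0) of the coefficient of X^(i - r (l + 2)) in
    (1 - X)^2 (1 + X + ... + X^e)^(n+2) = (1 - X^d)^(n+2) / (1 - X)^n
    ([card_valid_set_coefz]), and the binomial expansion is the formula for a_i.
    When i is at most the announced degree, the terms that the formula omits
    vanish ([hdeg_truncation]); that degree is the last one in which the strip
    [0, l] leaves room for a walk ([valid_set_hdeg], [valid_set_hdeg_neq0]). *)

Set Implicit Arguments.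
Unset Strict Implicit.
Unset Printing Implicit Defensive.

Import Order.TTheory GRing.Theory Num.Theory.
Local Open Scope ring_scope.

(** * Complete intersections in two variables *)
Section TwoVariables.

Variables (K : fieldType) (charK : [pchar K] =i pred0).

Lemma size_exp_Xadd1 (k : nat) : size (('X + 1 : {poly K}) ^+ k) = k.+1.
Proof. by rewrite -polyC1 -[1%:P]opprK -polyCN size_exp_XsubC. Qed.

Lemma dvdp_derivn_exp (q p : {poly K}) (m a : nat) :
  (a <= m)%N -> (q ^+ (m - a) %| (p * q ^+ m)^`(a)).
Proof.
elim: a m p => [|a IHa] m p lt_am; first by rewrite subn0 derivn0 dvdp_mull.
have -> : (p * q ^+ m)^`(a.+1) = ((p^`() * q + p * q^`() *+ m) * q ^+ m.-1)^`(a).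
  rewrite derivSn derivM deriv_exp; congr (derivn a _).
  case: m lt_am => // m _; rewrite exprS /= mulrDl mulrnAr mulrnAl.
  by rewrite !mulrA.
by case: m lt_am => // m; rewrite subSS => /IHa; apply.
Qed.

(** The a-th derivative of f = al (X + 1)^(mu+1) is divisible by X^(lam+1-a),
    as f has no coefficient from a to lam, and by (X + 1)^(mu+1-a).  Its degree
    is too small for both, so f has degree less than a <= mu and cannot be a
    nonzero multiple of (X + 1)^(mu+1). *)
Lemma window_coefs_eq0 (mu lam a : nat) (al : {poly K}) :
  (a <= mu)%N -> (a <= lam)%N -> (size al <= (lam - a).+1)%N ->
  (forall k, (a <= k <= lam)%N -> (al * ('X + 1) ^+ mu.+1)`_k = 0) -> al = 0.
Proof.
move=> le_amu le_alam szal al0.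
have natr_neq0 k : (0 < k)%N -> k%:R != 0 :> K.
  by move=> k_gt0; rewrite ((pcharf0P K).1 charK) -lt0n.
pose y : {poly K} := 'X + 1.
have y_neq0 k : y ^+ k != 0 by rewrite expf_neq0 // -size_poly_eq0 /y -polyC1 size_XaddC.
have size_y k : size (y ^+ k) = k.+1 := size_exp_Xadd1 k.
pose f : {poly K} := al * y ^+ mu.+1.
have szf : (size f <= lam + mu - a + 2)%N.
  apply: leq_trans (size_polyMleq _ _) _; rewrite size_y; lia.
have g0 : f^`(a) = 0.
  apply/eqP/negPn/negP=> g_neq0.
  have dvX : 'X^(lam.+1 - a) %| f^`(a).
    rewrite -(subr0 'X) -polyC0; apply/dvdpP.
    exists (\poly_(i < size f) (f^`(a))`_(i + (lam.+1 - a))).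
    apply/polyP=> k; rewrite polyC0 subr0 coefMXn coef_poly.
    case: ltnP => [lt_k|le_k].
      rewrite coef_derivn al0 ?mul0rn //; lia.
    case: ltnP => [_|le2]; first by rewrite subnK.
    by rewrite coef_derivn nth_default ?mul0rn //; apply: leq_trans le2 _; lia.
  have dvY : y ^+ (mu.+1 - a) %| f^`(a) by apply: dvdp_derivn_exp; lia.
  have dvXY : 'X^(lam.+1 - a) * y ^+ (mu.+1 - a) %| f^`(a).
    rewrite Gauss_dvdp ?dvX ?dvY //.
    apply/coprimep_expl/coprimep_expr.
    rewrite coprimep_sym -['X]subr0 -polyC0 coprimep_XsubC /root /y !hornerE.
    exact: oner_neq0.
  have := dvdp_leq g_neq0 dvXY.
  have szg : (size f^`(a) <= size f - a)%N.
    by apply/leq_sizeP=> k; rewrite leq_subLR => le_k; rewrite coef_derivn nth_default ?mul0rn.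
  rewrite size_proper_mul ?size_polyXn ?size_y; last first.
    by rewrite lead_coefXn mul1r lead_coef_eq0.
  move=> /leq_trans/(_ szg)/leq_trans/(_ (leq_sub2r a szf)); lia.
have szfa : (size f <= a)%N.
  apply/leq_sizeP=> k le_k; have := congr1 (fun p : {poly K} => p`_(k - a)) g0.
  rewrite coef_derivn coef0 subnKC // -mulr_natr => /eqP.
  by rewrite mulf_eq0 orbC (negbTE (natr_neq0 _ _)) ?ffact_gt0 // => /eqP.
apply/eqP/negPn/negP=> al_neq0.
have : (size (y ^+ mu.+1) <= size f)%N.
  by apply: dvdp_leq; rewrite ?mulf_neq0 // dvdp_mull.
by rewrite size_y => /leq_trans/(_ szfa); move: le_amu; clear; lia.
Qed.

(** Reading off the coefficients from a to lam is a square linear system in the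
    coefficients of al, injective by [window_coefs_eq0]. *)
Lemma window_poly (mu lam a : nat) :
  (a <= mu)%N -> (a <= lam)%N ->
  exists al : {poly K}, [/\ (size al <= (lam - a).+1)%N,
    (al * ('X + 1) ^+ mu.+1)`_a = 1 &
    forall k, (a < k <= lam)%N -> (al * ('X + 1) ^+ mu.+1)`_k = 0].
Proof.
move=> le_amu le_alam; pose r := (lam - a).+1.
pose cf (al : {poly K}) (j : 'I_r) := (al * ('X + 1) ^+ mu.+1)`_(a + j).
pose M : 'M[K]_r := \matrix_(i, j) cf 'X^i j.
have cfE (v : 'rV[K]_r) j : (v *m M) 0 j = cf (rVpoly v) j.
  rewrite mxE /cf (_ : rVpoly v = \sum_i v 0 i *: 'X^i); last first.
    by rewrite /rVpoly poly_def; apply: eq_bigr => i _; rewrite valK.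
  rewrite mulr_suml coef_sum; apply: eq_bigr=> i _.
  by rewrite mxE /cf -scalerAl coefZ.
have uM : M \in unitmx.
  rewrite -row_free_unit -kermx_eq0; apply/eqP/row_matrixP=> i; rewrite row0.
  have /sub_kermxP := row_sub i (kermx M); set v := row i _ => v0.
  rewrite -(rVpolyK v) (@window_coefs_eq0 mu lam a (rVpoly v)) ?linear0 //.
    exact: size_poly.
  move=> k /andP[le_ak le_kl]; have lt_kr : (k - a < r)%N by rewrite /r; lia.
  have := congr1 (fun m : 'rV_r => m 0 (Ordinal lt_kr)) v0.
  by rewrite cfE mxE /cf /= subnKC.
pose v := delta_mx 0 0 *m invmx M : 'rV[K]_r.
have vM : v *m M = delta_mx 0 0 by rewrite mulmxKV.
exists (rVpoly v); split; first exact: size_poly.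
  by have := cfE v 0; rewrite vM mxE !eqxx /cf addn0 => <-.
move=> k /andP[lt_ak le_kl]; have lt_kr : (k - a < r)%N by rewrite /r; lia.
have := cfE v (Ordinal lt_kr); rewrite vM mxE /cf /= subnKC; last exact: ltnW.
by move=> <-; case: eqP => // /(congr1 val) /=; lia.
Qed.

Definition homogenize (R : comAlgType K) (x w : R) (r : nat) (p : {poly K}) : R :=
  \sum_(k < r.+1) p`_k *: (x ^+ k * w ^+ (r - k)).

Lemma homogenizeM1 (R : comAlgType K) (x w : R) r (p : {poly K}) :
  (size p <= r.+1)%N ->
  homogenize x w r.+1 (p * ('X + 1)) = homogenize x w r p * (x + w).
Proof.
move=> szp; rewrite /homogenize [RHS]mulrDr.
have -> : (\sum_(k < r.+1) p`_k *: (x ^+ k * w ^+ (r - k))) * x =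
  \sum_(k < r.+2) (p * 'X)`_k *: (x ^+ k * w ^+ (r.+1 - k)).
  rewrite [RHS]big_ord_recl coefMX /= scale0r add0r mulr_suml.
  apply: eq_bigr=> i _; rewrite coefMX /= -scalerAl subSS; congr (_ *: _).
  by rewrite /bump add1n exprSr mulrAC.
have -> : (\sum_(k < r.+1) p`_k *: (x ^+ k * w ^+ (r - k))) * w =
  \sum_(k < r.+2) p`_k *: (x ^+ k * w ^+ (r.+1 - k)).
  rewrite [RHS]big_ord_recr /= nth_default // scale0r addr0 mulr_suml.
  apply: eq_bigr=> i _; rewrite -scalerAl subSn; last by rewrite -ltnS.
  by rewrite exprSr mulrA.
rewrite -big_split; apply: eq_bigr=> i _.
by rewrite mulrDr mulr1 coefD scalerDl.
Qed.

Lemma homogenizeM (R : comAlgType K) (x w : R) r (p : {poly K}) s :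
  (size p <= r.+1)%N ->
  homogenize x w (r + s) (p * ('X + 1) ^+ s) = homogenize x w r p * (x + w) ^+ s.
Proof.
move=> szp; elim: s => [|s IHs]; first by rewrite addn0 !mulr1.
rewrite !exprSr !mulrA addnS homogenizeM1 ?IHs //.
by apply: leq_trans (size_polyMleq _ _) _; rewrite size_exp_Xadd1; lia.
Qed.

(** Among the monomials of its degree, ordered by the power of x, the monomial
    on the left is the leading monomial of an element of the ideal of
    (x + w)^(mu+1) and x^(lam+1): homogenize the polynomial of [window_poly],
    which cancels the powers of x strictly between a and lam+1.  The first
    cofactor is explicit because [left_lead] needs a bound on its weight. *)
Lemma two_variables (R : comAlgType K) (x w : R) (mu lam a : nat) :
  (a <= mu)%N -> (a <= lam)%N ->
  exists (al c : nat -> K) (be : R),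
    x ^+ a * w ^+ (mu + lam - 2 * a).+1 =
      (\sum_(k < (lam - a).+1) al k *: (x ^+ k * w ^+ (lam - a - k))) * (x + w) ^+ mu.+1
      + be * x ^+ lam.+1
      + \sum_(k < a) c k *: (x ^+ k * w ^+ (mu + lam - a - k).+1).
Proof.
move=> le_amu le_alam; have [al [szal al_a al_0]] := window_poly le_amu le_alam.
have := homogenizeM x w mu.+1 szal.
set f := al * _ in al_a al_0 *; rewrite {1}/homogenize.
rewrite -(big_mkord xpredT (fun k => f`_k *: (x ^+ k * w ^+ ((lam - a) + mu.+1 - k)))).
rewrite (big_cat_nat (n:=a)) //=; last by lia.
rewrite (big_cat_nat (m:=a) (n:=lam.+1)) //=; try lia.
rewrite [X in _ + (X + _)]big_ltn //.
rewrite al_a scale1r [X in _ + (_ + X + _)]big1_seq ?addr0; last first.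
  move=> k; rewrite mem_index_iota => lt_k; rewrite al_0 ?scale0r //; lia.
rewrite !big_mkord => E.
exists (fun k => al`_k), (fun k => - f`_k),
  (- \sum_(lam.+1 <= k < (lam - a + mu.+1).+1) f`_k *: (x ^+ (k - lam.+1) * w ^+ (lam - a + mu.+1 - k))).
rewrite -[X in X * (x + w) ^+ _]/(homogenize x w (lam - a) al) -E.
rewrite mulNr mulr_suml.
rewrite [X in - X](_ : _ = \sum_(lam.+1 <= i < (lam - a + mu.+1).+1)
  f`_i *: (x ^+ i * w ^+ (lam - a + mu.+1 - i))); last first.
  rewrite !big_nat; apply: eq_bigr=> k /andP[le_k _].
  by rewrite -scalerAl mulrAC -exprD subnK.
rewrite [X in _ + X](_ : _ = - \sum_(i < a) f`_i *: (x ^+ i * w ^+ (lam - a + mu.+1 - i))); last first.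
  rewrite -sumrN; apply: eq_bigr=> k _; rewrite scaleNr.
  by congr (- (_ *: (_ * _ ^+ _))); have := ltn_ord k; lia.
have -> : (mu + lam - 2 * a).+1 = (lam - a + mu.+1 - a)%N by lia.
by rewrite addrA [_ - _]addrC; ring.
Qed.

End TwoVariables.

(** * Leading monomials for powers of linear forms *)
Section LexWeights.

Variables (n M : nat).

(** When M exceeds all degrees, comparing weights is comparing exponents
    lexicographically.  Numerical weights are needed because they become degrees
    in tau. *)
Definition lexw (k : nat) : nat := (M ^ (n - k))%N.
Definition wt (m : 'X_{1..n}) : nat := (\sum_(i < n) m i * lexw i)%N.

Lemma wtD m1 m2 : wt (m1 + m2) = (wt m1 + wt m2)%N.
Proof. by rewrite /wt -big_split; apply: eq_bigr => i _; rewrite mnmDE mulnDl. Qed.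

Lemma wtU i : wt U_(i) = lexw i.
Proof.
rewrite /wt (bigD1 i) //= mnm1E eqxx mul1n big1 ?addn0 // => j ne_ji.
by rewrite mnm1E eq_sym (negbTE ne_ji).
Qed.

Lemma wt0 : wt 0 = 0%N.
Proof. by rewrite /wt big1 // => i _; rewrite mnm0E. Qed.

Lemma wtMn m k : wt (m *+ k) = (wt m * k)%N.
Proof. by elim: k => [|k IHk]; rewrite ?mulm0n ?wt0 ?muln0 // mulmS wtD IHk mulnS. Qed.

Lemma leq_lexw k1 k2 : (0 < M)%N -> (k1 <= k2)%N -> (lexw k2 <= lexw k1)%N.
Proof. by move=> M_gt0 le_k; rewrite leq_pexp2l // leq_sub2l. Qed.

Variable K : fieldType.
Implicit Types p q : {mpoly K[n]}.

Definition wlt (d c : nat) p : Prop :=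
  forall m, m \in msupp p -> mdeg m = d /\ (wt m < c)%N.

Lemma wlt0 d c : wlt d c 0.
Proof. by move=> m; rewrite msupp0. Qed.

Lemma wltW d c c' p : (c <= c')%N -> wlt d c p -> wlt d c' p.
Proof. by move=> le_c wp m /wp[-> lt_m]; split=> //; apply: leq_trans lt_m le_c. Qed.

Lemma wltD d c p q : wlt d c p -> wlt d c q -> wlt d c (p + q).
Proof.
by move=> wp wq m /msuppD_le; rewrite mem_cat => /orP[/wp|/wq].
Qed.

Lemma wltN d c p : wlt d c p -> wlt d c (- p).
Proof. by move=> wp m; rewrite (perm_mem (msuppN p)) => /wp. Qed.

Lemma wltB d c p q : wlt d c p -> wlt d c q -> wlt d c (p - q).
Proof. by move=> wp wq; apply: wltD => //; apply: wltN. Qed.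

Lemma wltZ d c a p : wlt d c p -> wlt d c (a *: p).
Proof. by move=> wp m /msuppZ_le/wp. Qed.

Lemma wlt_sum d c (I : Type) (r : seq I) (P : pred I) (F : I -> {mpoly K[n]}) :
  (forall i, P i -> wlt d c (F i)) -> wlt d c (\sum_(i <- r | P i) F i).
Proof.
by move=> wF; apply: (big_ind (wlt d c)) => //; [apply: wlt0 | apply: wltD].
Qed.

Lemma wltM d1 d2 c1 c2 p q :
  wlt d1 c1.+1 p -> wlt d2 c2 q -> wlt (d1 + d2) (c1 + c2) (p * q).
Proof.
move=> wp wq m /msuppM_le/allpairsP[[m1 m2] /= [/wp[<- lt1] /wq[<- lt2] ->]].
by rewrite mdegD wtD -addnS leq_add.
Qed.

Lemma wltX m : wlt (mdeg m) (wt m).+1 'X_[m].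
Proof. by move=> m'; rewrite msuppX inE => /eqP->. Qed.

Lemma wlt_exp d c p s : wlt d c.+1 p -> wlt (d * s) (c * s).+1 (p ^+ s).
Proof.
move=> wp; elim: s => [|s IHs].
  by rewrite expr0 -mpolyX0 !muln0 -[X in wlt X](@mdeg0 n) -[X in wlt _ X.+1]wt0; apply: wltX.
by rewrite exprS !mulnS -addnS; apply: wltM.
Qed.

Definition tail_form (k : nat) : {mpoly K[n]} := \sum_(p < n | (k <= p)%N) 'X_p.

Lemma tail_formS (k : 'I_n) : tail_form k = 'X_k + tail_form k.+1.
Proof.
rewrite /tail_form (bigD1 k) //=; congr (_ + _); apply: eq_bigl => p.
by rewrite ltn_neqAle andbC eq_sym.
Qed.

Lemma wlt_tail_form k : (0 < M)%N -> wlt 1 (lexw k).+1 (tail_form k).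
Proof.
move=> M_gt0; apply: wlt_sum => p le_kp; apply: (@wltW _ (lexw p).+1).
  by rewrite ltnS leq_lexw.
by rewrite -[X in wlt X](mdeg1 p) -(wtU p); apply: wltX.
Qed.

Lemma wlt_two (x w : {mpoly K[n]}) (cx cw a b : nat) :
  wlt 1 cx.+1 x -> wlt 1 cw.+1 w -> wlt (a + b) (a * cx + b * cw).+1 (x ^+ a * w ^+ b).
Proof.
move=> wx ww; rewrite -addnS; apply: wltM.
  by have := wlt_exp (s:=a) wx; rewrite mul1n mulnC.
by have := wlt_exp (s:=b) ww; rewrite mul1n mulnC.
Qed.

(** Crossing the variables from k to j - 1 turns the power mu + 1 of the tail
    form into the power mu + \sum lam - 2 \sum e + 1; the monomial e is bad at j
    when its exponent there exceeds what that power or that of X_j allows. *)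
Definition left_bad (k mu : nat) (lam : 'I_n -> nat) (e : 'X_{1..n}) (j : 'I_n) : bool :=
  (lam j < e j)%N ||
  (mu + \sum_(p < n | (k <= p < j)%N) lam p < e j + 2 * \sum_(p < n | (k <= p < j)%N) e p)%N.

Lemma big_ord_from (F : 'I_n -> nat) (k j : 'I_n) : (k < j)%N ->
  (\sum_(p < n | (k <= p < j)%N) F p = F k + \sum_(p < n | (k.+1 <= p < j)%N) F p)%N.
Proof.
move=> lt_kj; rewrite (bigD1 k) /=; last by rewrite leqnn.
by congr (_ + _)%N; apply: eq_bigl => p; rewrite -val_eqE /=; lia.
Qed.

Hypothesis charK : [pchar K] =i pred0.

(** A bad monomial is a leading monomial.  By induction on j - k: [two_variables],
    with x = X_k and w the next tail form, replaces the power mu + 1 of the tail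
    form at k by the power mu + lam_k - 2 a + 1 of the next one, up to lower
    powers of X_k.  The bound on the weight of q keeps these corrections below
    the weight of e.  The recursion stops when X_k^(lam_k+1), or the leading term
    X_k^(mu+1) of the power of the tail form, divides the monomial. *)
Lemma left_lead (lam : 'I_n -> nat) (j : 'I_n) (k mu : nat) (e : 'X_{1..n}) :
  (k <= j)%N -> (forall i : 'I_n, (i < k)%N -> e i = 0%N) -> (mdeg e < M)%N ->
  left_bad k mu lam e j ->
  exists (q : {mpoly K[n]}) (Q : 'I_n -> {mpoly K[n]}),
    (q = 0 \/ exists2 dq, (dq + mu.+1 = mdeg e)%N & wlt dq (dq * lexw k).+1 q) /\
    wlt (mdeg e) (wt e)
      (q * tail_form k ^+ mu.+1 + \sum_p Q p * 'X_p ^+ (lam p).+1 - 'X_[e]).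
Proof.
have [t] := ubnP (j - k); elim: t => // t IHt in k mu e *.
rewrite ltnS => le_jkt le_kj e_low lt_eM bad.
have M_gt0 : (0 < M)%N by apply: leq_ltn_trans _ lt_eM.
pose ik := Ordinal (leq_ltn_trans le_kj (ltn_ord j)).
have tailE : tail_form k = 'X_ik + tail_form k.+1 := tail_formS ik.
have le_deg : (e ik <= mdeg e)%N by rewrite mdegE (bigD1 ik) //= leq_addr.
have low_le (m : 'X_{1..n}) : (forall i : 'I_n, (i < k)%N -> m i = 0%N) -> (wt m <= mdeg m * lexw k)%N.
  move=> m_low; rewrite /wt mdegE big_distrl /=; apply: leq_sum => i _.
  case: (ltnP i k) => [/m_low -> //|le_ki]; rewrite leq_mul2l leq_lexw // orbT //.
have splitX a : (a <= e ik)%N -> (e - U_(ik) *+ a + U_(ik) *+ a = e)%MM.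
  move=> le_a; apply: submK; apply/mnm_lepP => i.
  by rewrite mulmnE mnm1E; case: eqP => [<-|_]; rewrite ?mul1n.
have lowB a : forall i : 'I_n, (i < k)%N -> (e - U_(ik) *+ a)%MM i = 0%N.
  by move=> i /e_low ei; rewrite mnmBE ei sub0n.
case: (ltnP (lam ik) (e ik)) => [lt_lam|le_lam].
  exists 0, (fun p : 'I_n => if p == ik then 'X_[e - U_(ik) *+ (lam ik).+1] else 0).
  split; first by left.
  rewrite mul0r add0r (bigD1 ik) //= eqxx big1 => [|p /negbTE->]; last by rewrite mul0r.
  rewrite addr0 mpolyXn -mpolyXD splitX // subrr; exact: wlt0.
(* One more X_k outweighs any number less than M of later variables. *)
have lw_lt a b c : (b < M)%N -> (a < c)%N -> (a * lexw k + b * lexw k.+1 < c * lexw k)%N.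
  move=> lt_bM lt_ac; apply: leq_trans (_ : a.+1 * lexw k <= _)%N; last first.
    by rewrite leq_mul2r lt_ac orbT.
  rewrite mulSn [X in (_ < X)%N]addnC ltn_add2l.
  have -> : lexw k = (M * lexw k.+1)%N.
    by rewrite /lexw -expnS subnS prednK // subn_gt0 (ltn_ord ik).
  by rewrite ltn_mul2r expn_gt0 M_gt0.
have wX : wlt 1 (lexw k).+1 'X_ik by rewrite -[X in wlt X](mdeg1 ik) -(wtU ik); apply: wltX.
have wT := wlt_tail_form (k:=k.+1) M_gt0.
(* X_k^(mu+1) divides the monomial. *)
case: (ltnP mu (e ik)) => [lt_mu|le_mu].
  pose e' := (e - U_(ik) *+ mu.+1)%MM.
  have dege' : (mdeg e' + mu.+1 = mdeg e)%N.
    by rewrite -[in RHS](splitX mu.+1) // mdegD mdegMn mdeg1 mul1n.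
  have wte' : wt e = (wt e' + mu.+1 * lexw k)%N.
    by rewrite -(splitX mu.+1) // wtD wtMn wtU mulnC.
  exists 'X_[e'], (fun=> 0); split.
    right; exists (mdeg e') => //; apply: wltW _ (@wltX e').
    by rewrite ltnS low_le //; apply: lowB.
  rewrite [X in _ + X - _]big1 => [|p _]; last by rewrite mul0r.
  rewrite addr0 -[in X in _ - X](splitX mu.+1) // mpolyXD -mpolyXn -mulrBr.
  rewrite -dege' wte'; apply: wltM (@wltX e') _.
  rewrite tailE exprDn big_ord_recl subn0 expr0 mulr1 bin0 mulr1n addrAC subrr add0r.
  apply: wlt_sum => i _; rewrite lift0 subSS -scaler_nat; apply: wltZ.
  have := wlt_two (a:=mu - i) (b:=i.+1) wX wT; rewrite addnS subnK; last by rewrite -ltnS.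
  have lt_i := ltn_ord i; apply: wltW; apply: lw_lt; [apply: leq_ltn_trans _ lt_eM|]; lia.
(* At j itself badness was one of the two cases above, so j is still ahead. *)
have lt_kj : (k < j)%N.
  rewrite ltn_neqAle le_kj andbT; apply/eqP => def_k.
  have Eik : ik = j by apply: val_inj.
  move: bad; rewrite /left_bad def_k !big_pred0; try by move=> p; lia.
  rewrite -Eik; lia.
set a := e ik in le_lam le_mu splitX lowB.
pose e' := (e - U_(ik) *+ a)%MM.
have def_e : (e' + U_(ik) *+ a)%MM = e by apply: splitX.
have dege : (mdeg e' + a = mdeg e)%N by rewrite -def_e mdegD mdegMn mdeg1 mul1n.
have wte : (wt e = wt e' + a * lexw k)%N by rewrite -def_e wtD wtMn wtU mulnC.
have e'k : e' ik = 0%N by rewrite mnmBE mulmnE mnm1E eqxx mul1n subnn.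
have e'ne i : i != ik -> e' i = e i.
  by move=> ne; rewrite mnmBE mulmnE mnm1E eq_sym (negbTE ne) subn0.
pose mu' := (mu + lam ik - 2 * a)%N.
have bad' : left_bad k.+1 mu' lam e' j.
  move: bad; rewrite /left_bad e'ne; last by rewrite -val_eqE /= gtn_eqF.
  rewrite !(@big_ord_from _ ik) // -/a /=.
  have -> : (\sum_(p < n | (k.+1 <= p < j)%N) e' p = \sum_(p < n | (k.+1 <= p < j)%N) e p)%N.
    by apply: eq_bigr => p /andP[lt_kp _]; rewrite e'ne // -val_eqE /= gtn_eqF.
  rewrite /mu' => /orP[->//|lt_sum]; apply/orP; right.
  move: lt_sum le_mu le_lam.
  move: (\sum_(p < n | _) lam p)%N (\sum_(p < n | _) e p)%N (e j) (lam ik) => S1 S2 ej lk; lia.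
have [|||] := IHt k.+1 mu' e' _ lt_kj _ _ bad'.
- lia.
- move=> i; rewrite ltnS leq_eqVlt => /orP[/eqP Ei|lt_ik]; last exact: lowB.
  by have -> : i = ik by apply: val_inj.
- by apply: leq_ltn_trans _ lt_eM; rewrite -dege leq_addr.
move=> q [Q [q_ok hQ]].
have [al [c [be E]]] := two_variables charK 'X_ik (tail_form k.+1) le_mu le_lam.
set A := \sum_(i < _) al i *: _ in E.
pose R := \sum_(i < a) c i *: ('X_ik ^+ i * tail_form k.+1 ^+ (mu + lam ik - a - i).+1) : {mpoly K[n]}.
exists (q * A), (fun p : 'I_n => 'X_ik ^+ a * Q p + (if p == ik then q * be else 0)); split.
  case: q_ok => [->|[dq def_dq wq]]; [left|right]; first by rewrite mul0r.
  exists (dq + (lam ik - a))%N; first by move: def_dq; rewrite /mu'; lia.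
  rewrite mulnDl -addnS; apply: wltM.
    by apply: wltW _ wq; rewrite ltnS leq_mul2l leq_lexw ?orbT.
  apply: wlt_sum => i _; apply: wltZ.
  have := wlt_two (a:=i) (b:=lam ik - a - i) wX wT; rewrite subnKC; last by rewrite -ltnS.
  move=> H; apply: wltW _ H; rewrite ltnS.
  apply: leq_trans (_ : i * lexw k + (lam ik - a - i) * lexw k <= _)%N.
    by rewrite leq_add2l leq_mul2l leq_lexw ?orbT.
  by rewrite -mulnDl leq_mul2r subnKC ?leqnn ?orbT // -ltnS.
have -> : q * A * tail_form k ^+ mu.+1
    + \sum_p ('X_ik ^+ a * Q p + (if p == ik then q * be else 0)) * 'X_p ^+ (lam p).+1 - 'X_[e]
  = 'X_[U_(ik) *+ a] * (q * tail_form k.+1 ^+ mu'.+1 + \sum_p Q p * 'X_p ^+ (lam p).+1 - 'X_[e'])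
    - q * R.
  have -> : \sum_p ('X_ik ^+ a * Q p + (if p == ik then q * be else 0)) * 'X_p ^+ (lam p).+1
    = 'X_ik ^+ a * (\sum_p Q p * 'X_p ^+ (lam p).+1) + q * be * 'X_ik ^+ (lam ik).+1.
    rewrite (eq_bigr (fun p : 'I_n => 'X_ik ^+ a * (Q p * 'X_p ^+ (lam p).+1)
      + (if p == ik then q * be else 0) * 'X_p ^+ (lam p).+1)) => [|p _]; last first.
      by rewrite mulrDl mulrA.
    rewrite big_split /= -mulr_sumr; congr (_ + _).
    rewrite (bigD1 ik) //= eqxx big1 ?addr0 // => p /negbTE->.
    by rewrite mul0r.
  rewrite -[in LHS]def_e mpolyXD -mpolyXn tailE.
  move: E; rewrite -/mu' -/R => E.
  set T := tail_form _ in E *; set S := \sum_p _; set X := 'X_ik ^+ a in E *.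
  have -> : q * A * ('X_ik + T) ^+ mu.+1 = q * (X * T ^+ mu'.+1 - be * 'X_ik ^+ (lam ik).+1 - R).
    by rewrite E; ring.
  ring.
apply: wltB.
  rewrite -dege wte addnC [X in wlt _ X]addnC; apply: wltM; last exact: hQ.
  have := @wltX (U_(ik) *+ a)%MM; rewrite mdegMn mdeg1 mul1n wtMn wtU mulnC.
  exact.
case: q_ok => [->|[dq def_dq wq]]; first by rewrite mul0r; apply: wlt0.
rewrite /R mulr_sumr; apply: wlt_sum => i _; rewrite -scalerAr; apply: wltZ.
pose b := (mu + lam ik - a - i).+1.
have def_b : (dq + (i + b) = mdeg e)%N.
  by move: def_dq (ltn_ord i); rewrite -dege /b /mu' ; lia.
have := wltM wq (wlt_two (a:=i) (b:=b) wX wT); rewrite def_b.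
apply: wltW; apply: leq_trans (_ : a * lexw k <= _)%N; last by rewrite wte leq_addl.
rewrite addnS addnCA -mulnDl; apply: lw_lt (ltn_ord i).
by apply: leq_ltn_trans _ lt_eM; lia.
Qed.

End LexWeights.

(** * Degeneration along a one-parameter family *)
Section Dominance.

Variables (n : nat) (K : fieldType).
Implicit Types (g h : {mpoly {poly K}[n]}) (m e : 'X_{1..n}).

(** The coefficients are polynomials in tau: as tau tends to infinity, g
    degenerates to a multiple of the monomial e. *)
Definition dominant e g : Prop :=
  g@_e != 0 /\ forall m, m != e -> (size g@_m < size g@_e)%N.

Definition homog_of (R : nzRingType) (d : nat) (g : {mpoly R[n]}) : Prop :=
  forall m, g@_m != 0 -> mdeg m = d.

(** Put mu_i = l0 + \sum_(p < i) (lam_p - 2 m_p).  The first two conditions say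
    that mu_(i+1) is a highest weight in the sl2-representation
    V(mu_i) (x) V(lam_i); the last one is the same from the right.  The
    exponents are not taken equal because splitting a walk into two
    ([valid_dominant]) changes them separately. *)
Definition valid (l0 : nat) (lam : 'I_n -> nat) (l1 : nat) (m : 'X_{1..n}) : bool :=
  [forall i : 'I_n, [&& (m i <= lam i)%N,
    (m i + 2 * \sum_(p < n | (p < i)%N) m p <= l0 + \sum_(p < n | (p < i)%N) lam p)%N &
    (m i + 2 * \sum_(p < n | (i < p)%N) m p <= l1 + \sum_(p < n | (i < p)%N) lam p)%N]].

Definition normal_ideal (R : comNzRingType) (P Q : 'I_n -> R) (l0 : nat) (lam : 'I_n -> nat)
    (l1 : nat) (p : {mpoly R[n]}) : Prop :=
  exists (q0 q1 : {mpoly R[n]}) (q : 'I_n -> {mpoly R[n]}),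
    p = q0 * (\sum_i P i *: 'X_i) ^+ l0.+1 + q1 * (\sum_i Q i *: 'X_i) ^+ l1.+1
        + \sum_i q i * 'X_i ^+ (lam i).+1.

Definition reindex_mnm (s : 'I_n -> 'I_n) m : 'X_{1..n} := [multinom m (s i) | i < n].

Lemma mdeg_reindex s m : involutive s -> mdeg (reindex_mnm s m) = mdeg m.
Proof.
move=> sK; rewrite !mdegE [RHS](reindex_inj (inv_inj sK)).
by apply: eq_bigr => i _; rewrite mnmE.
Qed.

Lemma reindex_mnmK s : involutive s -> involutive (reindex_mnm s).
Proof. by move=> sK m; apply/mnmP => i; rewrite !mnmE sK. Qed.

Section Twist.

Variables (s : 'I_n -> 'I_n) (c : 'I_n -> {poly K}).
Hypothesis sK : involutive s.

(** Rescaling the variables by polynomials in tau turns weights into degrees in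
    tau and the sum of the variables into P or Q; the permutation s is the identity,
    or the reversal of the variables, which exchanges left and right. *)
Definition twist : {mpoly K[n]} -> {mpoly {poly K}[n]} :=
  mmap (@mpolyC n {poly K} \o polyC) (fun i => c i *: 'X_(s i)).

Lemma twist_mmap1 m :
  mmap1 (fun i => c i *: 'X_(s i)) m = (\prod_i c i ^+ m i) *: 'X_[reindex_mnm s m].
Proof.
rewrite /mmap1 (eq_bigr (fun i => (c i ^+ m i)%:MP * 'X_(s i) ^+ m i)) => [|i _]; last first.
  by rewrite -mul_mpolyC exprMn rmorphXn.
rewrite big_split /= -rmorph_prod mul_mpolyC; congr (_ *: _).
rewrite mpolyXE_id (reindex_inj (inv_inj sK)); apply: eq_bigr => i _.
by rewrite mnmE sK.
Qed.

Lemma mcoeff_twist p m :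
  (twist p)@_(reindex_mnm s m) = (p@_m)%:P * \prod_i c i ^+ m i.
Proof.
rewrite /twist /mmap raddf_sum /=.
rewrite (eq_bigr (fun m' => if m' == m then (p@_m)%:P * \prod_i c i ^+ m i else 0)); last first.
  move=> m' _; rewrite mul_mpolyC twist_mmap1 !mcoeffZ mcoeffX.
  rewrite (inj_eq (inv_inj (reindex_mnmK sK))); case: eqP => [->|]; last by rewrite !mulr0.
  by rewrite mulr1.
case: (boolP (m \in msupp p)) => [m_p|m_Np].
  rewrite (bigD1_seq m) ?msupp_uniq //= eqxx [X in _ + X]big1 ?addr0 // => m' /negbTE->; done.
rewrite big1_seq ?(memN_msupp_eq0 m_Np) ?mul0r // => m' /= m'_p.
by case: eqP m'_p m_Np => // -> ->.
Qed.

Variable M : nat.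
Hypothesis size_c : forall i : 'I_n, size (c i) = (lexw n M i).+1.

Lemma size_monomial m : size (\prod_i c i ^+ m i) = (wt M m).+1.
Proof.
have c_neq0 i : c i != 0 by rewrite -size_poly_eq0 size_c.
rewrite size_prod; last by move=> i _; rewrite expf_neq0.
rewrite (eq_bigr (fun i => m i * lexw n M i + 1)%N) => [|i _]; last first.
  by rewrite -[LHS]prednK ?size_poly_gt0 ?expf_neq0 // size_exp size_c mulnC addn1.
by rewrite big_split /= sum1_card -/(wt M m) -addSn addnK.
Qed.

Lemma dominant_twist e p :
  wlt M (mdeg e) (wt M e) (p - 'X_[e]) ->
  dominant (reindex_mnm s e) (twist p) /\ homog_of (mdeg e) (twist p).
Proof.
move=> p_e.
have pe1 : p@_e = 1.
  have : (p - 'X_[e])@_e = 0.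
    by apply: memN_msupp_eq0; apply/negP => /p_e[_]; rewrite ltnn.
  by rewrite mcoeffB mcoeffX eqxx => /eqP; rewrite subr_eq0 => /eqP.
have pm m : m != e -> p@_m != 0 -> mdeg m = mdeg e /\ (wt M m < wt M e)%N.
  move=> ne_me pm0; apply: p_e; rewrite mcoeff_msupp mcoeffB mcoeffX.
  by rewrite [e == m]eq_sym (negbTE ne_me) subr0.
have prod_neq0 m : \prod_i c i ^+ m i != 0 by rewrite -size_poly_eq0 size_monomial.
split.
  have se : size (twist p)@_(reindex_mnm s e) = (wt M e).+1.
    by rewrite mcoeff_twist pe1 mul1r size_monomial.
  split=> [|m]; first by rewrite -size_poly_eq0 se.
  rewrite -[m](reindex_mnmK sK) (inj_eq (inv_inj (reindex_mnmK sK))).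
  move: (reindex_mnm s m) => {}m ne_me; rewrite se mcoeff_twist ltnS.
  have [->|/(pm _ ne_me)[_ lt_w]] := eqVneq p@_m 0; first by rewrite mul0r size_poly0.
  apply: leq_trans (size_polyMleq _ _) _; rewrite size_monomial.
  by have := size_polyC_leq1 (p@_m); case: (size _) => [|[|]] //= _; apply: ltnW.
move=> m; rewrite -[m](reindex_mnmK sK) mcoeff_twist mdeg_reindex //.
move: (reindex_mnm s m) => {}m; rewrite mulf_eq0 (negbTE (prod_neq0 _)) orbF polyC_eq0.
by have [->|ne_me] := eqVneq m e; last by case/(pm _ ne_me).
Qed.

End Twist.

Hypothesis charK : [pchar K] =i pred0.
Variable M : nat.
Variables (P Q : 'I_n -> {poly K}).
Hypothesis size_P : forall i : 'I_n, size (P i) = (lexw n M i).+1.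
Hypothesis size_Q : forall i : 'I_n, size (Q i) = (lexw n M (rev_ord i)).+1.

Lemma twist_ideal (s : 'I_n -> 'I_n) (c c' : 'I_n -> {poly K}) l (lam : 'I_n -> nat) q (q' : 'I_n -> {mpoly K[n]}) :
  involutive s -> (forall i, c i = c' (s i)) ->
  exists q0 q1, twist s c (q * tail_form n K 0 ^+ l.+1 + \sum_p q' p * 'X_p ^+ (lam (s p)).+1)
    = q0 * (\sum_i c' i *: 'X_i) ^+ l.+1 + \sum_i q1 i * 'X_i ^+ (lam i).+1.
Proof.
move=> sK cE; exists (twist s c q), (fun i => twist s c (q' (s i)) * (c' i ^+ (lam i).+1)%:MP).
have tX i : twist s c 'X_i = c' (s i) *: 'X_(s i) by rewrite /twist mmapX mmap1U cE.
have tail_tw : twist s c (tail_form n K 0) = \sum_i c' i *: 'X_i.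
  rewrite /twist /tail_form rmorph_sum [RHS](reindex_inj (inv_inj sK)) big_mkcond /=.
  by apply: eq_bigr => i _; rewrite -/(twist s c 'X_i) tX.
rewrite {1}/twist rmorphD rmorphM rmorphXn /= -!/(twist s c _) tail_tw; congr (_ + _).
rewrite {1}/twist rmorph_sum [RHS](reindex_inj (inv_inj sK)).
apply: eq_bigr => i _; rewrite rmorphM rmorphXn /= -!/(twist s c _) tX sK.
by rewrite -mul_mpolyC exprMn rmorphXn mulrA.
Qed.

(** A monomial that violates a condition on the left is a leading monomial for
    the variables and P, on the right for the variables and Q.  In the latter
    case the order of the variables is reversed, which is why the degrees of the
    Q_k increase while those of the P_k decrease. *)
Lemma invalid_dominant l0 lam l1 e :
  (mdeg e < M)%N -> ~~ valid l0 lam l1 e ->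
  exists h, [/\ normal_ideal P Q l0 lam l1 h, dominant e h & homog_of (mdeg e) h].
Proof.
move=> lt_eM; rewrite negb_forall => /existsP[j].
rewrite !negb_and -!ltnNge orbA => /orP[bad|bad].
  have lb : left_bad 0 l0 lam e j by [].
  have [] := left_lead (k:=0) (mu:=l0) charK _ _ lt_eM lb => // q [q' [_ he]].
  have idK : involutive (@id 'I_n) by [].
  have [q0 [q1 E]] := twist_ideal (c:=P) (c':=P) l0 lam q q' idK (fun=> erefl).
  have [] := dominant_twist idK size_P he; rewrite E.
  have -> : reindex_mnm id e = e by apply/mnmP => i; rewrite mnmE.
  move=> dom hom; eexists; split; [|exact: dom|exact: hom].
  by exists q0, 0, q1; rewrite mul0r addr0.
pose s := @rev_ord n; have sK : involutive s := @rev_ordK n.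
pose lamr i := lam (s i); pose er := reindex_mnm s e.
have lb : left_bad 0 l1 lamr er (s j).
  rewrite /left_bad /lamr mnmE sK; apply/orP; right.
  have sumE (F : 'I_n -> nat) :
      (\sum_(p < n | (0 <= p < s j)%N) F (s p) = \sum_(p < n | (j < p)%N) F p)%N.
    rewrite [RHS](reindex_inj (inv_inj sK)); apply: eq_bigl => p /=.
    by have := ltn_ord p; have := ltn_ord j; lia.
  have -> : (\sum_(p < n | (0 <= p < s j)%N) er p = \sum_(p < n | (0 <= p < s j)%N) e (s p))%N.
    by apply: eq_bigr => p _; rewrite mnmE.
  by rewrite (sumE lam) (sumE e).
have dege : mdeg er = mdeg e by apply: mdeg_reindex.
have lt_erM : (mdeg er < M)%N by rewrite dege.
have [] := left_lead (k:=0) (mu:=l1) charK _ _ lt_erM lb => //.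
move=> q [q' [_]]; rewrite /lamr => he.
have [q0 [q1 E]] := twist_ideal (c:=fun i => Q (s i)) (c':=Q) l1 lam q q' sK (fun=> erefl).
have sz i : size (Q (s i)) = (lexw n M i).+1 by rewrite size_Q rev_ordK.
have [] := dominant_twist sK sz he.
rewrite E /er (reindex_mnmK sK) -/er dege.
move=> dom hom; eexists; split; [|exact: dom|exact: hom].
by exists 0, q0, q1; rewrite mul0r add0r.
Qed.

End Dominance.

(** * Derivations and apolarity *)
Section Derivations.

Variables (A : comNzRingType) (D : A -> A).
Hypothesis DD : forall x y, D (x + y) = D x + D y.
Hypothesis DM : forall x y, D (x * y) = D x * y + x * D y.

Lemma derivation0 : D 0 = 0.
Proof. by apply: (addIr (D 0)); rewrite -DD !add0r. Qed.

Lemma derivation1 : D 1 = 0.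
Proof. by apply: (addIr (D 1)); rewrite add0r -[in RHS](mul1r 1) DM mulr1 mul1r. Qed.

Lemma derivationN x : D (- x) = - D x.
Proof. by apply/eqP; rewrite -subr_eq0 opprK -DD addNr derivation0. Qed.

Lemma derivation_sum (I : Type) (r : seq I) (F : I -> A) :
  D (\sum_(i <- r) F i) = \sum_(i <- r) D (F i).
Proof. by elim: r => [|i r IHr]; rewrite ?big_nil ?derivation0 // !big_cons DD IHr. Qed.

Lemma derivation_prod (I : eqType) (r : seq I) (F : I -> A) : uniq r ->
  D (\prod_(i <- r) F i) = \sum_(i <- r) \prod_(j <- r) (if j == i then D (F j) else F j).
Proof.
elim: r => [|i r IHr] /=; first by rewrite !big_nil derivation1.
case/andP=> i_Nr /IHr{}IHr; rewrite big_cons DM IHr [RHS]big_cons; congr (_ + _).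
  rewrite big_cons eqxx; congr (_ * _); apply: eq_big_seq => j j_r.
  by case: eqP i_Nr => // <-; rewrite j_r.
rewrite mulr_sumr; apply: eq_big_seq => j j_r.
by rewrite big_cons; case: eqP i_Nr => // ->; rewrite j_r.
Qed.

Definition row_derived N (M : 'M[A]_N) (i : 'I_N) : 'M[A]_N :=
  \matrix_(a, b) if a == i then D (M a b) else M a b.

Lemma derivation_det N (M : 'M[A]_N) : D (\det M) = \sum_i \det (row_derived M i).
Proof.
rewrite /determinant derivation_sum exchange_big /=; apply: eq_bigr => s _.
rewrite -mulr_sumr; have -> x : D ((-1) ^+ perm.odd_perm s * x) = (-1) ^+ perm.odd_perm s * D x.
  by rewrite !mulr_sign; case: (perm.odd_perm s) => //; rewrite derivationN.
congr (_ * _); rewrite derivation_prod ?index_enum_uniq //.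
by apply: eq_bigr => i _; apply: eq_bigr => j _; rewrite mxE.
Qed.

Lemma det_row0 N (M : 'M[A]_N) i : (forall b, M i b = 0) -> \det M = 0.
Proof.
move=> Mi0; rewrite (expand_det_row M i) big1 // => b _.
by rewrite Mi0 mul0r.
Qed.

Definition killed_row N (M : 'M[A]_N) (i : 'I_N) :=
  (forall b, D (M i b) = 0) \/ exists2 i', i' != i & forall b, D (M i b) = M i' b.

Lemma det_row_derived0 N (M : 'M[A]_N) i : killed_row M i -> \det (row_derived M i) = 0.
Proof.
case=> [Di0|[i' ne_i' Di]].
  by apply: (@det_row0 _ _ i) => b; rewrite mxE eqxx.
apply: (@determinant_alternate _ _ _ i' i) => // b.
by rewrite !mxE eqxx (negbTE ne_i') Di.
Qed.

(** The derivative of a determinant is the sum over the rows of the determinants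
    with that row differentiated; each of them has a zero row or two equal rows. *)
Lemma derivation_det_eq0 N (M : 'M[A]_N) :
  (forall i, killed_row M i) -> D (\det M) = 0.
Proof. by move=> kM; rewrite derivation_det big1 // => i _; apply: det_row_derived0. Qed.

(** The row i0 is the only one whose derivative may be new.  No other row may have
    row i0 as its derivative, since that row is already differentiated when D is
    applied for the second time. *)
Lemma derivation2_det_eq0 N (M : 'M[A]_N) i0 :
  (forall b, D (D (M i0 b)) = 0) ->
  (forall i, i != i0 -> (forall b, D (M i b) = 0) \/
     exists i', [/\ i' != i, i' != i0 & forall b, D (M i b) = M i' b]) ->
  D (D (\det M)) = 0.
Proof.
move=> DD0 kM; rewrite derivation_det (bigD1 i0) //= big1 => [|i ne_i0]; last first.
  by apply: det_row_derived0; case: (kM i ne_i0) => [|[i' []]]; [left | right; exists i'].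
rewrite addr0; apply: derivation_det_eq0 => i.
have [->|ne_i0] := eqVneq i i0; first by left => b; rewrite mxE eqxx.
case: (kM i ne_i0) => [D0|[i' [ne_i' ne_i'0 Di]]]; [left=> b|right; exists i' => // b].
  by rewrite mxE (negbTE ne_i0).
by rewrite !mxE (negbTE ne_i0) (negbTE ne_i'0).
Qed.

Lemma iter_derivation0 k : iter k D 0 = 0.
Proof. by elim: k => //= k ->; rewrite derivation0. Qed.

Lemma iter_derivationD k x y : iter k D (x + y) = iter k D x + iter k D y.
Proof. by elim: k => //= k ->; rewrite DD. Qed.

Lemma iter_derivation_mul a b x y :
  iter a.+1 D x = 0 -> iter b.+1 D y = 0 -> iter (a + b).+1 D (x * y) = 0.
Proof.
have [t] := ubnP (a + b); elim: t a b x y => // t IHt a b x y; rewrite ltnS => le_t x0 y0.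
rewrite iterSr DM iter_derivationD; apply/eqP; rewrite addr_eq0; apply/eqP.
have -> : iter (a + b) D (D x * y) = 0.
  case: a le_t x0 => [|a] le_t x0; first by rewrite [D x]x0 mul0r iter_derivation0.
  by apply: IHt => //; rewrite -iterSr.
have -> : iter (a + b) D (x * D y) = 0.
  case: b le_t y0 => [|b] le_t y0; first by rewrite [D y]y0 mulr0 iter_derivation0.
  by rewrite addnS; apply: IHt => //; rewrite -?iterSr //; rewrite addnS in le_t.
by rewrite oppr0.
Qed.

End Derivations.

Section Apolarity.

Variables (n : nat) (R : comNzRingType).
Implicit Types (p g : {mpoly R[n]}) (m : 'X_{1..n}) (c : 'I_n -> R).

Definition mnm_fact m : nat := (\prod_i (m i)`!)%N.

(** The apolarity pairing, in which p acts on g as a differential operator and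
    the result is evaluated at 0.  The factorials make multiplication by a
    variable adjoint to differentiation. *)
Definition pairing p g : R := \sum_(m <- msupp p) p@_m * (g@_m *+ mnm_fact m).

Lemma pairingwE k p g : (msize p <= k)%N ->
  pairing p g = \sum_(m : 'X_{1..n < k}) p@_m * (g@_m *+ mnm_fact m).
Proof.
move=> le_k; rewrite /pairing (big_mksub ('X_{1..n < k} : subFinType _)) //=; first last.
- by move=> m /msize_mdeg_lt /leq_trans; apply.
- by rewrite msupp_uniq.
by rewrite big_rmcond //= => m /memN_msupp_eq0 ->; rewrite mul0r.
Qed.

Lemma pairingD p1 p2 g : pairing (p1 + p2) g = pairing p1 g + pairing p2 g.
Proof.
pose k := maxn (msize (p1 + p2)) (maxn (msize p1) (msize p2)).
rewrite !(@pairingwE k) ?leq_max ?leqnn ?orbT // -big_split; apply: eq_bigr => m _.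
by rewrite mcoeffD mulrDl.
Qed.

Lemma pairingZ a p g : pairing (a *: p) g = a * pairing p g.
Proof.
pose k := maxn (msize (a *: p)) (msize p).
rewrite !(@pairingwE k) ?leq_max ?leqnn ?orbT // mulr_sumr; apply: eq_bigr => m _.
by rewrite mcoeffZ mulrA.
Qed.

Lemma pairing0 g : pairing 0 g = 0.
Proof. by rewrite /pairing msupp0 big_nil. Qed.

Lemma pairing_sum (I : Type) (r : seq I) (F : I -> {mpoly R[n]}) g :
  pairing (\sum_(i <- r) F i) g = \sum_(i <- r) pairing (F i) g.
Proof. by elim: r => [|i r IHr]; rewrite ?big_nil ?pairing0 // !big_cons pairingD IHr. Qed.

Lemma pairingX m g : pairing 'X_[m] g = g@_m *+ mnm_fact m.
Proof. by rewrite /pairing msuppX big_seq1 mcoeffX eqxx mul1r. Qed.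

Lemma pairing0r p : pairing p 0 = 0.
Proof. by rewrite /pairing big1 // => m _; rewrite mcoeff0 mul0rn mulr0. Qed.

Lemma pairingDr p g1 g2 : pairing p (g1 + g2) = pairing p g1 + pairing p g2.
Proof. by rewrite -big_split; apply: eq_bigr => m _; rewrite mcoeffD mulrnDl mulrDr. Qed.

Lemma pairingZr p a g : pairing p (a *: g) = a * pairing p g.
Proof.
rewrite mulr_sumr; apply: eq_bigr => m _.
by rewrite mcoeffZ -mulrnAr mulrCA.
Qed.

Lemma mnm_factDU m i : mnm_fact (m + U_(i)) = (mnm_fact m * (m i).+1)%N.
Proof.
rewrite /mnm_fact (bigD1 i) //= [in RHS](bigD1 i) //= mnmDE mnm1E eqxx addn1 factS.
rewrite (eq_bigr (fun j => (m j)`!)) => [|j ne_ji]; first by rewrite mulnC mulnA mulnAC mulnC; lia.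
by rewrite mnmDE mnm1E eq_sym (negbTE ne_ji) addn0.
Qed.

Lemma pairing_mulX i p g : pairing ('X_i * p) g = pairing p g^`M(i).
Proof.
rewrite [in LHS](mpolyE p) mulr_sumr pairing_sum [in RHS](mpolyE p) pairing_sum.
apply: eq_bigr => m _; rewrite -scalerAr !pairingZ -mpolyXD addmC !pairingX.
by rewrite mcoeff_deriv mnm_factDU -mulrnA mulnC.
Qed.

Definition dird c g : {mpoly R[n]} := \sum_i c i *: g^`M(i).

Lemma pairing_mul_form c p g :
  pairing ((\sum_i c i *: 'X_i) * p) g = pairing p (dird c g).
Proof.
rewrite mulr_suml pairing_sum /dird.
elim: (index_enum _) => [|i r IHr]; first by rewrite !big_nil pairing0r.
by rewrite !big_cons pairingDr IHr pairingZr -scalerAl pairingZ pairing_mulX.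
Qed.

Lemma pairing_mul_form_exp c d p g :
  pairing (p * (\sum_i c i *: 'X_i) ^+ d) g = pairing p (iter d (dird c) g).
Proof.
elim: d g => [|d IHd] g; first by rewrite mulr1.
by rewrite exprS mulrCA pairing_mul_form IHd -iterSr.
Qed.

Lemma pairing_mulX_exp i d p g :
  pairing (p * 'X_i ^+ d) g = pairing p (iter d (mderiv i) g).
Proof.
elim: d g => [|d IHd] g; first by rewrite mulr1.
by rewrite exprS mulrCA pairing_mulX IHd -iterSr.
Qed.

Lemma dirdD c g1 g2 : dird c (g1 + g2) = dird c g1 + dird c g2.
Proof. by rewrite -big_split; apply: eq_bigr => i _; rewrite mderivD scalerDr. Qed.

Lemma dirdM c g1 g2 : dird c (g1 * g2) = dird c g1 * g2 + g1 * dird c g2.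
Proof.
rewrite mulr_suml mulr_sumr -big_split; apply: eq_bigr => i _ /=.
by rewrite mderivM scalerDr scalerAl scalerAr.
Qed.

Lemma dirdC c a : dird c a%:MP = 0.
Proof. by rewrite /dird big1 // => i _; rewrite mderivC scaler0. Qed.

Lemma mderivU i j : ('X_j : {mpoly R[n]})^`M(i) = (i == j)%:R%:MP.
Proof.
apply/mpolyP => m; rewrite mcoeff_deriv mcoeffX mcoeffC.
case: (eqVneq i j) => [<-|ne_ij].
  have -> : (U_(i)%MM == (m + U_(i))%MM) = (m == 0%MM).
    by rewrite -[X in X == _]add0m eqm_add2r eq_sym.
  by case: eqP => [->|_]; rewrite ?mul0rn ?mulr0 // mnm0E mulr1.
rewrite mul0r; case: eqP => [/mnmP/(_ i)|_]; last by rewrite mul0rn.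
by rewrite mnmDE !mnm1E eqxx eq_sym (negbTE ne_ij) addn1.
Qed.

Lemma dirdU c j : dird c 'X_j = (c j)%:MP.
Proof.
rewrite /dird (bigD1 j) //= mderivU eqxx big1 ?addr0 => [|i ne_ij].
  by rewrite -mul_mpolyC mulr1.
by rewrite mderivU (negbTE ne_ij) mpolyC0 scaler0.
Qed.

Variables (P Q : 'I_n -> R).

(** Macaulay's inverse system of [normal_ideal]. *)
Definition apolar (l0 : nat) (lam : 'I_n -> nat) (l1 : nat) g : Prop :=
  [/\ iter l0.+1 (dird P) g = 0, iter l1.+1 (dird Q) g = 0
    & forall i, iter (lam i).+1 (mderiv i) g = 0].

Lemma apolar_pairing l0 lam l1 p g :
  normal_ideal P Q l0 lam l1 p -> apolar l0 lam l1 g -> pairing p g = 0.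
Proof.
move=> [q0 [q1 [q ->]]] [g0 g1 gi].
rewrite !pairingD pairing_sum !pairing_mul_form_exp g0 g1 !pairing0r !add0r.
by rewrite big1 // => i _; rewrite pairing_mulX_exp gi pairing0r.
Qed.

(** By Leibniz' rule, if a + 1 derivations kill one factor and b + 1 the other, then
    a + b + 1 kill the product.  This is what reduces apolar forms with large exponents to those
    with exponents 0 and 1. *)
Lemma apolarM l0 lam l1 l0' lam' l1' g g' :
  apolar l0 lam l1 g -> apolar l0' lam' l1' g' ->
  apolar (l0 + l0') (fun i => lam i + lam' i)%N (l1 + l1') (g * g').
Proof.
move=> [g0 g1 gi] [g'0 g'1 g'i]; split.
- exact: (iter_derivation_mul (dirdD P) (dirdM P)).
- exact: (iter_derivation_mul (dirdD Q) (dirdM Q)).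
by move=> i; apply: (iter_derivation_mul (@mderivD n R i) (@mderivM n R i)).
Qed.

Lemma apolarC l0 lam l1 (a : R) : apolar l0 lam l1 a%:MP.
Proof.
split=> [||i]; rewrite iterSr ?dirdC ?mderivC.
- exact: (iter_derivation0 (dirdD P)).
- exact: (iter_derivation0 (dirdD Q)).
exact: (iter_derivation0 (@mderivD n R i)).
Qed.

End Apolarity.

(** * Determinantal apolar forms *)
Section BinaryVandermonde.

Variable R : idomainType.

Lemma binary_Vandermonde_neq0 (r : nat) (p q : 'I_r -> R) :
  (forall i, p i != 0) -> (forall i j, i != j -> p i * q j != p j * q i) ->
  \det (\matrix_(k < r, b < r) (p b ^+ (r.-1 - k) * q b ^+ k)) != 0.
Proof.
move=> p_neq0 pq; pose F (x : R) : {fraction R} := tofrac x.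
have F0 x : (F x == 0) = (x == 0) by apply: tofrac_eq0.
rewrite -F0 /F -det_map_mx.
pose a : 'rV[{fraction R}]_r := \row_b (tofrac (q b) / tofrac (p b)).
pose d : 'rV[{fraction R}]_r := \row_b (tofrac (p b) ^+ r.-1).
have -> : map_mx (@tofrac R) (\matrix_(k < r, b < r) (p b ^+ (r.-1 - k) * q b ^+ k)) =
    Vandermonde r a *m diag_mx d.
  apply/matrixP => k b; rewrite mul_mx_diag !mxE rmorphM !rmorphXn /=.
  have p0 : tofrac (p b) != 0 by rewrite tofrac_eq0.
  have le_k : (k <= r.-1)%N by rewrite -ltnS prednK // (leq_ltn_trans _ (ltn_ord k)).
  rewrite expr_div_n -{2}(subnK le_k) exprD mulrC.
  by rewrite mulrA mulrAC mulfVK ?expf_neq0 // mulrC.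
rewrite det_mulmx det_diag mulf_neq0 //.
  rewrite det_Vandermonde; apply/prodf_neq0 => i _; apply/prodf_neq0 => j lt_ij.
  rewrite !mxE subr_eq0 eqr_div ?tofrac_eq0 // -!rmorphM /= tofrac_eq.
  by rewrite mulrC [q i * _]mulrC pq // -val_eqE /= ltn_eqF.
by apply/prodf_neq0 => i _; rewrite mxE expf_neq0 // tofrac_eq0.
Qed.

End BinaryVandermonde.

Section Generators.

Variables (n : nat) (R : idomainType) (P Q : 'I_n -> R).
Variables (s r : nat) (d0 d1 : bool) (f : 'I_(r + s) -> 'I_n).
Hypothesis rs : (r + d0 + d1 = s.+1)%N.
Hypothesis f_inj : injective f.

(** Column b belongs to the point (P_(f b) : Q_(f b)) of the projective line.  The
    lower rows are the monomials of degree s - 1 in P and Q multiplied by the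
    variable, so that differentiating along P or Q turns them into monomials of
    degree s.  The upper rows are all of these monomials, except P^s if d0 and
    Q^s if d1: the missing one is where a first derivative survives, which gives
    exponent 1 instead of 0. *)
Definition apolar_mx : 'M[{mpoly R[n]}]_(r + s) :=
  \matrix_(a, b) match split a with
    | inl k => (P (f b) ^+ (s - d0 - k) * Q (f b) ^+ (d0 + k))%:MP
    | inr k => 'X_(f b) * (P (f b) ^+ (s.-1 - k) * Q (f b) ^+ k)%:MP
    end.

Lemma apolar_mxl k b :
  apolar_mx (lshift s k) b = (P (f b) ^+ (s - d0 - k) * Q (f b) ^+ (d0 + k))%:MP.
Proof. by rewrite mxE (unsplitK (inl k)). Qed.

Lemma apolar_mxr k b :
  apolar_mx (rshift r k) b = 'X_(f b) * (P (f b) ^+ (s.-1 - k) * Q (f b) ^+ k)%:MP.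
Proof. by rewrite mxE (unsplitK (inr k)). Qed.

Lemma dird_rowl c k b : dird c (apolar_mx (lshift s k) b) = 0.
Proof. by rewrite apolar_mxl dirdC. Qed.

Lemma dird_rowr c k b : dird c (apolar_mx (rshift r k) b) =
  (c (f b) * (P (f b) ^+ (s.-1 - k) * Q (f b) ^+ k))%:MP.
Proof. by rewrite apolar_mxr dirdM dirdC mulr0 addr0 dirdU -mpolyCM. Qed.

Lemma dirdP_row (k : 'I_s) : (d0 <= k)%N ->
  exists k' : 'I_r, forall b, dird P (apolar_mx (rshift r k) b) = apolar_mx (lshift s k') b.
Proof.
move=> le_k; have lt_k := ltn_ord k; have lt_k' : (k - d0 < r)%N by lia.
exists (Ordinal lt_k') => b; rewrite dird_rowr apolar_mxl /= mulrA -exprS.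
by congr ((_ ^+ _ * _ ^+ _)%:MP); lia.
Qed.

Lemma dirdQ_row (k : 'I_s) : (k.+1 + d1 <= s)%N ->
  exists k' : 'I_r, forall b, dird Q (apolar_mx (rshift r k) b) = apolar_mx (lshift s k') b.
Proof.
move=> le_k; have lt_k' : (k.+1 - d0 < r)%N by lia.
exists (Ordinal lt_k') => b; rewrite dird_rowr apolar_mxl /= mulrCA -exprS.
by congr ((_ ^+ _ * _ ^+ _)%:MP); lia.
Qed.

Definition occurs (i : 'I_n) : bool := [exists b, f b == i].

(** The derivatives of all lower rows are upper rows, except that of the row k0
    when d holds. *)
Lemma dird_det (c : 'I_n -> R) (d : bool) (k0 : nat) :
  (forall k : 'I_s, (d -> k != k0 :> nat) ->
    exists k' : 'I_r, forall b, dird c (apolar_mx (rshift r k) b) = apolar_mx (lshift s k') b) ->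
  iter d.+1 (dird c) (\det apolar_mx) = 0.
Proof.
move=> rows; have DD := @dirdD n R c; have DM := @dirdM n R c.
have [/andP[d1T lt_k0]|no_special] := boolP (d && (k0 < s)%N).
  rewrite d1T /=; apply: (derivation2_det_eq0 DD DM (i0 := rshift r (Ordinal lt_k0))).
    by move=> b; rewrite dird_rowr dirdC.
  move=> i; case: (split_ordP i) => k -> ne_k; first by left=> b; apply: dird_rowl.
  have [|k' Ek'] := rows k; last by right; exists (lshift s k'); rewrite !eq_lrshift.
  by move=> _; apply: contraNneq ne_k => Ek; apply/eqP; congr rshift; apply: val_inj.
have D0 : dird c (\det apolar_mx) = 0.
  apply: (derivation_det_eq0 DD DM) => i.
  case: (split_ordP i) => k ->; first by left=> b; apply: dird_rowl.
  have [|k' Ek'] := rows k; last by right; exists (lshift s k'); rewrite ?eq_lrshift.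
  move=> dT; apply: contraNneq no_special => Ek.
  by rewrite dT -Ek ltn_ord.
by rewrite iterSr D0 (iter_derivation0 DD).
Qed.

(** Along P and Q this is [dird_det].  A variable occurs in at most one column,
    linearly, which settles the other derivatives. *)
Lemma apolar_det : apolar P Q d0 (fun i => occurs i : nat) d1 (\det apolar_mx).
Proof.
split.
- apply: (dird_det (k0 := 0)) => k ne_k; apply: dirdP_row.
  by case: d0 ne_k => // /(_ isT); rewrite lt0n.
- apply: (dird_det (k0 := s.-1)) => k ne_k; apply: dirdQ_row.
  by have lt_k := ltn_ord k; case: d1 ne_k => [/(_ isT)|_]; lia.
move=> i; have DD := @mderivD n R i; have DM := @mderivM n R i.
have entryl k b : (apolar_mx (lshift s k) b)^`M(i) = 0 by rewrite apolar_mxl mderivC.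
have entryr k b : (apolar_mx (rshift r k) b)^`M(i) =
    ((i == f b)%:R * (P (f b) ^+ (s.-1 - k) * Q (f b) ^+ k))%:MP.
  by rewrite apolar_mxr mderivM mderivC mulr0 addr0 mderivU -mpolyCM.
have entry a b : i != f b -> (apolar_mx a b)^`M(i) = 0.
  move=> /negbTE ne_i; case: (split_ordP a) => k ->; first exact: entryl.
  by rewrite entryr ne_i mul0r mpolyC0.
rewrite -det_tr; case: (boolP (occurs i)) => [/existsP[b0 /eqP fb0]|/existsPn no_b] /=.
  apply: (derivation2_det_eq0 DD DM (i0 := b0)) => [a|b ne_b].
    by rewrite mxE; case: (split_ordP a) => k ->; rewrite ?entryl ?entryr ?mderivC ?mderiv0.
  left=> a; rewrite mxE entry // -fb0; apply: contraNneq ne_b => /f_inj->.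
  by [].
apply: (derivation_det_eq0 DD DM) => b; left=> a.
by rewrite mxE entry // eq_sym no_b.
Qed.

Lemma homog_prod_sum (I : Type) (t : seq I) (F : I -> {mpoly R[n]}) (d : I -> nat) N :
  N = (\sum_(i <- t) d i)%N ->
  (forall i, F i \is (d i).-homog) -> \prod_(i <- t) F i \is N.-homog.
Proof.
move=> -> Fh; elim: t => [|i t IHt]; first by rewrite !big_nil dhomog1.
by rewrite !big_cons; apply: dhomogM.
Qed.

Lemma homog_det : homog_of s (\det apolar_mx).
Proof.
suffices : \det apolar_mx \is s.-homog.
  by move/dhomogP => hom m; rewrite -mcoeff_msupp => /hom.
apply: rpred_sum => w _; rewrite rpredMsign big_split_ord /=.
have homC (a : R) : a%:MP \is [in R[n], 0.-homog] by rewrite -alg_mpolyC rpredZ // dhomog1.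
apply: (dhomogM (d := 0%N) (e := s)).
  apply: (homog_prod_sum (d := fun=> 0%N)) => [|k]; first by rewrite big1.
  by rewrite apolar_mxl.
apply: (homog_prod_sum (d := fun=> 1%N)) => [|k]; first by rewrite sum1_card card_ord.
rewrite apolar_mxr; apply: (dhomogM (d := 1%N) (e := 0%N)) => //.
by rewrite dhomogX /= mdeg1.
Qed.

(** Setting the variables of the last s columns to 1 and the others to 0 leaves a
    block triangular matrix with Vandermonde blocks on the diagonal. *)
Lemma det_apolar_neq0 :
  (forall i, P i != 0) -> (forall i, Q i != 0) ->
  (forall i j, i != j -> P i * Q j != P j * Q i) -> \det apolar_mx != 0.
Proof.
move=> P0 Q0 PQ.
pose v (i : 'I_n) : R := [exists k : 'I_s, f (rshift r k) == i]%:R.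
have vr k : v (f (rshift r k)) = 1.
  by rewrite /v (_ : [exists _, _] = true) //; apply/existsP; exists k.
have vl k : v (f (lshift s k)) = 0.
  rewrite /v (_ : [exists _, _] = false) //; apply/existsP => -[k' /eqP/f_inj/eqP].
  by rewrite eq_rlshift.
suffices : meval v (\det apolar_mx) != 0 by apply: contraNneq => ->; rewrite meval0.
rewrite -det_map_mx.
pose A : 'M[R]_r := \matrix_(k, b) (P (f (lshift s b)) ^+ (s - d0 - k) * Q (f (lshift s b)) ^+ (d0 + k)).
pose B : 'M[R]_(r, s) := \matrix_(k, b) (P (f (rshift r b)) ^+ (s - d0 - k) * Q (f (rshift r b)) ^+ (d0 + k)).
pose C : 'M[R]_s := \matrix_(k, b) (P (f (rshift r b)) ^+ (s.-1 - k) * Q (f (rshift r b)) ^+ k).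
have -> : map_mx (meval v) apolar_mx = block_mx A B 0 C.
  apply/matrixP => a b; rewrite mxE.
  case: (split_ordP a) => k ->; case: (split_ordP b) => k' ->.
  - by rewrite block_mxEul [A _ _]mxE apolar_mxl mevalC.
  - by rewrite block_mxEur [B _ _]mxE apolar_mxl mevalC.
  - by rewrite block_mxEdl [RHS]mxE apolar_mxr mevalM mevalXU vl mul0r.
  by rewrite block_mxEdr [C _ _]mxE apolar_mxr mevalM mevalXU vr mul1r mevalC.
rewrite det_ublock mulf_neq0 //; last first.
  apply: (@binary_Vandermonde_neq0 _ s (fun b => P (f (rshift r b))) (fun b => Q (f (rshift r b)))) => // i j ne_ij.
  by apply: PQ; rewrite (inj_eq f_inj) eq_rshift.
pose A' : 'M[R]_r := \matrix_(k, b) (P (f (lshift s b)) ^+ (r.-1 - k) * Q (f (lshift s b)) ^+ k).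
pose w : 'rV[R]_r := \row_b (P (f (lshift s b)) ^+ d1 * Q (f (lshift s b)) ^+ d0).
have -> : A = A' *m diag_mx w.
  apply/matrixP => k b; rewrite mul_mx_diag !mxE mulrACA -!exprD.
  by congr (_ ^+ _ * _ ^+ _); have := ltn_ord k; lia.
rewrite det_mulmx det_diag mulf_neq0 //.
  apply: (@binary_Vandermonde_neq0 _ r (fun b => P (f (lshift s b))) (fun b => Q (f (lshift s b)))) => // i j ne_ij.
  by apply: PQ; rewrite (inj_eq f_inj) eq_lshift.
by apply/prodf_neq0 => b _; rewrite mxE mulf_neq0 ?expf_neq0.
Qed.

End Generators.

(** * Dominant apolar forms *)
Section DominantSums.

Variable K : fieldType.

Lemma size_sum_lt (I : Type) (r : seq I) (A : pred I) (F : I -> {poly K}) N :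
  (0 < N)%N -> (forall i, A i -> (size (F i) < N)%N) ->
  (size (\sum_(i <- r | A i) F i)%R < N)%N.
Proof.
move=> N_gt0 FN; apply: (big_ind (fun p : {poly K} => size p < N)%N) => //.
  by rewrite size_poly0.
by move=> p q ltp ltq; apply: leq_ltn_trans (size_polyD _ _) _; rewrite gtn_max ltp.
Qed.

Lemma size_dominated_sum (I : eqType) (r : seq I) (F : I -> {poly K}) i0 :
  uniq r -> i0 \in r -> F i0 != 0 ->
  (forall i, i != i0 -> (size (F i) < size (F i0))%N) ->
  size (\sum_(i <- r) F i) = size (F i0).
Proof.
move=> r_uniq i0_r F0 Flt; rewrite (bigD1_seq i0) //= size_polyDl //.
by apply: size_sum_lt; rewrite // size_poly_gt0.
Qed.

Hypothesis charK : [pchar K] =i pred0.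

Lemma size_mulrn (p : {poly K}) k : (0 < k)%N -> size (p *+ k) = size p.
Proof.
move=> k_gt0; rewrite -scaler_nat size_scale //.
by rewrite ((pcharf0P K).1 charK) -lt0n.
Qed.

Lemma size_mul_lt (p q p' q' : {poly K}) :
  (size p <= size p')%N -> (size q <= size q')%N ->
  (size p < size p')%N || (size q < size q')%N -> p' * q' != 0 ->
  (size (p * q)%R < size (p' * q')%R)%N.
Proof.
move=> le_p le_q lt_pq pq'0; have [->|pq0] := eqVneq (p * q) 0.
  by rewrite size_poly0 size_poly_gt0.
move: pq0 pq'0; rewrite !mulf_eq0 !negb_or => /andP[p0 q0] /andP[p'0 q'0].
rewrite !size_mul //; move: p0 q0 le_p le_q lt_pq; rewrite -!size_poly_gt0.
by move: (size p) (size q) (size p') (size q') => a b c d; lia.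
Qed.

Variable n : nat.
Implicit Types (g h : {mpoly {poly K}[n]}) (m e : 'X_{1..n}).

Lemma pairing_dominant_neq0 e h g :
  dominant e h -> g@_e != 0 -> (forall m, (size g@_m <= size g@_e)%N) -> pairing h g != 0.
Proof.
move=> [he0 he] ge0 ge; have fact_gt0 m : (0 < mnm_fact m)%N.
  by apply: prodn_gt0 => i; apply: fact_gt0.
have size_g m : size (g@_m *+ mnm_fact m) = size g@_m := size_mulrn _ (fact_gt0 m).
have g_neq0 m : g@_m != 0 -> g@_m *+ mnm_fact m != 0.
  by rewrite -size_poly_eq0 -size_g size_poly_eq0.
have nz : h@_e * (g@_e *+ mnm_fact e) != 0 by rewrite mulf_neq0 ?g_neq0.
rewrite -size_poly_eq0 (size_dominated_sum (i0 := e)) ?msupp_uniq ?size_poly_eq0 //.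
  by rewrite mcoeff_msupp.
move=> m ne_me; by apply: size_mul_lt; rewrite ?size_g ?ge ?he // ltnW // he.
Qed.

Lemma dominantM e e' g g' :
  dominant e g -> dominant e' g' -> dominant (e + e')%MM (g * g').
Proof.
move=> [ge0 ge] [ge'0 ge'].
have nz : g@_e * g'@_e' != 0 by rewrite mulf_neq0.
have lt_t m m' : (m != e) || (m' != e') ->
    (size (g@_m * g'@_m')%R < size (g@_e * g'@_e')%R)%N.
  have le1 : (size g@_m <= size g@_e)%N by have [->//|/ge/ltnW] := eqVneq m e.
  have le2 : (size g'@_m' <= size g'@_e')%N by have [->//|/ge'/ltnW] := eqVneq m' e'.
  move=> ne; apply: size_mul_lt => //.
  by case/orP: ne => [/ge->|/ge'->]; rewrite ?orbT.
have se : size (g * g')@_(e + e') = size (g@_e * g'@_e').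
  rewrite mcoeffM.
  have lt_e : (mdeg e < (mdeg (e + e')).+1)%N by rewrite ltnS mdegD leq_addr.
  have lt_e' : (mdeg e' < (mdeg (e + e')).+1)%N by rewrite ltnS mdegD leq_addl.
  rewrite (bigD1 (BMultinom lt_e, BMultinom lt_e')) //= size_polyDl //.
  apply: size_sum_lt => [|[m m'] /=]; first by rewrite size_poly_gt0.
  by case/andP=> _ ne; apply: lt_t; rewrite -negb_and; apply: contra ne.
split=> [|m ne_m]; first by rewrite -size_poly_eq0 se size_poly_eq0.
rewrite se mcoeffM; apply: size_sum_lt => [|[m1 m2] /= /eqP def_m]; first by rewrite size_poly_gt0.
apply: lt_t; rewrite -negb_and; apply: contra ne_m => /andP[/eqP E1 /eqP E2].
by rewrite def_m E1 E2.
Qed.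

Lemma homogM (R : nzRingType) d d' (g g' : {mpoly R[n]}) :
  homog_of d g -> homog_of d' g' -> homog_of (d + d') (g * g').
Proof.
move=> hg hg' m; rewrite -mcoeff_msupp => /msuppM_le/allpairsP[[m1 m2] /= [m1g m2g ->]].
by rewrite mdegD hg ?hg' -?mcoeff_msupp.
Qed.

Variable M : nat.
Variables (P Q : 'I_n -> {poly K}).
Hypothesis size_P : forall i : 'I_n, size (P i) = (lexw n M i).+1.
Hypothesis size_Q : forall i : 'I_n, size (Q i) = (lexw n M (rev_ord i)).+1.

(** If m were not valid, the ideal would have an element dominant at m
    ([invalid_dominant]); its pairing with g is zero by apolarity, but the term
    at m has the largest degree in tau and cannot cancel. *)
Lemma apolar_max_valid l0 lam l1 d g m : (d < M)%N ->
  apolar P Q l0 lam l1 g -> homog_of d g ->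
  g@_m != 0 -> (forall m', (size g@_m' <= size g@_m)%N) -> valid l0 lam l1 m.
Proof.
move=> lt_dM ap hom gm0 gm; apply/negPn/negP => inv.
have lt_mM : (mdeg m < M)%N by rewrite (hom m gm0).
have [h [hI hdom _]] := invalid_dominant charK size_P size_Q lt_mM inv.
by have := pairing_dominant_neq0 hdom gm0 gm; rewrite (apolar_pairing hI ap) eqxx.
Qed.

(** By [apolar_max_valid] the largest degree in tau occurs at valid monomials
    only, and there is just one in this degree. *)
Lemma apolar_dominant l0 lam l1 d e g : (d < M)%N ->
  apolar P Q l0 lam l1 g -> homog_of d g -> g != 0 ->
  (forall m, valid l0 lam l1 m -> mdeg m = d -> m = e) -> dominant e g.
Proof.
move=> lt_dM ap hom g0 uniq_e.
pose b := \max_(m <- msupp g) size g@_m.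
have le_b m : (size g@_m <= b)%N.
  have [m_g|/memN_msupp_eq0->] := boolP (m \in msupp g); last by rewrite size_poly0.
  by rewrite /b (big_rem m) //= leq_maxl.
have max_e m : g@_m != 0 -> (b <= size g@_m)%N -> m = e.
  move=> gm0 le_bm; apply: uniq_e (hom m gm0).
  by apply: (apolar_max_valid lt_dM ap hom gm0) => m'; apply: leq_trans (le_b m') le_bm.
have ex_max (s : seq 'X_{1..n}) : s != [::] ->
    exists2 m, m \in s & \max_(m <- s) size g@_m = size g@_m.
  elim: s => // m [|m' s] IHs _; first by exists m; rewrite ?mem_head // big_seq1.
  have [//|m1 m1_s E] := IHs; rewrite big_cons E.
  case: (leqP (size g@_m1) (size g@_m)) => [le_m|/ltnW le_m].
    by exists m; rewrite ?mem_head.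
  by exists m1; rewrite // inE m1_s orbT.
have [|m m_g bE] := ex_max (msupp g); first by rewrite msupp_eq0.
have gm0 : g@_m != 0 by rewrite -mcoeff_msupp.
have Em : m = e by apply: max_e; rewrite // -bE.
rewrite -Em; split=> // m' ne_m'; rewrite ltnNge -bE; apply/negP => le_bm'.
have [gm'0|/max_e E] := eqVneq g@_m' 0; last by rewrite E // -Em eqxx in ne_m'.
by move: le_bm'; rewrite gm'0 size_poly0 /b bE leqn0 size_poly_eq0 (negbTE gm0).
Qed.

End DominantSums.

Section Levels.

Variable n : nat.
Implicit Types (lam F : 'I_n -> nat) (e m : 'X_{1..n}).

Definition psum F (k : nat) : nat := (\sum_(p < n | (p < k)%N) F p)%N.

Lemma psum0 F : psum F 0 = 0%N.
Proof. by rewrite /psum big_pred0. Qed.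

Lemma psumS F (i : 'I_n) : psum F i.+1 = (psum F i + F i)%N.
Proof.
rewrite /psum (bigD1 i) //= addnC; congr (_ + _)%N; apply: eq_bigl => p.
by rewrite -val_eqE /=; lia.
Qed.

Lemma psum_all F : psum F n = (\sum_p F p)%N.
Proof. by apply: eq_bigl => p; rewrite ltn_ord. Qed.

Lemma sum_above F (i : 'I_n) :
  (\sum_(p < n | (i < p)%N) F p + F i + psum F i = psum F n)%N.
Proof.
have -> : (\sum_(p < n | (i < p)%N) F p + F i = \sum_(p < n | ~~ (p < i)%N) F p)%N.
  rewrite [RHS](bigD1 i) ?ltnn // addnC; congr (_ + _)%N.
  by apply: eq_bigl => p; rewrite -val_eqE /=; lia.
by rewrite psum_all [RHS](bigID (fun p : 'I_n => (p < i)%N)) /= addnC.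
Qed.

(** Once the degree of m is fixed, validity from the right becomes an upper bound
    on the walk mu: together the conditions are the sl2 fusion rules at level l. *)
Lemma validP l0 lam l1 l m : (l + 2 * mdeg m = l0 + psum lam n + l1)%N ->
  reflect (forall i : 'I_n, [/\ (m i <= lam i)%N,
     (m i + 2 * psum m i <= l0 + psum lam i)%N &
     (l0 + psum lam i + lam i <= l + 2 * psum m i + m i)%N]) (valid l0 lam l1 m).
Proof.
move=> level; have mE : mdeg m = psum m n by rewrite psum_all mdegE.
have rightE (i : 'I_n) : (m i + 2 * \sum_(p < n | (i < p)%N) m p <= l1 + \sum_(p < n | (i < p)%N) lam p)%N
    = (l0 + psum lam i + lam i <= l + 2 * psum m i + m i)%N.
  by have := sum_above m i; have := sum_above lam i; rewrite mE in level; lia.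
apply: (iffP forallP) => H i.
  by have /and3P[H1 H2] := H i; rewrite rightE.
by have [H1 H2 H3] := H i; apply/and3P; split; rewrite ?rightE.
Qed.

(** At level 1 the walk stays in {0, 1}, so every exponent is determined by the
    position and by lam. *)
Lemma level1_valid_uniq (d0 d1 : bool) lam m e :
  (1 + 2 * mdeg m = d0 + psum lam n + d1)%N -> mdeg e = mdeg m ->
  valid d0 lam d1 m -> valid d0 lam d1 e -> m = e.
Proof.
move=> level Ee; have level' : (1 + 2 * mdeg e = d0 + psum lam n + d1)%N by rewrite Ee.
move=> /(validP level) Hm /(validP level') He.
have psumE k : (k <= n)%N -> psum m k = psum e k.
  elim: k => [|k IHk] lt_k; first by rewrite !psum0.
  have := IHk (ltnW lt_k); have := psumS m (Ordinal lt_k); have := psumS e (Ordinal lt_k).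
  by have [] := Hm (Ordinal lt_k); have [] := He (Ordinal lt_k) => /=; lia.
apply/mnmP => i; have := psumE i (ltnW (ltn_ord i)); have := psumE i.+1 (ltn_ord i).
by rewrite !psumS; lia.
Qed.

Section Peel.

Variables (l0 l1 l : nat) (lam : 'I_n -> nat) (e : 'X_{1..n}).
Hypothesis level : (l.+1 + 2 * mdeg e = l0 + psum lam n + l1)%N.
Hypothesis e_valid : valid l0 lam l1 e.

Let ev (k : nat) : nat := if insub k is Some i then e i else 0%N.
Let lv (k : nat) : nat := if insub k is Some i then lam i else 0%N.

(** The walk in {0, 1} that is split off from the walk mu of a valid monomial of
    level l + 1.  What remains has to stay between 0 and l, so mu > 0 is needed
    where the unit walk is at 1, and mu <= l where it is at 0
    ([unit_walk_inv]).  It therefore moves whenever it can: down when a factor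
    X_k is available, up when X_k does not exhaust lam_k. *)
Fixpoint unit_walk (k : nat) : bool :=
  if k is k'.+1 then (if unit_walk k' then ev k' == 0%N else (ev k' < lv k')%N) else (0 < l0)%N.

Lemma unit_walkS (i : 'I_n) : unit_walk i.+1 = if unit_walk i then e i == 0%N else (e i < lam i)%N.
Proof. by rewrite /= /ev /lv valK. Qed.

Lemma unit_walk_inv k : (k <= n)%N ->
  (if unit_walk k then 2 * psum e k < l0 + psum lam k else l0 + psum lam k <= l + 2 * psum e k)%N.
Proof.
elim: k => [|k IHk] lt_k; first by rewrite !psum0 /=; case: ifP; lia.
have := IHk (ltnW lt_k); have [] := (elimT (validP level) e_valid) (Ordinal lt_k).
rewrite -[k in psum _ k.+1]/(val (Ordinal lt_k)) -[k.+1]/(val (Ordinal lt_k)).+1.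
rewrite !psumS unit_walkS /=; move: (e _) (lam _) (psum e k) (psum lam k) => a b c d.
by case: (unit_walk k); case: ifP; lia.
Qed.

Definition peel_lam (i : 'I_n) : nat := (unit_walk i (+) unit_walk i.+1)%N.
Definition peel_mnm : 'X_{1..n} := [multinom (unit_walk i && ~~ unit_walk i.+1 : nat) | i < n].

Lemma peel_psum k : (k <= n)%N ->
  (unit_walk 0 + psum peel_lam k = unit_walk k + 2 * psum peel_mnm k)%N.
Proof.
clear level e_valid.
elim: k => [|k IHk] lt_k; first by rewrite !psum0 !addn0.
pose i := Ordinal lt_k.
have IH : (unit_walk 0 + psum peel_lam i = unit_walk i + 2 * psum peel_mnm i)%N := IHk (ltnW lt_k).
suffices : (unit_walk 0 + psum peel_lam i.+1 = unit_walk i.+1 + 2 * psum peel_mnm i.+1)%N by [].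
rewrite !psumS [peel_lam i]/peel_lam mnmE; move: IH.
move: (unit_walk 0) (unit_walk i) (unit_walk i.+1) (psum _ i) (psum _ i) => x0 x y a b.
by case: x; case: y => /=; lia.
Qed.

Lemma peel_level : (1 + 2 * mdeg peel_mnm = unit_walk 0 + psum peel_lam n + ~~ unit_walk n)%N.
Proof.
clear level e_valid.
have := peel_psum (leqnn n); rewrite [psum peel_mnm n]psum_all -mdegE.
by case: (unit_walk n) => /=; lia.
Qed.

Lemma peel_valid : valid (unit_walk 0) peel_lam (~~ unit_walk n) peel_mnm.
Proof.
clear level e_valid.
apply/(validP peel_level) => i; have := peel_psum (ltnW (ltn_ord i)).
rewrite /peel_lam !mnmE; move: (unit_walk 0) (unit_walk i) (unit_walk i.+1) => x0 x y.
by case: x; case: y => /= E; split; lia.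
Qed.

Lemma peel_le : [/\ (unit_walk 0 <= l0)%N, (~~ unit_walk n <= l1)%N, forall i, (peel_lam i <= lam i)%N
  & forall i, (peel_mnm i <= e i)%N].
Proof.
have V := elimT (validP level) e_valid.
split.
- by rewrite /=; case: l0.
- have := unit_walk_inv (leqnn n); move: level; rewrite mdegE -psum_all.
  by case: (unit_walk n) => //=; lia.
- move=> i; have [] := V i; rewrite /peel_lam unit_walkS.
  by case: (unit_walk i) => /=; [case: (e i =P 0%N)|case: (ltnP (e i) (lam i))] => /=; lia.
move=> i; have [] := V i; rewrite mnmE unit_walkS.
by case: (unit_walk i) => //=; case: (e i =P 0%N) => /=; lia.
Qed.

Lemma peel_rest :
  (l + 2 * mdeg (e - peel_mnm) =
     (l0 - unit_walk 0) + psum (fun i => lam i - peel_lam i)%N n + (l1 - ~~ unit_walk n))%N /\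
  valid (l0 - unit_walk 0) (fun i => lam i - peel_lam i)%N (l1 - ~~ unit_walk n) (e - peel_mnm)%MM.
Proof.
have [le0 le1 le_lam le_e] := peel_le.
have psumB F G k : (forall i, G i <= F i)%N ->
    (psum (fun i => F i - G i)%N k + psum G k = psum F k)%N.
  by move=> le_GF; rewrite /psum -big_split; apply: eq_bigr => i _; rewrite /= subnK.
have psumBm k : (psum (e - peel_mnm)%MM k + psum peel_mnm k = psum e k)%N.
  rewrite -(psumB e peel_mnm k le_e); congr (_ + _)%N.
  by apply: eq_bigr => i _; rewrite mnmBE.
have lev : (l + 2 * mdeg (e - peel_mnm) =
     (l0 - unit_walk 0) + psum (fun i => lam i - peel_lam i)%N n + (l1 - ~~ unit_walk n))%N.
  have dE (m : 'X_{1..n}) : mdeg m = psum m n by rewrite psum_all mdegE.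
  move: level peel_level (psumBm n) (psumB lam peel_lam n le_lam).
  by rewrite !dE; lia.
split=> //; apply/(validP lev) => i.
have [V1 V2 V3] := elimT (validP level) e_valid i.
have := unit_walk_inv (ltnW (ltn_ord i)); have := peel_psum (ltnW (ltn_ord i)).
have := psumBm i; have := psumB lam peel_lam i le_lam; have := le_lam i; have := le_e i.
rewrite mnmBE !mnmE /peel_lam unit_walkS.
move: le0; move: (unit_walk 0) => x0 le0.
by case: (unit_walk i) => /=; [case: (e i =P 0%N)|case: (ltnP (e i) (lam i))] => /= *; split; lia.
Qed.

End Peel.

End Levels.

Section DominantApolar.

Variables (n : nat) (K : fieldType).
Hypothesis charK : [pchar K] =i pred0.
Variable M : nat.
Hypothesis M_gt1 : (1 < M)%N.
Variables (P Q : 'I_n -> {poly K}).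
Hypothesis size_P : forall i : 'I_n, size (P i) = (lexw n M i).+1.
Hypothesis size_Q : forall i : 'I_n, size (Q i) = (lexw n M (rev_ord i)).+1.

Lemma P_neq0 i : P i != 0.
Proof. by rewrite -size_poly_eq0 size_P. Qed.

Lemma Q_neq0 i : Q i != 0.
Proof. by rewrite -size_poly_eq0 size_Q. Qed.

Lemma PQ_indep i j : i != j -> P i * Q j != P j * Q i.
Proof.
move=> ne_ij; apply/eqP => /(congr1 (fun p : {poly K} => size p)).
rewrite !size_mul ?P_neq0 ?Q_neq0 // !size_P !size_Q /= /lexw.
wlog lt_ij : i j ne_ij / (i < j)%N.
  move=> W; case: (ltngtP i j) => [|lt_ji E|/val_inj/eqP].
  - exact: W.
  - by apply: (W j i); rewrite // eq_sym.
  by rewrite (negbTE ne_ij).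
have lt1 : (M ^ (n - j) < M ^ (n - i))%N by rewrite ltn_exp2l //; have := ltn_ord j; lia.
have lt2 : (M ^ (n - (n - i.+1)) < M ^ (n - (n - j.+1)))%N.
  by rewrite ltn_exp2l //; have := ltn_ord j; lia.
lia.
Qed.

Lemma apolar_ext l0 lam lam' l1 (g : {mpoly {poly K}[n]}) :
  lam =1 lam' -> apolar P Q l0 lam l1 g -> apolar P Q l0 lam' l1 g.
Proof. by move=> E [? ? H]; split=> // i; rewrite -E. Qed.

(** The determinant of [apolar_mx], with one column for each i such that lam_i = 1,
    is dominant at the only valid monomial of its degree. *)
Lemma level1_dominant (d0 d1 : bool) (lam : 'I_n -> nat) e :
  (forall i, lam i <= 1)%N -> (1 + 2 * mdeg e = d0 + psum lam n + d1)%N -> (mdeg e < M)%N ->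
  valid d0 lam d1 e ->
  exists g, [/\ apolar P Q d0 lam d1 g, homog_of (mdeg e) g & dominant e g].
Proof.
move=> lam1 level lt_eM e_val; pose s := mdeg e; pose J := [pred i | lam i == 1%N].
pose r := (psum lam n - s)%N.
have le_s : (s <= psum lam n)%N.
  rewrite psum_all /s mdegE; apply: leq_sum => i _.
  by have [] := elimT (validP level) e_val i.
have card_J : (r + s = #|J|)%N.
  rewrite subnK // psum_all -sum1_card [RHS]big_mkcond /=; apply: eq_bigr => i _.
  by rewrite inE; have := lam1 i; case: (lam i) => [|[|]].
have rs : (r + d0 + d1 = s.+1)%N by rewrite /r; lia.
pose f (b : 'I_(r + s)) : 'I_n := enum_val (cast_ord card_J b).
have f_inj : injective f by move=> b b' /enum_val_inj/cast_ord_inj.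
have occ i : (occurs f i : nat) = lam i.
  have -> : occurs f i = (lam i == 1%N).
    apply/existsP/idP => [[b /eqP<-]|J_i]; first by have := enum_valP (cast_ord card_J b).
    exists (cast_ord (esym card_J) (enum_rank_in J_i i)).
    by rewrite /f cast_ordKV enum_rankK_in.
  by have := lam1 i; case: (lam i) => [|[|]].
have ap := apolar_det P Q rs f_inj.
have hom : homog_of s (\det (apolar_mx P Q d0 f)) by apply: homog_det.
have nz := det_apolar_neq0 rs f_inj P_neq0 Q_neq0 PQ_indep.
exists (\det (apolar_mx P Q d0 f)).
have ap' := apolar_ext occ ap; split=> //.
apply: (apolar_dominant charK size_P size_Q lt_eM ap' hom nz) => m m_val Em.
by apply: (level1_valid_uniq (d0 := d0) (d1 := d1) (lam := lam)); rewrite // Em.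
Qed.

(** Induction on the level: the unit walk splits off a factor of level 1, the rest
    has a smaller level, and the product of the two forms is dominant at the
    product of the two monomials. *)
Lemma valid_dominant l l0 lam l1 e :
  (l + 2 * mdeg e = l0 + psum lam n + l1)%N -> (mdeg e < M)%N -> valid l0 lam l1 e ->
  exists g, [/\ apolar P Q l0 lam l1 g, homog_of (mdeg e) g & dominant e g].
Proof.
elim: l => [|l IHl] in l0 lam l1 e *.
  move=> level _ /(validP level) V.
  have e0 : e = 0%MM.
    by apply/mnmP => i; rewrite mnm0E; have [] := V i; lia.
  exists 1%:MP; split; first exact: apolarC.
    by move=> m; rewrite e0 mcoeff1; case: (m =P 0%MM) => [->|_]; rewrite ?mdeg0 ?eqxx.
  rewrite e0; split=> [|m /negbTE m0]; first by rewrite mcoeff1 eqxx oner_neq0.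
  by rewrite !mcoeff1 m0 eqxx size_poly0 size_poly1.
move=> level lt_eM e_val.
have [lev' val'] := peel_rest level e_val; have [le0 le1 le_lam le_e] := peel_le level e_val.
set x := unit_walk l0 lam e in lev' val' le0 le1 *.
set e' := peel_mnm l0 lam e in lev' val' le_e *.
set lam' := peel_lam l0 lam e in lev' val' le_lam *.
have def_e : (e' + (e - e'))%MM = e.
  by rewrite addmC submK //; apply/mnm_lepP.
have dege : (mdeg e' + mdeg (e - e'))%N = mdeg e by rewrite -mdegD def_e.
have [|g [g_ap g_hom g_dom]] := IHl _ _ _ _ lev' _ val'; first by lia.
have [||g' [g'_ap g'_hom g'_dom]] := @level1_dominant (x 0) (~~ x n) lam' e' _ (peel_level l0 lam e) _ (peel_valid l0 lam e).
- by move=> i; rewrite /lam' /peel_lam; case: (_ (+) _).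
- by lia.
exists (g' * g); split.
- have := apolarM g'_ap g_ap; rewrite !subnKC //; apply: apolar_ext => i.
  by rewrite subnKC.
- by rewrite -dege; apply: homogM.
by rewrite -def_e; apply: dominantM.
Qed.

End DominantApolar.

(** * Coordinates and ideals of powers *)
Section HomogeneousCoordinates.

Variable n : nat.

Definition monomials (i : nat) : seq 'X_{1..n} :=
  [seq val m | m : 'X_{1..n < i.+1} <- [seq m : 'X_{1..n < i.+1} <- enum {: 'X_{1..n < i.+1}} | mdeg (val m) == i]].

Lemma mem_monomials i m : (m \in monomials i) = (mdeg m == i).
Proof.
apply/mapP/eqP => [[m' ]|Em]; first by rewrite mem_filter => /andP[/eqP Em _] ->.
have lt_m : (mdeg m < i.+1)%N by rewrite Em.
by exists (BMultinom lt_m); rewrite // mem_filter /= Em eqxx mem_enum.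
Qed.

Lemma monomials_uniq i : uniq (monomials i).
Proof.
rewrite map_inj_uniq; last by move=> x y; apply: val_inj.
exact/filter_uniq/enum_uniq.
Qed.

Definition mon (i : nat) (k : 'I_(size (monomials i))) : 'X_{1..n} := nth 0%MM (monomials i) k.

Lemma mdeg_mon i k : mdeg (@mon i k) = i.
Proof. by apply/eqP; rewrite -mem_monomials mem_nth. Qed.

Lemma mon_inj i : injective (@mon i).
Proof. by move=> k k' /eqP; rewrite nth_uniq ?monomials_uniq // => /eqP/val_inj. Qed.

Lemma mon_onto i m : mdeg m = i -> exists k, @mon i k = m.
Proof.
move=> /eqP; rewrite -mem_monomials => m_i.
have lt_k : (index m (monomials i) < size (monomials i))%N by rewrite index_mem.
by exists (Ordinal lt_k); rewrite /mon nth_index.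
Qed.

Variables (R : comNzRingType) (i : nat).
Notation N := (size (monomials i)).

Definition coords (p : {mpoly R[n]}) : 'rV[R]_N := \row_k p@_(mon k).
Definition from_coords (v : 'rV[R]_N) : {mpoly R[n]} := \sum_k v 0 k *: 'X_[mon k].

Lemma mcoeff_from_coords v k : (from_coords v)@_(mon k) = v 0 k.
Proof.
rewrite raddf_sum (bigD1 k) //= mcoeffZ mcoeffX eqxx mulr1 big1 ?addr0 // => k' ne_k'.
by rewrite mcoeffZ mcoeffX (inj_eq (@mon_inj i)) (negbTE ne_k') mulr0.
Qed.

Lemma from_coordsK : cancel from_coords coords.
Proof. by move=> v; apply/rowP => k; rewrite mxE mcoeff_from_coords. Qed.

Lemma from_coords_homog v : from_coords v \is i.-homog.
Proof.
by apply: rpred_sum => k _; apply: rpredZ; rewrite dhomogX /= mdeg_mon.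
Qed.

Lemma from_coordsE (p : {mpoly R[n]}) : from_coords (coords p) = pihomog mdeg i p.
Proof.
apply/mpolyP => m; case: (eqVneq (mdeg m) i) => [Em|ne_m].
  have [k <-] := mon_onto Em; rewrite mcoeff_from_coords mxE.
  rewrite [in LHS](pihomog_partitionE (leqnn (msize p))) raddf_sum /=.
  have hne j : j != i -> (pihomog mdeg j p)@_(mon k) = 0.
    by move=> ne; apply: (dhomog_nemf_coeff (pihomogP mdeg j p)); rewrite /= mdeg_mon eq_sym.
  have [lt_i|le_i] := ltnP i (msize p).
    by rewrite (bigD1 (Ordinal lt_i)) //= big1 ?addr0 // => j ne_j; rewrite hne.
  rewrite big1 => [|j _]; last by rewrite hne // ltn_eqF // (leq_trans (ltn_ord j)).
  rewrite pihomogE raddf_sum /= big1_seq // => m' /andP[/eqP Em' m'_p].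
  by have := msize_mdeg_lt m'_p; rewrite Em' ltnNge le_i.
rewrite (dhomog_nemf_coeff (from_coords_homog _) ne_m).
by rewrite (dhomog_nemf_coeff (pihomogP mdeg i p) ne_m).
Qed.

Lemma coords_homogK (p : {mpoly R[n]}) : p \is i.-homog -> from_coords (coords p) = p.
Proof. by move=> hp; rewrite from_coordsE pihomog_dE. Qed.

Lemma from_coords_mul (r : nat) (c : 'rV[R]_r) (T : 'M[R]_(r, N)) :
  from_coords (c *m T) = \sum_j c 0 j *: from_coords (row j T).
Proof.
rewrite /from_coords (eq_bigr (fun k => \sum_j (c 0 j * T j k) *: 'X_[mon k])) => [|k _].
  rewrite exchange_big /=; apply: eq_bigr => j _; rewrite scaler_sumr.
  by apply: eq_bigr => k _; rewrite mxE scalerA.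
by rewrite mxE scaler_suml.
Qed.

End HomogeneousCoordinates.

Section PowerIdeals.

Variables (n : nat).

(** [lform] and [pideal] extend [linform] and [power_ideal] to coefficient rings
    that are not fields: K[tau], and the ring of polynomials in the coefficients
    of the forms. *)
Definition lform (R : comNzRingType) m (A : 'M[R]_(m, n)) (j : 'I_m) : {mpoly R[n]} :=
  \sum_(i < n) A j i *: 'X_i.

Definition pideal (R : comNzRingType) m (A : 'M[R]_(m, n)) (d : nat) (p : {mpoly R[n]}) : Prop :=
  exists q : 'I_m -> {mpoly R[n]}, p = \sum_j q j * lform A j ^+ d.

Section Closure.

Variables (R : comNzRingType) (m d : nat) (A : 'M[R]_(m, n)).

Lemma pideal0 : pideal A d 0.
Proof. by exists (fun=> 0); rewrite big1 // => j _; rewrite mul0r. Qed.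

Lemma pidealD p q : pideal A d p -> pideal A d q -> pideal A d (p + q).
Proof.
move=> [a ->] [b ->]; exists (fun j => a j + b j).
by rewrite -big_split; apply: eq_bigr => j _; rewrite mulrDl.
Qed.

Lemma pidealMl r p : pideal A d p -> pideal A d (r * p).
Proof.
move=> [a ->]; exists (fun j => r * a j).
by rewrite mulr_sumr; apply: eq_bigr => j _; rewrite mulrA.
Qed.

Lemma pidealZ c p : pideal A d p -> pideal A d (c *: p).
Proof. by rewrite -mul_mpolyC; apply: pidealMl. Qed.

Lemma pidealN p : pideal A d p -> pideal A d (- p).
Proof. by rewrite -mulN1r; apply: pidealMl. Qed.

Lemma pidealB p q : pideal A d p -> pideal A d q -> pideal A d (p - q).
Proof. by move=> hp hq; apply: pidealD (pidealN hq). Qed.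

Lemma pideal_sum (I : Type) (r : seq I) (B : pred I) (F : I -> {mpoly R[n]}) :
  (forall i, B i -> pideal A d (F i)) -> pideal A d (\sum_(i <- r | B i) F i).
Proof.
by move=> hF; apply: (big_ind (pideal A d)) => //; [apply: pideal0 | apply: pidealD].
Qed.

Lemma lform_homog j : lform A j \is 1.-homog.
Proof. by apply: rpred_sum => i _; apply: rpredZ; rewrite dhomogX /= mdeg1. Qed.

Lemma pihomogM_homog i e (p l : {mpoly R[n]}) : l \is e.-homog ->
  pihomog mdeg i (p * l) = (if (e <= i)%N then pihomog mdeg (i - e) p else 0) * l.
Proof.
move=> hl; rewrite [in LHS](pihomog_partitionE (leqnn (msize p))) mulr_suml raddf_sum /=.
have E (j : nat) : pihomog mdeg i (pihomog mdeg j p * l) =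
    if (j + e == i)%N then pihomog mdeg j p * l else 0.
  have hjl := dhomogM (pihomogP mdeg j p) hl.
  by case: eqP => [<-|/eqP ne]; [rewrite pihomog_dE | rewrite (pihomog_ne0 _ hjl) // eq_sym].
rewrite (eq_bigr (fun j : 'I__ => if (j + e == i)%N then pihomog mdeg j p * l else 0));
  last by move=> j _; apply: E.
rewrite -big_mkcond /=.
case: leqP => [le_ei|lt_ie]; last by rewrite mul0r big1 // => j /eqP; lia.
have [lt_i|le_i] := ltnP (i - e) (msize p).
  rewrite (big_pred1 (Ordinal lt_i)) // => j.
  by rewrite /= -val_eqE /=; apply/eqP/eqP; lia.
rewrite big1 => [|j /eqP]; last by have := ltn_ord j; lia.
rewrite pihomogE big1_seq ?mul0r // => m' /andP[/eqP Em' m'_p].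
by have := msize_mdeg_lt m'_p; rewrite Em' ltnNge le_i.
Qed.

Lemma pideal_pihomog i p : pideal A d p -> pideal A d (pihomog mdeg i p).
Proof.
move=> [q ->]; rewrite raddf_sum /=.
exists (fun j => if (d <= i)%N then pihomog mdeg (i - d) (q j) else 0).
apply: eq_bigr => j _; apply: pihomogM_homog.
by have := dhomogMn d (lform_homog j); rewrite mul1n.
Qed.

End Closure.

Lemma map_lform (R S : comNzRingType) (phi : {rmorphism R -> S}) m (A : 'M[R]_(m, n)) j :
  map_mpoly phi (lform A j) = lform (map_mx phi A) j.
Proof.
rewrite raddf_sum /=; apply: eq_bigr => i _.
by rewrite map_mpolyZ map_mpolyX mxE.
Qed.

(** The variables followed by two arbitrary forms: a normal form, up to a linear
    change of variables, of n + 2 forms the first n of which are independent. *)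
Definition normal_mx (R : comNzRingType) (P Q : 'I_n -> R) : 'M[R]_(n + 2, n) :=
  \matrix_(j, i) match split j with
    | inl k => (k == i)%:R
    | inr k => if k == 0 then P i else Q i
    end.

Lemma lform_normall (R : comNzRingType) (P Q : 'I_n -> R) k :
  lform (normal_mx P Q) (lshift 2 k) = 'X_k.
Proof.
rewrite /lform (bigD1 k) //= mxE (unsplitK (inl k)) eqxx scale1r big1 ?addr0 // => i ne_i.
by rewrite mxE (unsplitK (inl k)) eq_sym (negbTE ne_i) scale0r.
Qed.

Lemma lform_normalr (R : comNzRingType) (P Q : 'I_n -> R) k :
  lform (normal_mx P Q) (rshift n k) = \sum_i (if k == 0 then P i else Q i) *: 'X_i.
Proof. by apply: eq_bigr => i _; rewrite mxE (unsplitK (inr k)). Qed.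

Lemma sum_normal_rows (V : nmodType) (F : 'I_(n + 2) -> V) :
  \sum_j F j = F (rshift n ord0) + F (rshift n (lift ord0 ord0)) + \sum_i F (lshift 2 i).
Proof.
rewrite big_split_ord /= addrC; congr (_ + _).
by rewrite big_ord_recl; congr (_ + _); rewrite big_ord_recl big_ord0 addr0.
Qed.

Lemma normal_idealP (R : comNzRingType) (P Q : 'I_n -> R) e p :
  normal_ideal P Q e (fun=> e) e p <-> pideal (normal_mx P Q) e.+1 p.
Proof.
have L0 : lform (normal_mx P Q) (rshift n ord0) = \sum_i P i *: 'X_i := lform_normalr P Q ord0.
have L1 : lform (normal_mx P Q) (rshift n (lift ord0 ord0)) = \sum_i Q i *: 'X_i :=
  lform_normalr P Q (lift ord0 ord0).
split=> [[q0 [q1 [q ->]]]|[q ->]].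
  exists (fun j => match split j with inl k => q k | inr k => if k == 0 then q0 else q1 end).
  rewrite sum_normal_rows L0 L1 !(unsplitK (inr _)); congr (_ + _).
  by apply: eq_bigr => i _; rewrite (unsplitK (inl _)) lform_normall.
exists (q (rshift n ord0)), (q (rshift n (lift ord0 ord0))), (fun i => q (lshift 2 i)).
rewrite sum_normal_rows L0 L1; congr (_ + _).
by apply: eq_bigr => i _; rewrite lform_normall.
Qed.

End PowerIdeals.

(** If v is a linear relation between the columns, take k such that v_k has the
    largest degree: in the row k only the term v_k T_kk reaches its degree, so the
    relation fails there. *)
Lemma det_dominant_neq0 (K : fieldType) N (T : 'M[{poly K}]_N) :
  (forall k, T k k != 0) -> (forall k k', k' != k -> (size (T k k') < size (T k k))%N) ->
  \det T != 0.
Proof.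
move=> T0 Tlt; apply/negP; rewrite -det_tr => /det0P[v v0 vT].
have [k0 vk0] : exists k, v 0 k != 0 by apply/rV0Pn.
pose k := [arg max_(k > k0) size (v 0 k)].
have max_k k' : (size (v ord0 k') <= size (v ord0 k))%N.
  by rewrite /k; case: arg_maxnP => // j _; apply.
have vk : v 0 k != 0 by rewrite -size_poly_gt0 (leq_trans _ (max_k k0)) // size_poly_gt0.
have := congr1 (fun w : 'rV_N => w 0 k) vT; rewrite !mxE => /eqP; apply/negP.
have nz : v 0 k * T^T k k != 0 by rewrite mxE mulf_neq0.
rewrite -size_poly_eq0 (size_dominated_sum (i0 := k)) ?index_enum_uniq ?mem_index_enum //.
  by rewrite size_poly_eq0.
move=> k' ne_k'; have lt_T := Tlt k k' ne_k'.
by apply: size_mul_lt => //; rewrite ![T^T _ _]mxE ?(ltnW lt_T) ?lt_T ?orbT.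
Qed.

(** * Reductions and functionals over K[tau] *)
Section GradedDimension.

Variables (K : fieldType) (n m d : nat) (A : 'M[K]_(m, n)).

Definition graded_span (i h : nat) : Prop :=
  exists b : 'I_h -> {mpoly K[n]}, (forall j, b j \is i.-homog) /\
    forall p : {mpoly K[n]}, p \is i.-homog ->
      exists c : 'rV[K]_h, pideal A d (p - \sum_j c 0 j *: b j).

Definition graded_indep (i h : nat) : Prop :=
  exists b : 'I_h -> {mpoly K[n]}, (forall j, b j \is i.-homog) /\
    forall c : 'rV[K]_h, pideal A d (\sum_j c 0 j *: b j) -> c = 0.

(** Modulo the ideal, an independent family is expressed by a spanning family of
    the same size through a square matrix, which is injective and hence
    invertible. *)
Lemma graded_dim_span_indep (i h : nat) :
  graded_span i h -> graded_indep i h -> has_graded_dim (power_ideal A d) i h.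
Proof.
move=> [b [b_hom b_span]] [b' [b'_hom b'_indep]].
have [t tP] := fin_all_exists (fun k => b_span (b' k) (b'_hom k)).
pose T : 'M[K]_h := \matrix_(k, j) t k 0 j.
have combT (c : 'rV[K]_h) :
    pideal A d (\sum_k c 0 k *: b' k - \sum_j (c *m T) 0 j *: b j).
  have -> : \sum_j (c *m T) 0 j *: b j = \sum_k c 0 k *: (\sum_j t k 0 j *: b j).
    rewrite (eq_bigr (fun j => \sum_k (c 0 k * t k 0 j) *: b j)) => [|j _]; last first.
      by rewrite mxE scaler_suml; apply: eq_bigr => k _; rewrite mxE.
    rewrite exchange_big; apply: eq_bigr => k _; rewrite scaler_sumr.
    by apply: eq_bigr => j _; rewrite scalerA.
  rewrite -sumrB; apply: pideal_sum => k _; rewrite -scalerBr.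
  exact: pidealZ.
have uT : T \in unitmx.
  rewrite -row_free_unit -kermx_eq0; apply/eqP/row_matrixP => k; rewrite row0.
  have /sub_kermxP := row_sub k (kermx T); move: (row k _) => c cT.
  apply: b'_indep; have := combT c; rewrite cT [X in _ - X]big1 ?subr0 // => j _.
  by rewrite mxE scale0r.
have b_indep (c : 'rV[K]_h) : pideal A d (\sum_j c 0 j *: b j) -> c = 0.
  move=> Ic; have := combT (c *m invmx T); rewrite mulmxKV // => /pidealD/(_ Ic).
  rewrite subrK => /b'_indep c0.
  by rewrite -(mulmxKV uT c) c0 mul0mx.
exists b; split=> // p p_hom; have [c pc] := b_span p p_hom.
exists c; split=> // c' pc'; apply/eqP; rewrite -subr_eq0; apply/eqP/b_indep.
have := pidealB pc' pc; rewrite opprB addrC addrA subrK.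
rewrite -sumrN -big_split /=; congr (pideal _ _ _); apply: eq_bigr => j _.
by rewrite !mxE scalerBl addrC.
Qed.

End GradedDimension.

Section Genericity.

Variables (K : fieldType) (n e : nat).
Hypothesis charK : [pchar K] =i pred0.
Local Notation d := e.+1.

Definition valid_set (i : nat) : {set 'I_(size (monomials n i))} :=
  [set k | valid e (fun=> e) e (mon k)].

Section Family.

Variables (M i : nat) (P Q : 'I_n -> {poly K}).
Hypothesis lt_iM : (i < M)%N.
Hypothesis M_gt1 : (1 < M)%N.
Hypothesis size_P : forall k : 'I_n, size (P k) = (lexw n M k).+1.
Hypothesis size_Q : forall k : 'I_n, size (Q k) = (lexw n M (rev_ord k)).+1.
Local Notation N := (size (monomials n i)).

(** Elements of the ideal for the invalid monomials, completed by the valid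
    monomials, form a basis over K(tau): the source of the spanning property. *)
Lemma reduction_system : exists h : 'I_N -> {mpoly {poly K}[n]},
  [/\ forall k, k \in valid_set i -> h k = 'X_[mon k],
      forall k, k \notin valid_set i -> pideal (normal_mx P Q) d (h k) &
      \det (\matrix_k coords i (h k)) != 0].
Proof.
have ex_h (k : 'I_N) : exists h : {mpoly {poly K}[n]},
    [/\ k \in valid_set i -> h = 'X_[mon k],
        k \notin valid_set i -> pideal (normal_mx P Q) d h & dominant (mon k) h].
  have [k_val|k_inv] := boolP (k \in valid_set i).
    exists 'X_[mon k]; split=> //; split=> [|m ne_m]; first by rewrite mcoeffX eqxx oner_neq0.
    by rewrite !mcoeffX eqxx eq_sym (negbTE ne_m) size_poly0 size_poly1.
  have lt_kM : (mdeg (mon k) < M)%N by rewrite mdeg_mon.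
  have := k_inv; rewrite inE => /(invalid_dominant charK size_P size_Q lt_kM).
  by case=> h [/normal_idealP hI hdom _]; exists h; split=> //; rewrite (negbTE k_inv).
have [h hP] := fin_all_exists ex_h.
exists h; split=> [k|k|]; try by case: (hP k).
apply: det_dominant_neq0 => [k|k k' ne_k']; have [_ _ [h0 hlt]] := hP k.
  by rewrite !mxE.
by rewrite !mxE; apply: hlt; rewrite (inj_eq (@mon_inj n i)).
Qed.

(** As many linear functionals vanishing on the ideal as there are valid
    monomials, independent over K(tau): the source of linear independence. *)
Lemma functional_system : exists g : 'I_#|valid_set i| -> {mpoly {poly K}[n]},
  [/\ forall j, homog_of i (g j),
      forall j p, pideal (normal_mx P Q) d p -> pairing p (g j) = 0 &
      \det (\matrix_(j, j') pairing 'X_[mon (enum_val j')] (g j)) != 0].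
Proof.
have level k : k \in valid_set i ->
    exists l, (l + 2 * mdeg (mon k) = e + psum (fun _ : 'I_n => e) n + e)%N.
  rewrite inE => k_val; exists (e + psum (fun _ : 'I_n => e) n + e - 2 * mdeg (mon k))%N; apply: subnK.
  have [n0|n_gt0] := posnP n.
    by have -> : mdeg (mon k) = 0%N by rewrite mdegE big1 // => p; have := ltn_ord p; lia.
  have lt_n : (n.-1 < n)%N by rewrite prednK.
  have /forallP/(_ (Ordinal lt_n))/and3P[V1 V2 _] := k_val.
  have := psumS (mon k) (Ordinal lt_n); have := psumS (fun _ : 'I_n => e) (Ordinal lt_n).
  rewrite /= prednK // mdegE -psum_all; move: V1 V2; rewrite -!/(psum _ _) /=; lia.
have ex_g (j : 'I_#|valid_set i|) : exists g : {mpoly {poly K}[n]},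
    [/\ apolar P Q e (fun=> e) e g, homog_of i g & dominant (mon (enum_val j)) g].
  have [l lE] := level _ (enum_valP j).
  have lt_jM : (mdeg (mon (enum_val j)) < M)%N by rewrite mdeg_mon.
  have := enum_valP j; rewrite inE => /(valid_dominant charK M_gt1 size_P size_Q lE lt_jM).
  by rewrite mdeg_mon.
have [g gP] := fin_all_exists ex_g.
exists g; split=> [j|j p /normal_idealP pI|]; first by case: (gP j).
  by have [g_ap _ _] := gP j; apply: apolar_pairing pI g_ap.
have fact_gt0 (m : 'X_{1..n}) : (0 < mnm_fact m)%N by apply: prodn_gt0 => k; apply: fact_gt0.
have entry j j' : size (pairing 'X_[mon (enum_val j')] (g j)) = size (g j)@_(mon (enum_val j')).
  by rewrite pairingX; apply: size_mulrn.
apply: det_dominant_neq0 => [j|j j' ne_j']; have [_ _ [g0 glt]] := gP j; rewrite !mxE.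
  by rewrite -size_poly_eq0 entry size_poly_eq0.
by rewrite !entry; apply: glt; rewrite (inj_eq (@mon_inj n i)) (inj_eq enum_val_inj).
Qed.

End Family.

End Genericity.

(** The part of an ideal in one degree is only known through a predicate;
    excluded middle gives it a basis, and so a rank. *)
Lemma subspace_row_space (F : fieldType) N (S : 'rV[F]_N -> Prop) :
  S 0 -> (forall u v, S u -> S v -> S (u + v)) -> (forall a v, S v -> S (a *: v)) ->
  exists W : 'M[F]_N, forall v, (v <= W)%MS <-> S v.
Proof.
move=> S0 SD SZ.
have rowsS k (W : 'M_(k, N)) : (forall j, S (row j W)) -> forall v, (v <= W)%MS -> S v.
  move=> SW v /submxP[c ->]; rewrite mulmx_sum_row.
  by apply: (big_ind S) => // j _; apply: SZ.
suffices grow t (W : 'M_N) : (N - \rank W < t)%N -> (forall v, (v <= W)%MS -> S v) ->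
    exists W' : 'M[F]_N, forall v, (v <= W')%MS <-> S v.
  apply: (grow N.+1 0) => [|v]; first by rewrite ltnS leq_subr.
  by rewrite submx0 => /eqP->.
elim: t => // t IHt in W *; rewrite ltnS => le_t SW.
have [full|not_full] := Classical_Prop.classic (forall v, S v -> (v <= W)%MS).
  by exists W => v; split; [apply: SW | apply: full].
have [v [Sv vW]] : exists v, S v /\ ~~ (v <= W)%MS.
  apply: Classical_Prop.NNPP => no_v; apply: not_full => v Sv.
  by apply/negPn/negP => vW; apply: no_v; exists v.
have lt_W : (W < W + v)%MS.
  rewrite ltmxE addsmxSl; apply: contra vW => /(submx_trans (addsmxSr W v)).
  by [].
apply: (IHt (W + v)%MS).
  have := rank_ltmx lt_W; have := rank_leq_row (W + v)%MS; lia.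
move=> u /sub_addsmxP[[a b] ->] /=; apply: SD; first by apply/SW/submxMl.
apply: (rowsS _ v) => [j|]; last exact: submxMl.
by rewrite row_id.
Qed.

Lemma coords_map n (R S : comNzRingType) (phi : {rmorphism R -> S}) i (p : {mpoly R[n]}) :
  coords i (map_mpoly phi p) = map_mx phi (coords i p).
Proof. by apply/rowP => k; rewrite !mxE mcoeff_map_mpoly. Qed.

Lemma pairing_pihomog n (R : comNzRingType) i (p g : {mpoly R[n]}) :
  homog_of i g -> pairing p g = pairing (pihomog mdeg i p) g.
Proof.
move=> g_hom; have pair0 j : j != i -> pairing (pihomog mdeg j p) g = 0.
  move=> ne_j; rewrite /pairing big1_seq // => m /= m_j.
  have Em : mdeg m = j by apply: (dhomog_mf (pihomogP mdeg j p)).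
  have [->|/g_hom Ei] := eqVneq g@_m 0; first by rewrite mul0rn mulr0.
  by rewrite -Em Ei eqxx in ne_j.
rewrite [in LHS](pihomog_partitionE (leqnn (msize p))) pairing_sum.
have [lt_i|le_i] := ltnP i (msize p).
  by rewrite (bigD1 (Ordinal lt_i)) //= big1 ?addr0 // => j ne_j; rewrite pair0.
rewrite big1 => [|j _]; last by rewrite pair0 // ltn_eqF // (leq_trans (ltn_ord j)).
rewrite (_ : pihomog mdeg i p = 0) ?pairing0 // pihomogE big1_seq // => m /andP[/eqP Em m_p].
by have := msize_mdeg_lt m_p; rewrite Em ltnNge le_i.
Qed.

(** * Specialization *)
Section SpanAndIndependence.

Variables (K : fieldType) (n e : nat).
Hypothesis charK : [pchar K] =i pred0.
Local Notation d := e.+1.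

Lemma span_of_system (i : nat) (A : 'M[K]_(n + 2, n)) (h : 'I_(size (monomials n i)) -> {mpoly K[n]}) :
  (forall k, k \in valid_set n e i -> h k = 'X_[mon k]) ->
  (forall k, k \notin valid_set n e i -> pideal A d (h k)) ->
  \det (\matrix_k coords i (h k)) != 0 ->
  graded_span d A i #|valid_set n e i|.
Proof.
move=> h_val h_inv detT; set V := valid_set n e i in h_val h_inv *.
pose T := \matrix_k coords i (h k).
have uT : T \in unitmx by rewrite unitmxE unitfE.
exists (fun j => 'X_[mon (enum_val j)]); split=> [j|p p_hom].
  by rewrite dhomogX /= mdeg_mon.
pose c := coords i p *m invmx T.
exists (\row_j c 0 (enum_val j)).
have -> : p = \sum_k c 0 k *: pihomog mdeg i (h k).
  rewrite -[LHS](coords_homogK p_hom) -(mulmxKV uT (coords i p)) from_coords_mul.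
  by apply: eq_bigr => k _; rewrite rowK from_coordsE.
rewrite (bigID (mem V)) /= (eq_bigr (fun k => c 0 k *: 'X_[mon k])) => [|k kV]; last first.
  by rewrite h_val // pihomog_dE // dhomogX /= mdeg_mon.
rewrite big_enum_val addrAC (eq_bigr (fun j => c 0 (enum_val j) *: 'X_[mon (enum_val j)])) //.
rewrite [X in _ - X + _](eq_bigr (fun j => c 0 (enum_val j) *: 'X_[mon (enum_val j)])) => [|j _]; last first.
  by rewrite mxE.
rewrite subrr add0r; apply: pideal_sum => k kV.
by apply/pidealZ/pideal_pihomog/h_inv.
Qed.

Definition generic_mx : 'M[{mpoly K[((n + 2) * n)%N]}]_(n + 2, n) :=
  \matrix_(j, k) 'X_(mxvec_index j k).

Lemma eval_generic_mx (A : 'M[K]_(n + 2, n)) :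
  map_mx (meval (fun k => mxvec A 0 k)) generic_mx = A.
Proof. by apply/matrixP => j k; rewrite !mxE mevalXU mxvecE. Qed.

(** Keep the cofactors of the relations of [reduction_system], specialized at
    tau = t, and let the forms vary.  The resulting determinant is a polynomial f
    in the coefficients of the forms, and the condition f != 0 suffices for
    spanning; it holds at the specialized family if t is not a root of D. *)
Lemma span_open (M i : nat) (P Q : 'I_n -> {poly K}) :
  (i < M)%N ->
  (forall k : 'I_n, size (P k) = (lexw n M k).+1) ->
  (forall k : 'I_n, size (Q k) = (lexw n M (rev_ord k)).+1) ->
  exists2 D : {poly K}, D != 0 & forall t, ~~ root D t ->
    exists f : {mpoly K[((n + 2) * n)%N]},
      f.@[fun k => mxvec (map_mx (horner_eval t) (normal_mx P Q)) 0 k] != 0 /\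
      forall A, f.@[fun k => mxvec A 0 k] != 0 -> graded_span d A i #|valid_set n e i|.
Proof.
move=> lt_iM size_P size_Q.
have [h [h_val h_inv detT]] := reduction_system e charK lt_iM size_P size_Q.
exists (\det (\matrix_k coords i (h k))) => // t Dt.
have ex_q (k : 'I_(size (monomials n i))) : exists q : 'I_(n + 2) -> {mpoly {poly K}[n]},
    k \notin valid_set n e i -> h k = \sum_j q j * lform (normal_mx P Q) j ^+ d.
  have [_|/h_inv[q ->]] := boolP (k \in valid_set n e i); first by exists (fun=> 0).
  by exists q.
have [q qE] := fin_all_exists ex_q.
pose q' k j := map_mpoly (horner_eval t) (q k j).
pose hA (A : 'M[K]_(n + 2, n)) k : {mpoly K[n]} :=
  if k \in valid_set n e i then 'X_[mon k] else \sum_j q' k j * lform A j ^+ d.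
pose G k : {mpoly {mpoly K[((n + 2) * n)%N]}[n]} :=
  if k \in valid_set n e i then 'X_[mon k]
  else \sum_j map_mpoly (@mpolyC _ K) (q' k j) * lform generic_mx j ^+ d.
exists (\det (\matrix_k coords i (G k))).
have evalG A : (\det (\matrix_k coords i (G k))).@[fun k => mxvec A 0 k] =
    \det (\matrix_k coords i (hA A k)).
  rewrite -det_map_mx; congr (\det _); apply/row_matrixP => k; rewrite -map_row !rowK.
  rewrite -coords_map; congr (coords i _); rewrite /G /hA.
  case: ifP => _; first by rewrite map_mpolyX.
  rewrite raddf_sum /=; apply: eq_bigr => j _; rewrite rmorphM rmorphXn /= map_lform eval_generic_mx.
  congr (_ * _); apply/mpolyP => m; rewrite !mcoeff_map_mpoly /=; exact: mevalC.
split=> [|A]; rewrite evalG.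
  rewrite (_ : \det _ = (\det (\matrix_k coords i (h k))).[t]) //.
  rewrite -[RHS]/(horner_eval t _) -det_map_mx; congr (\det _); apply/row_matrixP => k.
  rewrite -map_row !rowK -coords_map; congr (coords i _); rewrite /hA.
  case: ifP => [k_val|/negbT k_inv]; first by rewrite h_val // map_mpolyX.
  rewrite (qE k k_inv) raddf_sum /=; apply: eq_bigr => j _.
  by rewrite rmorphM rmorphXn /= map_lform.
move=> detA; apply: (@span_of_system i A (hA A)) => // k kV; rewrite /hA.
  by rewrite kV.
by rewrite (negbTE kV); exists (q' k).
Qed.

(** Independence holds for all pairs of forms, not only for general ones.  Deform
    the given forms to P and Q, which coincide with them at tau = 0.  A basis W of
    the ideal at tau = 0 lifts to the ideal over K[tau], where it stays
    independent, and [functional_system] bounds the rank of that lift.  So the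
    ideal leaves room for as many classes as there are valid monomials. *)
Lemma indep_normal (i : nat) (p q : 'I_n -> K) :
  graded_indep d (normal_mx p q) i #|valid_set n e i|.
Proof.
pose M := i.+2; pose A := normal_mx p q.
pose P k := (p k)%:P + 'X^(lexw n M k); pose Q k := (q k)%:P + 'X^(lexw n M (rev_ord k)).
have lexw_gt0 k : (0 < lexw n M k)%N by rewrite expn_gt0.
have size_PX (a : K) w : (0 < w)%N -> size (a%:P + 'X^w) = w.+1.
  move=> w_gt0; rewrite addrC size_polyDl size_polyXn // ltnS.
  exact: leq_trans (size_polyC_leq1 a) w_gt0.
have size_P k : size (P k) = (lexw n M k).+1 by apply: size_PX.
have size_Q k : size (Q k) = (lexw n M (rev_ord k)).+1 by apply: size_PX.
have [g [g_hom g_kill detg]] :=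
  functional_system e charK (ltnW (ltnSn i.+1)) (isT : (1 < M)%N) size_P size_Q.
have A0 : map_mx (horner_eval 0) (normal_mx P Q) = A.
  apply/matrixP => j k; rewrite !mxE /horner_eval; case: split => [j'|j'].
    by case: eqP => _; rewrite ?hornerC // -polyC1 hornerC.
  by case: ifP => _; rewrite !hornerE expr0n gtn_eqF // addr0.
set V := valid_set n e i in g g_hom g_kill detg *.
pose N := size (monomials n i).
have [W WP] : exists W : 'M[K]_N, forall v, (v <= W)%MS <-> pideal A d (from_coords v).
  apply: subspace_row_space => [|u v Iu Iv|a v Iv].
  - rewrite /from_coords big1 => [|k _]; first exact: pideal0.
    by rewrite mxE scale0r.
  - have := pidealD Iu Iv; rewrite -big_split /=; congr (pideal _ _ _).
    by apply: eq_bigr => k _; rewrite mxE scalerDl.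
  have := pidealZ a Iv; rewrite /from_coords scaler_sumr; congr (pideal _ _ _).
  by apply: eq_bigr => k _; rewrite mxE scalerA.
pose r := \rank W.
have ex_w (a : 'I_r) : exists w : 'I_(n + 2) -> {mpoly K[n]},
    from_coords (row a (row_base W)) = \sum_j w j * lform A j ^+ d.
  by apply/WP; rewrite -(eq_row_base W) row_sub.
have [w wE] := fin_all_exists ex_w.
pose v a := \sum_j map_mpoly polyC (w a j) * lform (normal_mx P Q) j ^+ d.
pose G : 'M[{poly K}]_(r, N) := \matrix_a coords i (v a).
pose Phi : 'M[{poly K}]_(N, #|V|) := \matrix_(k, j) pairing 'X_[mon k] (g j).
have GPhi : G *m Phi = 0.
  apply/matrixP => a j; rewrite !mxE -[RHS](g_kill j (v a)); last by exists (fun j => map_mpoly polyC (w a j)).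
  rewrite (eq_bigr (fun k => pairing ((v a)@_(mon k) *: 'X_[mon k]) (g j))) => [|k _]; last first.
    by rewrite pairingZ !mxE.
  rewrite -pairing_sum (pairing_pihomog (v a) (g_hom j)) -from_coordsE /from_coords.
  by congr pairing; apply: eq_bigr => k _; rewrite mxE.
have G0 : map_mx (horner_eval 0) G = row_base W.
  apply/row_matrixP => a; rewrite -map_row rowK -coords_map -[RHS]from_coordsK wE.
  congr (coords i _); rewrite /v raddf_sum /=; apply: eq_bigr => j _.
  rewrite rmorphM rmorphXn /= map_lform A0; congr (_ * _); apply/mpolyP => m.
  by rewrite !mcoeff_map_mpoly /= /horner_eval hornerC.
pose toF := @tofrac {poly K}.
have rank_le (s t1 : nat) (X : 'M[{poly K}]_(s, t1)) (Y : 'M[{poly K}]_(t1, s)) :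
    \det (X *m Y) != 0 -> \rank (map_mx toF X) = s /\ \rank (map_mx toF Y) = s.
  move=> detXY; have u : map_mx toF X *m map_mx toF Y \in unitmx.
    by rewrite -map_mxM unitmxE unitfE det_map_mx tofrac_eq0.
  split; apply/eqP; rewrite eqn_leq.
    by rewrite rank_leq_row -{1}(mxrank_unit u) mxrankM_maxl.
  by rewrite rank_leq_col -{1}(mxrank_unit u) mxrankM_maxr.
have [D GD] : exists D, row_base W *m D = 1%:M by apply/row_freeP/row_base_free.
(* The rank of the lift can only drop at tau = 0, where it is already r. *)
have [rG _] : \rank (map_mx toF G) = r /\ \rank (map_mx toF (map_mx polyC D)) = r.
  apply: rank_le; apply/eqP => /(congr1 (horner_eval 0)).
  rewrite -det_map_mx map_mxM G0 -map_mx_comp (_ : map_mx _ D = D); last first.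
    by apply/matrixP => a b; rewrite !mxE /= /horner_eval hornerC.
  by rewrite GD det1 /horner_eval horner0 => /eqP; rewrite oner_eq0.
pose Sel : 'M[{poly K}]_(#|V|, N) := \matrix_(j, k) (k == enum_val j)%:R.
have [_ rPhi] : \rank (map_mx toF Sel) = #|V| /\ \rank (map_mx toF Phi) = #|V|.
  apply: rank_le; rewrite -det_tr (_ : _^T = \matrix_(j, j') pairing 'X_[mon (enum_val j')] (g j)) //.
  apply/matrixP => j j'; rewrite !mxE (bigD1 (enum_val j')) //= !mxE eqxx mul1r big1 ?addr0 // => k ne_k.
  by rewrite !mxE (negbTE ne_k) mul0r.
have le_rV : (r + #|V| <= N)%N.
  rewrite -rG -rPhi; apply: mulmx0_rank_max.
  by rewrite -map_mxM GPhi map_mx0.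
pose Z : 'M[K]_(#|V|, N) := pid_mx #|V| *m row_base (W^C)%MS.
have rkC : \rank (W^C)%MS = (N - r)%N by rewrite mxrank_compl.
have Z_free : row_free Z.
  rewrite /row_free /Z mxrankMfree ?row_base_free // rank_pid_mx //.
  by rewrite rkC; lia.
exists (fun j => from_coords (row j Z)); split=> [j|c]; first exact: from_coords_homog.
rewrite -from_coords_mul => /WP cW; apply: (row_free_inj Z_free); rewrite mul0mx.
have cC : (c *m Z <= W^C)%MS.
  by rewrite mulmxA (submx_trans (submxMl _ _)) // eq_row_base.
have := capmx_compl W; move: cW cC => cW cC W0.
have : (c *m Z <= W :&: W^C)%MS by rewrite sub_capmx cW cC.
by rewrite W0 submx0 => /eqP.
Qed.

End SpanAndIndependence.

(** * General linear forms *)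
Section LinearSubstitution.

Variables (K : fieldType) (n : nat).

Definition lin_subst (C : 'M[K]_n) (p : {mpoly K[n]}) : {mpoly K[n]} :=
  p \mPo [tuple lform C i | i < n].

Lemma lin_substU C i : lin_subst C 'X_i = lform C i.
Proof. by rewrite /lin_subst comp_mpolyXU -tnth_nth tnth_mktuple. Qed.

Lemma lin_substXm C m : lin_subst C 'X_[m] = \prod_i lform C i ^+ m i.
Proof. by rewrite /lin_subst comp_mpolyX; apply: eq_bigr => i _; rewrite tnth_mktuple. Qed.

Lemma lin_subst_sum C (I : Type) (r : seq I) (a : I -> K) (F : I -> {mpoly K[n]}) :
  lin_subst C (\sum_(i <- r) a i *: F i) = \sum_(i <- r) a i *: lin_subst C (F i).
Proof.
elim: r => [|i r IHr]; first by rewrite !big_nil /lin_subst comp_mpoly0.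
by rewrite !big_cons /lin_subst comp_mpolyD comp_mpolyZ -IHr.
Qed.

Lemma lin_subst_lform C m (B : 'M[K]_(m, n)) j : lin_subst C (lform B j) = lform (B *m C) j.
Proof.
rewrite [in LHS]/lform lin_subst_sum.
rewrite (eq_bigr (fun i => \sum_k (B j i * C i k) *: 'X_k)) => [|i _]; last first.
  rewrite lin_substU scaler_sumr.
  by apply: eq_bigr => k _; rewrite scalerA.
rewrite exchange_big; apply: eq_bigr => k _.
by rewrite mxE scaler_suml.
Qed.

Lemma lin_substK C C' : C *m C' = 1%:M -> cancel (lin_subst C) (lin_subst C').
Proof.
move=> CC' p; rewrite [in LHS](mpolyE p) !lin_subst_sum [RHS]mpolyE.
apply: eq_bigr => m _; congr (_ *: _).
rewrite lin_substXm [in LHS]/lin_subst rmorph_prod [RHS]mpolyXE_id /=.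
apply: eq_bigr => i _; rewrite rmorphXn /= -/(lin_subst C' _) lin_subst_lform CC'; congr (_ ^+ _).
rewrite /lform (bigD1 i) //= mxE eqxx scale1r big1 ?addr0 // => k ne_k.
by rewrite mxE eq_sym (negbTE ne_k) scale0r.
Qed.

Lemma lin_subst_homog C i p : p \is i.-homog -> lin_subst C p \is i.-homog.
Proof.
move=> /dhomogP p_hom; rewrite [p]mpolyE lin_subst_sum big_seq.
apply: rpred_sum => m /p_hom /= Em; apply: rpredZ.
rewrite lin_substXm.
apply: (homog_prod_sum (d := fun i => m i)) => [|j]; first by rewrite -Em mdegE.
by have := dhomogMn (m j) (lform_homog C j); rewrite mul1n.
Qed.

(** Multiplying the coefficient matrix by C on the right is the substitution of
    variables [lin_subst C]. *)
Lemma graded_indep_mulmx m d (B : 'M[K]_(m, n)) (C : 'M[K]_n) i h :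
  C \in unitmx -> graded_indep d B i h -> graded_indep d (B *m C) i h.
Proof.
move=> uC [b [b_hom b_indep]].
exists (fun j => lin_subst C (b j)); split=> [j|c [q qE]]; first exact: lin_subst_homog.
apply: b_indep; exists (fun j => lin_subst (invmx C) (q j)).
rewrite -[LHS](lin_substK (mulmxV uC)) lin_subst_sum qE [in LHS]/lin_subst rmorph_sum /=.
apply: eq_bigr => j _; rewrite rmorphM rmorphXn /= -!/(lin_subst (invmx C) _).
by rewrite lin_subst_lform mulmxK.
Qed.

End LinearSubstitution.

Section Assembly.

Variables (K : fieldType) (n e : nat).
Hypothesis charK : [pchar K] =i pred0.
Local Notation d := e.+1.

Lemma nonroot_exists (D : {poly K}) : D != 0 -> exists t, ~~ root D t.
Proof.
move=> D0; pose rs := [seq k%:R : K | k <- iota 0 (size D)].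
have natr_inj : injective (fun k => k%:R : K).
  move=> i j; wlog le_ij : i j / (i <= j)%N.
    by move=> W E; case: (leqP i j) => [/W|/ltnW/W]; [apply | move=> W'; apply/esym/W'].
  move=> /eqP; rewrite eq_sym -subr_eq0 -natrB // ((pcharf0P K).1 charK) subn_eq0 => le_ji.
  by apply/eqP; rewrite eqn_leq le_ij.
have [all_r|/allPn[t _ Dt]] := boolP (all (root D) rs); last by exists t.
have := max_poly_roots D0 all_r; rewrite map_inj_uniq // iota_uniq size_map size_iota ltnn.
by move=> /(_ isT).
Qed.

Lemma valid_mdeg l0 l1 m : valid l0 (fun _ : 'I_n => e) l1 m -> (mdeg m <= n * e)%N.
Proof.
move=> /forallP V; rewrite mdegE -[n in (n * e)%N]card_ord -sum_nat_const.
by apply: leq_sum => i _; case/and3P: (V i).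
Qed.

Lemma valid_set_large i : (n * e < i)%N -> #|valid_set n e i| = 0%N.
Proof.
move=> lt_i; apply: eq_card0 => k; rewrite inE; apply/negP => /valid_mdeg.
by rewrite mdeg_mon leqNgt lt_i.
Qed.

Lemma pideal_above m (A : 'M[K]_(m, n)) i j :
  (forall p : {mpoly K[n]}, p \is i.-homog -> pideal A d p) -> (i <= j)%N ->
  forall p : {mpoly K[n]}, p \is j.-homog -> pideal A d p.
Proof.
move=> Hi /subnK <-; elim: (j - i)%N => {j} [//|k IHk] p /dhomogP p_hom.
rewrite [p]mpolyE big_seq; apply: pideal_sum => m' /p_hom /= Em; apply: pidealZ.
have [l m'l] : exists l : 'I_n, m' l != 0%N.
  apply/existsP; apply: contraT; rewrite negb_exists => /forallP m0.
  have : mdeg m' = 0%N by rewrite mdegE big1 // => l _; apply/eqP; rewrite -[_ == _]negbK.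
  by rewrite Em.
have Em' : (m' - U_(l) + U_(l))%MM = m' by apply: submK; rewrite lep1mP.
rewrite -Em' mpolyXD mulrC; apply: pidealMl; apply: IHk; rewrite dhomogX /=.
by move: Em; rewrite -{1}Em' mdegD mdeg1 addn1 addSn => -[->].
Qed.

(** Openness can only be imposed in finitely many degrees.  They go up to n e + 1,
    where no monomial is valid: there the ideal contains all forms, and so it does
    in all higher degrees. *)
Lemma generic_graded_dim :
  for_general (fun A : 'M[K]_(n + 2, n) =>
    forall i, has_graded_dim (power_ideal A d) i #|valid_set n e i|).
Proof.
pose I := (n * e).+1; pose M := I.+2.
pose P (k : 'I_n) : {poly K} := 'X^(lexw n M k); pose Q (k : 'I_n) : {poly K} := 'X^(lexw n M (rev_ord k)).
have size_P k : size (P k) = (lexw n M k).+1 by rewrite size_polyXn.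
have size_Q k : size (Q k) = (lexw n M (rev_ord k)).+1 by rewrite size_polyXn.
have ex_D (i : 'I_I.+1) : exists D : {poly K}, D != 0 /\ forall t, ~~ root D t ->
    exists f : {mpoly K[((n + 2) * n)%N]},
      f.@[fun k => mxvec (map_mx (horner_eval t) (normal_mx P Q)) 0 k] != 0 /\
      forall A, f.@[fun k => mxvec A 0 k] != 0 -> graded_span d A i #|valid_set n e i|.
  have lt_iM : (i < M)%N by rewrite ltnW // ltnS.
  by have [D D0 HD] := span_open e charK lt_iM size_P size_Q; exists D.
have [D DP] := fin_all_exists ex_D.
have [t Dt] : exists t, ~~ root (\prod_i D i) t.
  by apply: nonroot_exists; apply/prodf_neq0 => i _; case: (DP i).
have Dit i : ~~ root (D i) t.
  by apply: contra Dt => /eqP Di; rewrite /root horner_prod (bigD1 i) //= Di mul0r.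
have [f fP] := fin_all_exists (fun i => (DP i).2 t (Dit i)).
pose g : {mpoly K[((n + 2) * n)%N]} := (\prod_i f i) * \det (usubmx (generic_mx K n)).
have evalg (A : 'M[K]_(n + 2, n)) :
    (g.@[fun k => mxvec A 0 k] != 0) = [forall i, (f i).@[fun k => mxvec A 0 k] != 0] && (usubmx A \in unitmx).
  rewrite mevalM mulf_eq0 negb_or; congr (_ && _).
    rewrite rmorph_prod /=; apply/prodf_neq0/forallP => H i; first exact: H.
    by move=> _; exact: H.
  by rewrite -det_map_mx map_usubmx eval_generic_mx unitmxE unitfE.
exists (fun A => g.@[fun k => mxvec A 0 k] != 0); split.
- exists (eq g) => A; split=> [gA|[_ <-]]; first by exists g.
  by [].
- exists (map_mx (horner_eval t) (normal_mx P Q)); rewrite evalg; apply/andP; split.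
    by apply/forallP => i; case: (fP i).
  rewrite (_ : usubmx _ = 1%:M) ?unitmx1 //; apply/matrixP => j k.
  by rewrite !mxE (unsplitK (inl j)) /horner_eval; case: eqP => _; rewrite -?polyC1 hornerC.
move=> A; rewrite evalg => /andP[/forallP fA uA] i.
have spanA (j : nat) : (j <= I)%N -> graded_span d A j #|valid_set n e j|.
  by move=> le_j; have [_] := fP (Ordinal (le_j : (j < I.+1)%N)); apply; apply: fA.
have [le_i|lt_i] := leqP i I.
  apply: graded_dim_span_indep; first exact: spanA.
  pose B := A *m invmx (usubmx A).
  have -> : A = B *m usubmx A by rewrite mulmxKV.
  apply: graded_indep_mulmx => //.
  have -> : B = normal_mx (B (rshift n ord0)) (B (rshift n (lift ord0 ord0))).
    apply/matrixP => j k; rewrite [RHS]mxE; case: (split_ordP j) => j' ->.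
      have := congr1 (fun X : 'M_n => X j' k) (mulmxV uA); rewrite !mxE => <-.
      by apply: eq_bigr => l _; rewrite !mxE.
    case: eqP => [->//|ne_j'].
    by congr (B (rshift n _) k); apply: val_inj; case: j' ne_j' => [[|[]]] // lt_j [] ; apply: val_inj.
  exact: indep_normal.
have V0 j : (I <= j)%N -> #|valid_set n e j| = 0%N by move=> le_j; apply: valid_set_large.
have spanI p : p \is I.-homog -> pideal A d p.
  have := spanA I (leqnn I); rewrite V0 // => -[b [_ b_span]] /b_span[c].
  by rewrite big_ord0 subr0.
rewrite V0; last exact: ltnW.
exists (fun=> 0); split=> [[]//|p p_hom]; exists 0; split=> [|c _].
  by rewrite big_ord0 subr0; apply: (pideal_above spanI (ltnW lt_i)).
by apply/rowP => -[].
Qed.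

End Assembly.

(** * Valid monomials as walks *)
Section Walks.

Variables (l lam : nat).

(** Read as a list of exponents, a valid monomial is a walk that starts at mu,
    moves from mu to mu + lam - 2 a, obeys the fusion rules at level l, and ends
    at l - lam, from where the last form leads to l. *)
Fixpoint walk_ok (mu : nat) (s : seq nat) : bool :=
  if s is a :: s' then
    [&& (a <= lam)%N, (a <= mu)%N, (mu + lam <= l + a)%N & walk_ok (mu + lam - 2 * a) s']
  else (mu + lam == l)%N.

(** The enumeration follows the recursion of [walk_ok], which turns counting into
    the iteration of an operator on functions of mu. *)
Fixpoint walks (k mu : nat) : seq (seq nat) :=
  if k is k'.+1 then
    flatten [seq [seq a :: s | s <- walks k' (mu + lam - 2 * a)]
               | a <- [seq a <- iota 0 lam.+1 | (a <= mu)%N && (mu + lam <= l + a)%N]]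
  else if (mu + lam == l)%N then [:: [::]] else [::].

Lemma walksS k mu : walks k.+1 mu =
  flatten [seq [seq a :: s | s <- walks k (mu + lam - 2 * a)]
             | a <- [seq a <- iota 0 lam.+1 | (a <= mu)%N && (mu + lam <= l + a)%N]].
Proof. by []. Qed.

Lemma mem_walks k mu s : (s \in walks k mu) = (size s == k) && walk_ok mu s.
Proof.
elim: k mu s => [|k IHk] mu s.
  by rewrite /=; case: ifP; case: s => //= *; rewrite inE.
rewrite walksS; apply/flatten_mapP/idP => [[a]|].
  rewrite mem_filter mem_iota => /andP[/andP[le_a le_l] lt_a] /mapP[s' s'_in ->] /=.
  by move: s'_in; rewrite IHk eqSS le_a le_l => /andP[-> ->]; rewrite !andbT.
case: s => // a s /andP[/eqP[/eqP sz] /and4P[H1 H2 H3 H4]].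
exists a; first by rewrite mem_filter mem_iota H2 H3.
by apply/mapP; exists s; rewrite // IHk sz.
Qed.

Lemma walks_uniq k mu : uniq (walks k mu).
Proof.
elim: k mu => [|k IHk] mu; first by rewrite /=; case: ifP.
rewrite walksS; have : uniq [seq a <- iota 0 lam.+1 | (a <= mu)%N && (mu + lam <= l + a)%N].
  by rewrite filter_uniq ?iota_uniq.
elim: [seq a <- _ | _] => //= a t IHt /andP[a_t /IHt{}IHt].
rewrite cat_uniq IHt andbT map_inj_uniq ?IHk => [|s s' [] //]; apply/hasPn => s.
move=> /flatten_mapP[b b_t] /mapP[s' _ ->]; apply/mapP => -[s'' _ [E _]].
by rewrite -E b_t in a_t.
Qed.

Lemma walk_okP mu s : reflect
  ((forall j, (j < size s)%N -> [/\ (nth 0 s j <= lam)%N,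
      (nth 0 s j + 2 * sumn (take j s) <= mu + j * lam)%N &
      (mu + j * lam + lam <= l + 2 * sumn (take j s) + nth 0 s j)%N])
   /\ (mu + size s * lam + lam = l + 2 * sumn s)%N) (walk_ok mu s).
Proof.
elim: s mu => [|a s IHs] mu.
  by apply: (iffP eqP) => [E|[_ /=]]; [split=> [j //|/=]; lia | lia].
apply: (iffP and4P) => [[H1 H2 H3 /IHs[H4 H5]]|[H H']].
  split=> [[_|j lt_j] /=|/=]; last by move: H5; lia.
    by split; lia.
  have [K1 K2 K3] := H4 j lt_j; split=> //; lia.
have [H1 H2 H3] := H 0%N (ltn0Sn _); move: H1 H2 H3 H'; rewrite /= => H1 H2 H3 H'.
split=> //; try lia.
apply/IHs; split=> [j lt_j|]; last by lia.
by have := H j.+1 lt_j; rewrite /= => -[K1 K2 K3]; split=> //; lia.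
Qed.

End Walks.

Lemma sumn_take_psum n (m : 'X_{1..n}) j : (j <= n)%N -> sumn (take j m) = psum m j.
Proof.
elim: j => [|j IHj] lt_j; first by rewrite take0 psum0.
rewrite (take_nth 0%N) ?size_tuple // sumn_rcons IHj 1?ltnW //.
by rewrite -[j.+1]/(val (Ordinal lt_j)).+1 psumS (mnm_nth 0%N).
Qed.

Lemma psum_const n c j : (j <= n)%N -> psum (fun _ : 'I_n => c) j = (j * c)%N.
Proof.
elim: j => [|j IHj] lt_j; first by rewrite psum0.
by rewrite -[j.+1]/(val (Ordinal lt_j)).+1 psumS /= IHj 1?ltnW // mulSn addnC.
Qed.

Lemma valid_walk n e l i (m : 'X_{1..n}) : (l + 2 * i = (n + 2) * e)%N ->
  (mdeg m == i) && valid e (fun _ : 'I_n => e) e m = walk_ok l e e m.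
Proof.
move=> lE; have sumE : sumn m = mdeg m.
  by rewrite mdegE -psum_all -sumn_take_psum // -[X in take X _](size_tuple m) take_size.
apply/andP/walk_okP => [[/eqP Em V]|[V E]].
  have level : (l + 2 * mdeg m = e + psum (fun _ : 'I_n => e) n + e)%N by rewrite psum_const // Em; lia.
  split=> [j|]; rewrite size_tuple; last by rewrite sumE Em; lia.
  move=> lt_j; have := elimT (validP level) V (Ordinal lt_j).
  rewrite (mnm_nth 0%N) /= psum_const ?sumn_take_psum ?(ltnW lt_j) //.
move: E; rewrite size_tuple sumE => E.
have Em : mdeg m = i by lia.
have level : (l + 2 * mdeg m = e + psum (fun _ : 'I_n => e) n + e)%N by rewrite psum_const // Em; lia.
split; first by rewrite Em.
apply/(validP level) => j; have := V j; rewrite size_tuple ltn_ord => /(_ isT).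
by rewrite -(mnm_nth 0%N) psum_const ?sumn_take_psum // ltnW.
Qed.

Lemma card_valid_set n e l i : (l + 2 * i = (n + 2) * e)%N ->
  #|valid_set n e i| = size (walks l e n e).
Proof.
move=> lE; pose A := [seq m <- monomials n i | valid e (fun _ : 'I_n => e) e m].
have -> : #|valid_set n e i| = size A.
  rewrite cardsE size_filter -sum1_card -sum1_count (big_nth 0%MM) big_mkord.
  by apply: eq_bigl => k; rewrite unfold_in.
rewrite -(size_map (fun m : 'X_{1..n} => (m : seq nat)) A); apply: perm_size.
apply: uniq_perm; [|exact: walks_uniq|].
  rewrite map_inj_in_uniq ?filter_uniq ?monomials_uniq // => m m' _ _ E.
  by apply/val_inj/val_inj.
move=> s; rewrite mem_walks; apply/mapP/andP => [[m]|[sz s_ok]].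
  by rewrite mem_filter mem_monomials andbC (valid_walk _ lE) => m_ok ->; rewrite size_tuple.
have Em : (Multinom (Tuple sz) : seq nat) = s by [].
exists (Multinom (Tuple sz)) => //.
by rewrite mem_filter mem_monomials andbC (valid_walk _ lE) Em.
Qed.

Lemma valid_set_level n e i : (0 < n)%N -> (0 < #|valid_set n e i|)%N ->
  exists2 l, (l + 2 * i = (n + 2) * e)%N & (e <= l)%N.
Proof.
move=> n_gt0 /card_gt0P[k]; rewrite inE => V.
have Em : mdeg (mon k) = psum (mon k) n by rewrite psum_all mdegE.
have lt_n : (n.-1 < n)%N by rewrite prednK.
have /forallP/(_ (Ordinal lt_n))/and3P[V1 V2 V3] := V.
have E1 := psumS (mon k) (Ordinal lt_n); have E2 := psum_const (n := n) e (ltnW lt_n).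
rewrite -!/(psum _ _) /= in V1 V2; rewrite /= prednK // -Em mdeg_mon in E1.
move: V2; rewrite E2 => V2.
have lE : ((n + 2) * e - 2 * i + 2 * i = (n + 2) * e)%N by rewrite subnK //; move: n_gt0; nia.
exists ((n + 2) * e - 2 * i)%N => //.
have level : ((n + 2) * e - 2 * i + 2 * mdeg (mon k) = e + psum (fun _ : 'I_n => e) n + e)%N.
  by rewrite mdeg_mon lE psum_const //; lia.
by have [W1 W2 W3] := elimT (validP level) V (Ordinal n_gt0); lia.
Qed.

(** * The reflection principle *)
Lemma antisym_sum0 (p q : nat) (f : nat -> int) :
  (forall a, (p <= a < q)%N -> f (p + q - a.+1)%N = - f a) ->
  \sum_(p <= a < q) f a = 0.
Proof.
move=> fN; set S := \sum_(_ <= _ < _) _.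
have : S = - S.
  rewrite {1}/S big_nat_rev -sumrN !big_nat; apply: eq_bigr => a /andP[le_a lt_a].
  exact/fN/andP.
move: S => S; lia.
Qed.

Lemma dvdz_shift (d a b k : int) : a = b + k * d -> (d %| a)%Z = (d %| b)%Z.
Proof.
move=> ->; apply/dvdzP/dvdzP => -[q E]; [exists (q - k) | exists (q + k)].
  by rewrite mulrBl -E addrK.
by rewrite mulrDl -E.
Qed.

Lemma dvdz_shiftN (d a b k : int) : a = - b + k * d -> (d %| a)%Z = (d %| b)%Z.
Proof. by move=> E; rewrite (dvdz_shift E) !dvdzE abszN. Qed.

Section Reflection.

Variables (l lam : nat).
Hypothesis le_laml : (lam <= l)%N.

(** The free step: nothing prevents x + lam - 2 a from leaving [0, l]. *)
Definition step (phi : int -> int) (x : int) : int :=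
  \sum_(0 <= a < lam.+1) phi (x + lam%:Z - 2 * a%:Z).

(** Antisymmetry under the reflections in -1 and in l + 1. *)
Definition reflected (phi : int -> int) : Prop :=
  (forall x, phi (- x - 2) = - phi x) /\ (forall x, phi (2 * l%:Z + 2 - x) = - phi x).

Lemma reflected_step phi : reflected phi -> reflected (step phi).
Proof.
move=> [phi1 phi2]; split=> x; rewrite /step -sumrN big_nat_rev !big_nat; apply: eq_bigr => a /andP[_ lt_a].
  rewrite -phi1; congr phi; lia.
rewrite -phi2; congr phi; lia.
Qed.

Lemma size_walksS k mu : size (walks l lam k.+1 mu) =
  (\sum_(0 <= a < lam.+1 | (a <= mu)%N && (mu + lam <= l + a)%N)
     size (walks l lam k (mu + lam - 2 * a)))%N.
Proof.
rewrite walksS size_flatten sumnE /shape -map_comp big_map big_filter.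
by apply: eq_bigr => a _; rewrite /= size_map.
Qed.

(** Forbidden steps do not contribute: the steps with a > mu end at points permuted
    by the reflection in -1, those that violate the level end at points permuted by
    the reflection in l + 1, and a reflected function takes opposite values there. *)
Lemma size_walks_step phi k : reflected phi ->
  (forall mu, (mu <= l)%N -> (size (walks l lam k mu))%:Z = phi mu) ->
  forall mu, (mu <= l)%N -> (size (walks l lam k.+1 mu))%:Z = step phi mu.
Proof.
move=> [phi1 phi2] Hk mu le_mu; rewrite size_walksS.
pose good a := (a <= mu)%N && (mu + lam <= l + a)%N.
pose f a := phi (mu%:Z + lam%:Z - 2 * a%:Z).
have -> : (\sum_(0 <= a < lam.+1 | good a) size (walks l lam k (mu + lam - 2 * a)))%N%:Z =
    \sum_(0 <= a < lam.+1 | good a) f a.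
  rewrite (big_morph Posz PoszD (erefl _)) big_nat_cond [RHS]big_nat_cond.
  apply: eq_bigr => a /andP[/andP[_ lt_a] /andP[H1 H2]].
  rewrite Hk; last by lia.
  by rewrite /f; congr phi; lia.
rewrite big_mkcond /step -/f.
pose lo := (mu + lam - l)%N; pose hi := (minn mu lam).+1.
have lo_hi : (lo <= hi)%N by rewrite /lo /hi; lia.
have hi_le : (hi <= lam.+1)%N by rewrite /hi; lia.
rewrite [RHS](big_cat_nat (n := lo)) //=; last by apply: leq_trans hi_le.
rewrite [X in _ = X + _]antisym_sum0 ?add0r; last first.
  by move=> a /andP[_ lt_a]; rewrite -phi2; congr phi; rewrite /lo in lt_a *; lia.
rewrite [RHS](big_cat_nat (n := hi)) //=.
rewrite [X in _ = _ + X]antisym_sum0 ?addr0; last first.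
  by move=> a /andP[le_a lt_a]; rewrite -phi1; congr phi; rewrite /hi in le_a *; lia.
rewrite (big_cat_nat (n := lo)) //=; last by apply: leq_trans hi_le.
rewrite big_nat big1 ?add0r => [|a /andP[_ lt_a]]; last first.
  by rewrite /good; case: ifP => //; rewrite /lo in lt_a *; lia.
rewrite (big_cat_nat (n := hi)) //= [X in _ + X]big_nat [X in _ + X]big1 ?addr0; last first.
  by move=> a /andP[le_a lt_a]; rewrite /good; case: ifP => //; rewrite /hi in le_a *; lia.
rewrite !big_nat; apply: eq_bigr => a /andP[le_a lt_a].
by rewrite /good; case: ifP => //; rewrite /lo /hi in le_a lt_a *; lia.
Qed.

(** The indicator of the end point l, made periodic and antisymmetric. *)
Definition source (x : int) : int :=
  ((2 * l%:Z + 4 %| x - l%:Z)%Z : nat)%:Z - ((2 * l%:Z + 4 %| x - l%:Z - 2)%Z : nat)%:Z.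

Lemma source_reflected : reflected source.
Proof.
split=> x; rewrite /source opprB; congr ((_ : bool)%:Z - (_ : bool)%:Z).
- by apply: (dvdz_shiftN (k := -1)); lia.
- by apply: (dvdz_shiftN (k := -1)); lia.
- by apply: (dvdz_shiftN (k := 0)); lia.
by apply: (dvdz_shiftN (k := 0)); lia.
Qed.

Lemma dvdz_small (d a : int) : `|a| < d -> (d %| a)%Z = (a == 0).
Proof.
move=> lt_a; apply/idP/eqP => [/dvdzP[q E]|->]; last exact: dvdz0.
have : q = 0; last by move=> q0; rewrite E q0 mul0r.
nia.
Qed.

Lemma size_walks0 mu : (mu <= l)%N -> (size (walks l lam 0 mu))%:Z = step source mu.
Proof.
move=> le_mu; rewrite /step.
pose u (a : nat) : int := ((2 * l%:Z + 4 %| mu%:Z + lam%:Z - 2 * a%:Z - l%:Z)%Z : nat)%:Z.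
rewrite (eq_bigr (fun a => - u a.+1 - - u a)) => [|a _]; last first.
  rewrite opprK [RHS]addrC /source /u; congr (_ - Posz (nat_of_bool (_ %| _)%Z)); lia.
rewrite (telescope_sumr (fun a => - u a)) // opprK addrC /u.
rewrite !dvdz_small; [|lia|lia].
rewrite (_ : (mu%:Z + lam%:Z - 2 * lam.+1%:Z - l%:Z == 0) = false) ?subr0; last by apply/eqP; lia.
rewrite /=; case: ifP => [/eqP <-|/eqP ne]; first by rewrite (_ : _ == 0) //; apply/eqP; lia.
by rewrite (_ : _ == 0 = false) //; apply/eqP; lia.
Qed.

Lemma reflected_iter k : reflected (iter k step source).
Proof. by elim: k => [|k IHk]; [apply: source_reflected | apply: reflected_step]. Qed.

Lemma size_walks_iter k mu : (mu <= l)%N ->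
  (size (walks l lam k mu))%:Z = iter k.+1 step source mu.
Proof.
elim: k mu => [|k IHk] mu le_mu; first exact: size_walks0.
exact: (size_walks_step (reflected_iter k.+1) IHk).
Qed.

Lemma step0 phi : reflected phi -> step phi 0 = phi lam.
Proof.
move=> [phi1 _]; rewrite /step big_nat_recl // antisym_sum0 ?addr0; first by congr phi; lia.
by move=> a /andP[_ lt_a]; rewrite -phi1; congr phi; lia.
Qed.

(** The end condition mu + lam = l is one more free step, and so is the start,
    from 0 to lam; in this way the two general forms play the same part as the
    n variables. *)
Lemma size_walks_source k : (size (walks l lam k lam))%:Z = iter k.+2 step source 0.
Proof.
by rewrite (size_walks_iter k le_laml) [RHS](step0 (reflected_iter k.+1)).
Qed.

End Reflection.

(** * Sums of coefficients over a residue class *)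
Section ShiftSums.

Implicit Types (p : {poly int}) (phi : int -> int).

(** The polynomial p acts on functions on the integers, X being the shift by -2;
    the free step is then, up to a translation, a truncated geometric series. *)
Definition shift_sum p phi (x : int) : int := \sum_(t < size p) p`_t * phi (x - 2 * t%:Z).

Lemma shift_sumE N p phi x : (size p <= N)%N ->
  shift_sum p phi x = \sum_(t < N) p`_t * phi (x - 2 * t%:Z).
Proof.
move=> le_N; rewrite /shift_sum (big_ord_widen N (fun t => p`_t * phi (x - 2 * t%:Z))) //.
rewrite big_mkcond; apply: eq_bigr => t _; case: ltnP => // le_t.
by rewrite nth_default ?mul0r.
Qed.

Lemma shift_sumD p q phi x : shift_sum (p + q) phi x = shift_sum p phi x + shift_sum q phi x.
Proof.
pose N := maxn (size (p + q)) (maxn (size p) (size q)).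
rewrite !(@shift_sumE N) ?leq_max ?leqnn ?orbT // -big_split; apply: eq_bigr => t _.
by rewrite coefD mulrDl.
Qed.

Lemma shift_sum_mulXn a p phi x : shift_sum ('X^a * p) phi x = shift_sum p phi (x - 2 * a%:Z).
Proof.
rewrite (@shift_sumE (a + size p)); last first.
  by apply: leq_trans (size_polyMleq _ _) _; rewrite size_polyXn.
rewrite big_split_ord /= big1 ?add0r => [|t _]; last by rewrite coefXnM ltn_ord mul0r.
apply: eq_bigr => t _; rewrite coefXnM ltnNge leq_addr /= addKn; congr (_ * phi _); lia.
Qed.

Lemma iter_step lam k phi x :
  iter k (step lam) phi x = shift_sum ((\sum_(0 <= a < lam.+1) 'X^a) ^+ k) phi (x + k%:Z * lam%:Z).
Proof.
elim: k x => [|k IHk] x.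
  rewrite expr0 (@shift_sumE 1) ?size_poly1 // big_ord1 coef1 mul1r /=; congr phi; lia.
rewrite iterS /step exprS mulr_suml.
have sumE (r : seq nat) (F : nat -> {poly int}) z :
    shift_sum (\sum_(a <- r) F a) phi z = \sum_(a <- r) shift_sum (F a) phi z.
  elim: r => [|a r IHr]; last by rewrite !big_cons shift_sumD IHr.
  by rewrite !big_nil /shift_sum size_poly0 big_ord0.
rewrite sumE; apply: eq_bigr => a _; rewrite shift_sum_mulXn IHk; congr shift_sum; lia.
Qed.

End ShiftSums.

Section IntegerCoefficients.

Implicit Types (p : {poly int}) (z : int).

(** Indices in Z spare the side conditions of truncated subtraction. *)
Definition coefz p z : int := if z is Posz t then p`_t else 0.

Lemma coefz_neg p z : z < 0 -> coefz p z = 0.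
Proof. by case: z. Qed.

Lemma coefzB p q z : coefz (p - q) z = coefz p z - coefz q z.
Proof. by case: z => t /=; rewrite ?coefB ?subr0. Qed.

Lemma coefz_sum (r : seq nat) (F : nat -> {poly int}) z :
  coefz (\sum_(a <- r) F a) z = \sum_(a <- r) coefz (F a) z.
Proof. by case: z => t /=; rewrite ?coef_sum // big1. Qed.

Lemma coefz_mulXn a p z : coefz ('X^a * p) z = coefz p (z - a%:Z).
Proof.
case: z => t /=; last by rewrite coefz_neg //; lia.
rewrite coefXnM; case: ltnP => [lt_t|le_a]; first by rewrite coefz_neg //; lia.
by rewrite (_ : t%:Z - a%:Z = (t - a)%N%:Z) //; lia.
Qed.

Lemma coefz_mul1subX p z : coefz ((1 - 'X) * p) z = coefz p z - coefz p (z - 1).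
Proof. by rewrite mulrBl mul1r coefzB -['X]expr1 coefz_mulXn. Qed.

Lemma sum_coefz p w : \sum_(t < size p) p`_t * ((t%:Z == w) : nat)%:Z = coefz p w.
Proof.
case: w => [s|s] /=; last by rewrite big1 // => t _; rewrite mulr0.
have [lt_s|le_s] := ltnP s (size p).
  rewrite (bigD1 (Ordinal lt_s)) //= eqxx mulr1 big1 ?addr0 // => t ne_t.
  by rewrite eqz_nat (_ : (t == s :> nat) = false) ?mulr0 //; apply: negbTE.
rewrite nth_default // big1 // => t _; rewrite eqz_nat ltn_eqF ?mulr0 //.
by apply: leq_trans le_s.
Qed.

Definition truncated_geometric (e : nat) : {poly int} := \sum_(0 <= a < e.+1) 'X^a.

Lemma coefz_geometric_sym e k z :
  coefz (truncated_geometric e ^+ k) ((k * e)%N%:Z - z) = coefz (truncated_geometric e ^+ k) z.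
Proof.
elim: k z => [|k IHk] z.
  rewrite expr0; case: z => [[|t]|t] //=; rewrite ?coef1 //.
rewrite exprS mulr_suml !coefz_sum big_nat_rev !big_nat; apply: eq_bigr => a /andP[_ lt_a].
rewrite !coefz_mulXn -[in RHS]IHk; congr coefz; lia.
Qed.

Lemma truncated_geometricE e : (1 - 'X) * truncated_geometric e = 1 - 'X^(e.+1).
Proof.
rewrite /truncated_geometric; elim: e => [|e IHe]; first by rewrite big_nat1 mulr1.
by rewrite big_nat_recr //= mulrDr IHe mulrBl mul1r -exprS addrA subrK.
Qed.

Lemma residue_indicator (L R : nat) (z : int) (t : nat) : (0 < L)%N -> (`|z| + t < R)%N ->
  ((L%:Z %| z - t%:Z)%Z : nat)%:Z =
  \sum_(r < R) ((t%:Z == z - r%:Z * L%:Z) : nat)%:Z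
  + \sum_(r < R) ((t%:Z == z + r.+1%:Z * L%:Z) : nat)%:Z.
Proof.
move=> L_gt0 lt_R; case: (boolP (L%:Z %| z - t%:Z)%Z) => [/dvdzP[q E]|ndvd] /=; last first.
  rewrite !big1 ?addr0 // => r _; case: eqP => // Et; case/negP: ndvd; apply/dvdzP.
    by exists (- r.+1%:Z); rewrite Et; ring.
  by exists r%:Z; rewrite Et; ring.
have lt_q : (`|q| < R)%N by move: E lt_R L_gt0; nia.
have L_neq0 : L%:Z != 0 by rewrite -lt0n in L_gt0 *; lia.
case: q E lt_q => [r0|r0] E lt_r0.
  rewrite (bigD1 (Ordinal lt_r0)) //= [X in _ + X + _]big1 => [|r ne_r]; last first.
    case: eqP => // Et; case/negP: ne_r; apply/eqP/val_inj => /=.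
    have : (r%:Z - r0%:Z) * L%:Z == 0 by apply/eqP; rewrite mulrBl -E Et; ring.
    by rewrite mulf_eq0 (negbTE L_neq0) orbF => /eqP; lia.
  rewrite big1 => [|r _]; last first.
    case: eqP => // Et; have : (r0%:Z + r.+1%:Z) * L%:Z == 0.
      by apply/eqP; rewrite mulrDl -E Et; ring.
    by rewrite mulf_eq0 (negbTE L_neq0) orbF => /eqP; lia.
  by rewrite (_ : _ == _) //; apply/eqP; rewrite -E; ring.
have lt_r0' : (r0 < R)%N by lia.
rewrite big1 => [|r _]; last first.
  case: eqP => // Et; have : (r%:Z + r0.+1%:Z) * L%:Z == 0.
    by apply/eqP; move: E; rewrite NegzE Et => E; rewrite mulrDl -[X in _ + X]opprK -mulNr -E; ring.
  by rewrite mulf_eq0 (negbTE L_neq0) orbF => /eqP; lia.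
rewrite add0r (bigD1 (Ordinal lt_r0')) //= big1 => [|r ne_r]; last first.
  case: eqP => // Et; case/negP: ne_r; apply/eqP/val_inj => /=.
  have : (r.+1%:Z - r0.+1%:Z) * L%:Z == 0.
    by apply/eqP; move: E; rewrite NegzE Et => E; rewrite mulrBl -mulNr -E; ring.
  by rewrite mulf_eq0 (negbTE L_neq0) orbF => /eqP; lia.
rewrite addr0 (_ : _ == _) //; apply/eqP; move: E; rewrite NegzE mulNr => E.
by rewrite -[X in _ + X]opprK -E; ring.
Qed.

(** The residue class of z is listed from z downwards and from z + L upwards; the
    bound R only has to exceed every index at which p has a coefficient. *)
Lemma residue_sum p (L R : nat) (z : int) : (0 < L)%N -> (`|z| + size p < R)%N ->
  \sum_(t < size p) p`_t * ((L%:Z %| z - t%:Z)%Z : nat)%:Z =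
  \sum_(r < R) coefz p (z - r%:Z * L%:Z) + \sum_(r < R) coefz p (z + r.+1%:Z * L%:Z).
Proof.
move=> L_gt0 lt_R.
rewrite (eq_bigr (fun t : 'I_(size p) =>
    \sum_(r < R) p`_t * ((t%:Z == z - r%:Z * L%:Z) : nat)%:Z
    + \sum_(r < R) p`_t * ((t%:Z == z + r.+1%:Z * L%:Z) : nat)%:Z)) => [|t _]; last first.
  rewrite -!mulr_sumr -mulrDr (@residue_indicator L R) //.
  by apply: leq_ltn_trans lt_R; rewrite leq_add2l ltnW.
rewrite big_split /=; congr (_ + _); rewrite exchange_big; apply: eq_bigr => r _;
  exact: sum_coefz.
Qed.

Lemma coef_div_1subX (n : nat) p q j : (1 - 'X) ^+ n.+1 * p = q ->
  p`_j = \sum_(u < j.+1) q`_u * ('C(j - u + n, n))%:Z.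
Proof.
have stepX (s : {poly int}) k : s`_k.+1 = s`_k + ((1 - 'X) * s)`_k.+1.
  by rewrite mulrBl mul1r coefB coefXM /= addrCA subrr addr0.
have step0 (s : {poly int}) : s`_0 = ((1 - 'X) * s)`_0.
  by rewrite mulrBl mul1r coefB coefXM subr0.
elim: n => [|n IHn] in p j *.
  rewrite expr1 => <-; elim: j => [|j IHj]; first by rewrite big_ord1 addn0 bin0 mulr1 -step0.
  rewrite big_ord_recr /= subnn bin0 mulr1 stepX IHj; congr (_ + _).
  by apply: eq_bigr => u _; rewrite !addn0 !bin0.
move=> E; have E' : (1 - 'X) ^+ n.+1 * ((1 - 'X) * p) = q by rewrite mulrA -exprSr.
have {}IHn k := IHn _ k E'.
elim: j => [|j IHj].
  by rewrite step0 IHn !big_ord1 !binn.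
rewrite stepX IHj IHn [X in _ + X]big_ord_recr [RHS]big_ord_recr /= !subnn !add0n !binn addrA; congr (_ + _).
rewrite -big_split; apply: eq_bigr => u _ /=; rewrite -mulrDr; congr (_ * _).
have -> : (j.+1 - u = (j - u).+1)%N by have := ltn_ord u; lia.
by rewrite !addSn !addnS [in RHS]binS PoszD.
Qed.

(** The coefficients of 1 / (1 - X)^(n+1). *)
Definition weight_count (n : nat) z : int := if z is Posz j then ('C(j + n, n))%:Z else 0.

(** The polynomial is (1 - X^(e+1))^(n+3) / (1 - X)^(n+1). *)
Lemma coef_second_difference (n e : nat) z :
  coefz ((1 - 'X) ^+ 2 * truncated_geometric e ^+ n.+3) z =
  \sum_(0 <= k < n.+4) (-1) ^+ k * ('C(n.+3, k))%:Z * weight_count n (z - k%:Z * e.+1%:Z).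
Proof.
case: z => [j|j]; last first.
  rewrite coefz_neg // big1 // => k _; rewrite (_ : weight_count _ _ = 0) ?mulr0 //.
  by case E: (_ - _) => // [j']; lia.
rewrite /= (@coef_div_1subX n _ ((1 - 'X^(e.+1)) ^+ n.+3)); last first.
  by rewrite mulrA -exprD -truncated_geometricE exprMn addnC.
rewrite exprBn big_mkord.
rewrite (eq_bigr (fun u : 'I_j.+1 => \sum_(k < n.+4) (-1) ^+ k * ('C(n.+3, k))%:Z *
   (((u == k * e.+1 :> nat)%N : nat)%:Z * ('C(j - u + n, n))%:Z))) => [|u _]; last first.
  rewrite coef_sum mulr_suml; apply: eq_bigr => k _.
  rewrite expr1n mulr1 -exprM.
  have -> : (-1) ^+ k = ((-1) ^+ k)%:P :> {poly int} by rewrite rmorphXn rmorphN rmorph1.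
  rewrite coefMn coefCM coefXn mulnC -[X in X * _ = _]mulr_natr !natz.
  by rewrite -!mulrA; congr (_ * _); rewrite mulrCA.
rewrite exchange_big; apply: eq_bigr => k _; rewrite -mulr_sumr; congr (_ * _).
have [le_k|lt_k] := leqP (k * e.+1) j.
  rewrite (bigD1 (inord (k * e.+1))) //= inordK // eqxx mul1r big1 ?addr0 => [|u ne_u].
    by rewrite (_ : j%:Z - _ = (j - k * e.+1)%N%:Z) //; lia.
  by rewrite (_ : (u == _ :> nat) = false) ?mul0r //;
      apply: contraNF ne_u => /eqP Eu; apply/eqP/val_inj; rewrite /= inordK.
rewrite big1 => [|u _]; last first.
  by rewrite ltn_eqF ?mul0r //; apply: leq_ltn_trans lt_k; rewrite -ltnS.
by case E: (_ - _) => // [j']; lia.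
Qed.

End IntegerCoefficients.

Arguments coefz : simpl never.

(** By the reflection principle the walks are counted by the coefficients of C
    at indices congruent to i, minus those at indices congruent to i - 1,
    modulo l + 2.  Since (n + 2) e = l + 2 i, the symmetry of C maps the indices
    above i to indices below it, and the four terms attached to
    z = i - r (l + 2) add up to a second difference of C at z. *)
Lemma card_valid_set_coefz n e l i R :
  (l + 2 * i = (n + 2) * e)%N -> (e <= l)%N ->
  (i + (n + 2) * e + 2 < R)%N ->
  (#|valid_set n e i|)%:Z =
  \sum_(r < R) coefz ((1 - 'X) ^+ 2 * truncated_geometric e ^+ (n + 2))
                 (i%:Z - r%:Z * (l + 2)%N%:Z).
Proof.
move=> lE le_el lt_R; set C := truncated_geometric e ^+ (n + 2).
rewrite (card_valid_set lE) (size_walks_source le_el) iter_step add0r -/(truncated_geometric e).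
rewrite -[n.+2]addn2 -/C /shift_sum.
have size_C : (size C <= (n + 2) * e + 1)%N.
  have sg : size (truncated_geometric e) = e.+1.
    have -> : truncated_geometric e = \poly_(a < e.+1) 1.
      by rewrite poly_def /truncated_geometric big_mkord; apply: eq_bigr => a _; rewrite scale1r.
    by rewrite size_poly_eq // oner_neq0.
  apply: leq_trans (size_poly_exp_leq _ _) _; rewrite sg /=; lia.
pose L := (l + 2)%N.
have mE : (n + 2)%N%:Z * e%:Z = l%:Z + 2 * i%:Z by rewrite -PoszM -lE; lia.
rewrite mE (eq_bigr (fun t : 'I_(size C) => C`_t * ((L%:Z %| i%:Z - t%:Z)%Z : nat)%:Z
   - C`_t * ((L%:Z %| i%:Z - 1 - t%:Z)%Z : nat)%:Z)) => [|t _]; last first.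
  rewrite -mulrBr /source; congr (_ * (Posz (nat_of_bool _) - Posz (nat_of_bool _))).
    rewrite -[in RHS](@dvdz_mul2l 2) //; congr (_ %| _)%Z; rewrite /L; lia.
  rewrite -[in RHS](@dvdz_mul2l 2) //; congr (_ %| _)%Z; rewrite /L; lia.
rewrite big_split /= sumrN.
rewrite !(@residue_sum _ L R) ?addn_gt0 ?orbT //; try lia.
have symC (z : int) : coefz C z = coefz C (((n + 2) * e)%N%:Z - z) by rewrite coefz_geometric_sym.
rewrite opprD addrACA -!sumrB -big_split; apply: eq_bigr => r _ /=.
rewrite expr2 -mulrA !coefz_mul1subX.
rewrite (symC (i%:Z + r.+1%:Z * L%:Z)) (symC (i%:Z - 1 + r.+1%:Z * L%:Z)).
set z := i%:Z - _.
have -> : ((n + 2) * e)%N%:Z - (i%:Z + r.+1%:Z * L%:Z) = z - 1 - 1 by rewrite /z /L -lE; lia.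
have -> : ((n + 2) * e)%N%:Z - (i%:Z - 1 + r.+1%:Z * L%:Z) = z - 1 by rewrite /z /L -lE; lia.
have -> : i%:Z - 1 - r%:Z * L%:Z = z - 1 by rewrite /z /L; lia.
by ring.
Qed.

(** * The formula and the degree *)
Lemma leq_hdeg n e i : (i <= hdeg n e.+1)%N =
  (if odd n then 2 * i <= (n + 1) * e else i * (2 * (n + 1)) <= n * (n + 2) * e)%N.
Proof.
rewrite /hdeg subn1 /=; case: ifP => _.
  by rewrite leq_divRL // mulnC.
by rewrite leq_divRL // muln_gt0 addn1.
Qed.

Lemma hdeg_level n e i : (0 < n)%N -> (i <= hdeg n e.+1)%N ->
  exists l, [/\ (l + 2 * i = (n + 2) * e)%N, (e <= l)%N & ~~ odd n -> ((n + 2) * e <= (n + 1) * l)%N].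
Proof.
move=> n_gt0; rewrite leq_hdeg => le_i.
have le_2i : (2 * i <= (n + 2) * e)%N by move: le_i; case: ifP => _ le_i; nia.
exists ((n + 2) * e - 2 * i)%N; split; first by rewrite subnK.
  by move: le_i; case: ifP => _ le_i; nia.
by move=> /negbTE n_even; move: le_i; rewrite n_even => le_i; nia.
Qed.

(** Outside the range of summation of [hcoef] the degrees are negative, so that the
    full sums of [card_valid_set_coefz] and of [coef_second_difference] reduce to
    those of the formula. *)
Lemma hdeg_truncation n e l i r k : (0 < n)%N ->
  (l + 2 * i = (n + 2) * e)%N -> (e <= l)%N -> (~~ odd n -> (n + 2) * e <= (n + 1) * l)%N ->
  (k * e.+1 + r * (l + 2) <= i)%N -> (k + 2 * r < n)%N.
Proof.
move=> n_gt0 lE le_el even_n le_i; rewrite ltnNge; apply/negP => le_n.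
have H : ((2 * r + 1) * l + 4 * r + 2 * k * e + 2 * k <= (n + 2) * e)%N.
  by rewrite -lE; nia.
case: k le_i le_n H => [|k] _ le_n H.
  have [lt_n|le_2r] := ltnP n (2 * r).
    have : ((n + 2) * e <= (2 * r + 1) * l)%N by apply: leq_mul => //; lia.
    lia.
  have n2r : n = (2 * r)%N by lia.
  have : ((n + 2) * e <= (n + 1) * l)%N by apply: even_n; rewrite n2r mul2n odd_double.
  rewrite n2r in H n_gt0 *; lia.
have : ((n + 2) * e <= (2 * r + 1 + 2 * k.+1) * e)%N by rewrite leq_mul2r; apply/orP; right; lia.
have : ((2 * r + 1) * e <= (2 * r + 1) * l)%N by rewrite leq_mul2l le_el orbT.
rewrite [((_ + 2 * k.+1) * e)%N]mulnDl; lia.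
Qed.

Lemma hcoef_card n e i : (0 < n)%N -> (i <= hdeg n e.+1)%N ->
  hcoef n e.+1 i = (#|valid_set n e i|)%:Z.
Proof.
case: n => // n _ le_i; have [l [lE le_el even_n]] := hdeg_level (ltn0Sn n) le_i.
pose R := (i + n.+3 * e + n.+3)%N.
have lt_R : (i + (n.+1 + 2) * e + 2 < R)%N by rewrite /R; lia.
rewrite (card_valid_set_coefz lE le_el lt_R).
pose z (r : nat) : int := i%:Z - r%:Z * (l + 2)%N%:Z.
pose term (r k : nat) : int := (-1) ^+ k * ('C(n.+3, k))%:Z * weight_count n (z r - k%:Z * e.+1%:Z).
have term0 (r k : nat) : (n < k + 2 * r)%N -> term r k = 0.
  move=> lt_n; rewrite /term /weight_count; case E: (_ - _) => [j|j]; last by rewrite mulr0.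
  have : (k * e.+1 + r * (l + 2) <= i)%N by move: E; rewrite /z -!PoszM; lia.
  by move/(hdeg_truncation (ltn0Sn n) lE le_el even_n); rewrite ltnS leqNgt lt_n.
rewrite (eq_bigr (fun r : 'I_R => \sum_(0 <= k < n.+4) term r k)) => [|r _]; last first.
  by rewrite addn2 coef_second_difference.
rewrite /hcoef /= -(big_mkord xpredT (fun r => \sum_(0 <= k < n.+4) term r k)).
rewrite (big_nat_widen _ _ R) /=; last by rewrite /R; have := leq_div n 2; lia.
rewrite big_mkcond /= !big_nat; apply: eq_bigr => r _.
case: ifP => [le_r|/negbT]; last first.
  rewrite -leqNgt => lt_r; rewrite big_nat big1 // => k _; apply: term0.
  by move: lt_r; rewrite ltn_divLR // => lt_r; lia.
rewrite (big_nat_widen _ _ n.+4) /=; last by lia.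
rewrite big_mkcond !big_nat; apply: eq_bigr => k _ /=.
case: ifP => [le_k|/negbT]; last by rewrite -leqNgt => lt_k; rewrite term0 //; lia.
rewrite /term addn2; congr (_ * _).
have le_2r : (2 * r <= n)%N.
  by move: le_r; rewrite ltnS leq_divRL // mulnC.
have lE' : l%:Z = (n.+1 + 2)%N%:Z * e%:Z - 2 * i%:Z by rewrite -PoszM -lE; lia.
rewrite (_ : _ - 1 = z r - k%:Z * e.+1%:Z + n%:Z); last first.
  rewrite /z PoszD lE' !PoszD -!natz; ring.
case yE : (z r - k%:Z * e.+1%:Z) => [j|j]; first by rewrite /weight_count -PoszD.
(* For a negative argument [binz] is 1 when the lower index is 0, that is, for
   forms in one variable; but then r = k = 0 and the argument is not negative. *)
have n_gt0 : (0 < n)%N.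
  rewrite lt0n; apply/eqP => n0; move: yE le_k le_2r; rewrite n0 => yE le_k le_2r.
  have r0 : r = 0%N by lia.
  have k0 : k = 0%N by lia.
  by move: yE; rewrite r0 k0 /z !mul0r !subr0; lia.
rewrite /weight_count; case E: (_ + _) => [a|a] /=.
  by rewrite bin_small //; lia.
by rewrite eqn0Ngt n_gt0.
Qed.

(** The walk ends at l - lam, and two consecutive steps cannot lower it by more
    than 2 (l - lam). *)
Lemma walk_even_bound l lam p mu s : size s = (2 * p)%N -> walk_ok l lam mu s ->
  (mu + (2 * p + 1) * lam <= (2 * p + 1) * l)%N.
Proof.
elim: p mu s => [|p IHp] mu s.
  by move/size0nil => -> /= /eqP; lia.
case: s => [|a [|b s]] //=; rewrite mulnS // => -[sz].
case/and4P => a_lam a_mu a_l /and4P[b_lam b_mu b_l /(IHp _ _ sz)].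
move: a_lam a_mu a_l b_lam b_mu b_l => H1 H2 H3 H4 H5 H6 H7.
rewrite (_ : 2 + 2 * p + 1 = (2 * p + 1) + 2)%N ?[((_ + 2) * _)%N]mulnDl; last by lia.
lia.
Qed.

Lemma valid_set_hdeg n e i : (0 < n)%N -> (0 < #|valid_set n e i|)%N -> (i <= hdeg n e.+1)%N.
Proof.
move=> n_gt0 V_gt0; have [l lE le_el] := valid_set_level n_gt0 V_gt0.
rewrite leq_hdeg; case: ifP => [_|n_even]; first by nia.
have : (0 < size (walks l e n e))%N by rewrite -(card_valid_set lE).
case Ew : (walks l e n e) => [//|s w] _.
have : s \in walks l e n e by rewrite Ew mem_head.
rewrite mem_walks => /andP[/eqP sz ok].
have n2 : n = (2 * n./2)%N by rewrite mul2n even_halfK // n_even.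
have := walk_even_bound (p := n./2) (etrans sz n2) ok; rewrite -n2 => bnd.
nia.
Qed.

(** The walk alternates between lam and 0. *)
Lemma walk_odd_exists lam p : exists2 s, size s = (2 * p).+1 & walk_ok lam lam lam s.
Proof.
elim: p => [|p [s sz ok]].
  by exists [:: lam] => //; rewrite /= !leqnn /=; lia.
exists [:: lam, 0%N & s]; first by rewrite /= sz mulnS.
rewrite /= !leqnn /=; have -> : (lam + lam - 2 * lam + lam - 2 * 0 = lam)%N by lia.
by rewrite ok !andbT; lia.
Qed.

(** The two steps 2 y and lam - 2 y + w lower the walk by 2 w, where w is as large
    as the level lam + del permits; [walk_even_bound] is attained in this way. *)
Lemma walk_even_exists lam del p y : (del + 2 * y <= lam)%N -> (y <= p * del)%N ->
  exists2 s, size s = (2 * p)%N & walk_ok (lam + del) lam (del + 2 * y) s.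
Proof.
elim: p y => [|p IHp] y le_lam le_y.
  by exists [::] => //=; apply/eqP; move: le_y; rewrite mul0n leqn0 => /eqP->; lia.
pose w := minn del y.
have [s sz ok] := IHp (y - w)%N ltac:(lia) ltac:(rewrite /w; nia).
exists [:: (2 * y)%N, (lam - 2 * y + w)%N & s]; first by rewrite /= sz mulnS.
rewrite /=; have -> : (del + 2 * y + lam - 2 * (2 * y) + lam - 2 * (lam - 2 * y + w) = del + 2 * (y - w))%N.
  by rewrite /w; lia.
by rewrite ok andbT; apply/and3P; split; [lia|lia|apply/and4P; split; rewrite /w; lia].
Qed.

(** In the top degree the level l is e for odd n; for even n it is the least number
    of the right parity allowed by [walk_even_bound]. *)
Lemma valid_set_hdeg_neq0 n e : (0 < n)%N -> (0 < #|valid_set n e (hdeg n e.+1)|)%N.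
Proof.
move=> n_gt0; set D := hdeg n e.+1.
have [l [lE le_el even_n]] := hdeg_level n_gt0 (leqnn D).
rewrite (card_valid_set lE).
suffices [s sz ok] : exists2 s, size s = n & walk_ok l e e s.
  have : s \in walks l e n e by rewrite mem_walks sz eqxx.
  by case: (walks _ _ _ _).
have max_D : ~~ (D.+1 <= hdeg n e.+1)%N by rewrite -/D ltnn.
rewrite leq_hdeg in max_D.
have [n_odd|n_even] := boolP (odd n).
  rewrite n_odd in max_D.
  have n2 : n = (2 * n./2).+1 by rewrite -[LHS]odd_double_half n_odd mul2n.
  have le : (l = e)%N.
    have : (2 * D <= (n + 1) * e)%N by have := leqnn D; rewrite {2}/D leq_hdeg n_odd.
    move: max_D; rewrite -ltnNge; rewrite n2 in lE *; nia.
  by rewrite n2 le; apply: walk_odd_exists.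
rewrite (negbTE n_even) in max_D.
have n2 : n = (2 * n./2)%N by rewrite mul2n even_halfK.
have bnd := even_n n_even.
pose del := (l - e)%N; pose y := (e - l./2)%N.
have l2 : l = (2 * l./2)%N.
  rewrite mul2n even_halfK //; have := congr1 odd lE.
  by rewrite oddD oddM /= addbF oddM oddD (negbTE n_even) /= => ->.
have le_l : (l <= 2 * e)%N.
  move: max_D; rewrite -ltnNge => max_D; rewrite leqNgt; apply/negP => lt_l.
  have lt_l2 : (2 * e + 2 <= l)%N by lia.
  nia.
have [||s sz ok] := @walk_even_exists e del n./2 y.
- by rewrite /del /y; lia.
- by rewrite /del /y; nia.
exists s; first by rewrite sz -n2.
move: ok; rewrite (_ : e + del = l)%N; last by rewrite /del; lia.
by rewrite (_ : del + 2 * y = e)%N //; rewrite /del /y; lia.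
Qed.

Theorem theorem3p1 (K : fieldType) (charK : [pchar K] =i pred0)
    (n d : nat) (n_gt0 : (0 < n)%N) (d_gt0 : (0 < d)%N) :
  for_general (fun A : 'M[K]_(n + 2, n) =>
    exists H : {poly int},
      [/\ has_hilbert_series (power_ideal A d) H,
          H = \sum_(0 <= i < (hdeg n d).+1) hcoef n d i *: 'X^i
        & size H = (hdeg n d).+1]).
Proof.
case: d d_gt0 => // e _.
have [U [U_open U_ne U_dim]] := generic_graded_dim n e charK.
exists U; split=> // A /U_dim dimA.
pose H := \poly_(i < (hdeg n e.+1).+1) hcoef n e.+1 i; exists H; split.
- move=> i; exists #|valid_set n e i|; first exact: dimA.
  rewrite coef_poly ltnS; case: leqP => [le_i|lt_i]; first exact: hcoef_card.
  case: (posnP #|valid_set n e i|) => [-> //|/(valid_set_hdeg n_gt0)].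
  by rewrite leqNgt lt_i.
- by rewrite /H poly_def big_mkord.
rewrite size_poly_eq // hcoef_card // eqz_nat -lt0n.
exact: valid_set_hdeg_neq0.
Qed.
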